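(* Let $(\Omega,\mathbb P)$ be a non purely atomic probability space and $\Psi$ an Orlicz function (with the standing assumptions below) whose complementary function $\Phi$ satisfies the $\Delta_2$ condition. Then the Orlicz space $L^\Psi(\Omega,\mathbb P)$ has Pe{\l}czy\'nski's property $(V)$.
   Context: An Orlicz function is a non-decreasing convex $\Psi\colon[0,\infty]\to[0,\infty]$ with $\Psi(0)=0$, $\Psi(\infty)=\infty$; it is assumed moreover continuous at $0$, strictly convex, and with $\Psi(x)/x\to\infty$ as $x\to\infty$. $L^\Psi(\Omega)$ is the space of (classes of) measurable $f\colon\Omega\to\mathbb C$ such that $\int_\Omega\Psi(|f|/C)\,d\mathbb P<\infty$ for some $C>0$, with the Luxemburg norm $\|f\|_\Psi=\inf\{C>0:\int_\Omega\Psi(|f|/C)\,d\mathbb P\le1\}$. The complementary function is $\Phi(x)=\sup_{y\ge0}(xy-\Psi(y))$. A function $\Phi$ satisfies $\Delta_2$ if there are $K>0$, $x_0>0$ with $\Phi(2x)\le K\Phi(x)$ for all $x\ge x_0$. A Banach space $X$ has Pe{\l}czy\'nski's property $(V)$ if for every Banach space $Z$ and every non-weakly compact operator $T\colon X\to Z$ there is a subspace $X_0\subseteq X$ isomorphic to $c_0$ such that $T|_{X_0}$ is an isomorphism onto $T(X_0)$ (equivalently: every subset $A\subseteq X^\ast$ with $\lim_n\sup_{x^\ast\in A}|x^\ast(x_n)|=0$ for all weakly unconditionally Cauchy sequences $(x_n)$ in $X$ is relatively weakly compact). *)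

(* Defs.v *)
From HB Require Import structures.
From mathcomp Require Import all_boot all_order all_algebra.
From mathcomp Require Import all_classical all_reals all_analysis.
From mathcomp.real_closed Require Import complex.
Set Implicit Arguments. Unset Strict Implicit. Unset Printing Implicit Defensive.
Import Order.TTheory GRing.Theory Num.Theory numFieldNormedType.Exports.
Local Open Scope ring_scope.
Local Open Scope classical_set_scope.

(* The complex field C = R[i], packaged as a numClosedFieldType so that it
   gets its canonical topology / normed-module structure. *)
Definition Cplx (R : realType) : numClosedFieldType := R[i].

Section Orlicz.
Variable R : realType.
Local Open Scope ereal_scope.

(* Psi : [0,oo] -> [0,oo], represented as a map \bar R -> \bar R of which
   only the values on [0,+oo] matter. *)
Definition Orlicz_function (Psi : \bar R -> \bar R) : Prop :=
  Psi 0 = 0 /\ Psi +oo = +oo /\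
      (forall x, 0 <= x -> 0 <= Psi x) /\
      (forall x y, 0 <= x -> x <= y -> Psi x <= Psi y) /\
      (* convex on [0,oo) (on [0,oo] it then follows from Psi +oo = +oo) *)
      (forall (x y t : R), (0 <= x)%R -> (0 <= y)%R -> (0 <= t <= 1)%R ->
         Psi (t * x + (1 - t) * y)%R%:E <= t%:E * Psi x%:E + (1 - t)%:E * Psi y%:E) /\
      ((fun x : R => Psi x%:E) @ at_right 0%R --> 0) /\
      (forall (x y t : R), (0 <= x)%R -> (0 <= y)%R -> x != y -> (0 < t < 1)%R ->
         Psi (t * x + (1 - t) * y)%R%:E < t%:E * Psi x%:E + (1 - t)%:E * Psi y%:E) /\
      ((fun x : R => Psi x%:E * (x^-1)%:E) @ +oo%R --> +oo).

Definition complementary (Psi : \bar R -> \bar R) (x : R) : \bar R :=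
  ereal_sup [set (x * y)%:E - Psi y%:E | y in [set y : R | (0 <= y)%R]].

Definition Delta2 (Phi : R -> \bar R) : Prop :=
  exists K : R, exists x0 : R, (0 < K)%R /\ (0 < x0)%R /\
    forall x : R, (x0 <= x)%R -> Phi (2 * x)%R <= K%:E * Phi x.
End Orlicz.

Section Atoms.
Local Open Scope ereal_scope.
Context (d : measure_display) (T : measurableType d) (R : realType).

Definition is_atom (P : probability T R) (A : set T) : Prop :=
  measurable A /\ 0 < P A /\
  forall B, measurable B -> B `<=` A -> P B = 0 \/ P B = P A.

Definition purely_atomic (P : probability T R) : Prop :=
  forall A, measurable A -> 0 < P A -> exists B, B `<=` A /\ is_atom P B.
End Atoms.

Section OrliczSpace.
Local Open Scope ereal_scope.
Context (d : measure_display) (T : measurableType d) (R : realType).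
Variables (P : probability T R) (Psi : \bar R -> \bar R).

Definition cmeasurable (f : T -> Cplx R) : Prop :=
  measurable_fun setT (fun x => complex.Re (f x : R[i])) /\
  measurable_fun setT (fun x => complex.Im (f x : R[i])).

Definition orlicz_modular (f : T -> Cplx R) (C : R) : \bar R :=
  \int[P]_x Psi (ComplexField.Normc.normc (f x : R[i]) / C)%R%:E.

Definition in_orlicz (f : T -> Cplx R) : Prop :=
  cmeasurable f /\ exists C : R, (0 < C)%R /\ orlicz_modular f C < +oo.

Definition luxemburg (f : T -> Cplx R) : \bar R :=
  ereal_inf [set C%:E | C in [set C : R | (0 < C)%R /\ orlicz_modular f C <= 1]].
End OrliczSpace.

Definition rnorm (R : realType) (Z : normedModType (Cplx R)) (z : Z) : R :=
  complex.Re (`|z| : R[i]).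

Section Weak.
Variable R : realType.
Variable Z : normedModType (Cplx R).

Definition cdual := {phi : Z -> Cplx R |
  (forall (a : Cplx R) x y, phi (a *: x + y) = a * phi x + phi y) /\ continuous phi}.

Definition weak_eval (z : Z) : {ptws cdual -> Cplx R} := fun phi => proj1_sig phi z.

Definition weakly (_ : phantom Type Z) := initial_topology weak_eval.

Definition rel_weakly_compact (A : set Z) : Prop :=
  precompact (A : set (weakly (Phantom Type Z))).
End Weak.

Section C0.
Variable R : realType.
Definition in_c0 (u : nat -> Cplx R) : Prop := u @ \oo --> (0 : Cplx R).
Definition c0_norm (u : nat -> Cplx R) : \bar R :=
  ereal_sup [set (ComplexField.Normc.normc (u n : R[i]))%:E | n in [set: nat]].
End C0.

Section PropertyV.
Local Open Scope ereal_scope.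
Context (d : measure_display) (T : measurableType d) (R : realType).
Variables (P : probability T R) (Psi : \bar R -> \bar R).

Local Notation X := (in_orlicz P Psi).
Local Notation nX := (luxemburg P Psi).

(* Top is (a representative-level description of) a bounded linear
   operator L^Psi -> Z. *)
Definition bounded_linear_on_orlicz (Z : normedModType (Cplx R))
    (Top : (T -> Cplx R) -> Z) : Prop :=
  (forall (a : Cplx R) f g, X f -> X g ->
     Top (fun x => a * f x + g x)%R = (a *: Top f + Top g)%R) /\
  exists M : R, forall f, X f -> (rnorm (Top f))%:E <= M%:E * nX f.

Definition weakly_compact_op (Z : normedModType (Cplx R))
    (Top : (T -> Cplx R) -> Z) : Prop :=
  rel_weakly_compact [set Top f | f in [set f | X f /\ nX f <= 1]].

(* J : c_0 -> L^Psi is an isomorphic embedding (linear modulo null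
   functions, two-sided norm bounds), and Top restricted to its range
   X0 = J(c_0) is an isomorphism onto Top(X0). *)
Definition fixes_c0 (Z : normedModType (Cplx R)) (Top : (T -> Cplx R) -> Z) : Prop :=
  exists J : (nat -> Cplx R) -> (T -> Cplx R),
    [/\ (forall u, in_c0 u -> X (J u)),
        (forall (a : Cplx R) u v, in_c0 u -> in_c0 v ->
           nX (fun x => J (fun n => a * u n + v n)%R x - (a * J u x + J v x))%R = 0),
        (exists c1 c2 : R, (0 < c1)%R /\ (0 < c2)%R /\
           forall u, in_c0 u -> c1%:E * c0_norm u <= nX (J u) /\ nX (J u) <= c2%:E * c0_norm u)
      & (exists c : R, (0 < c)%R /\
           forall u, in_c0 u -> c%:E * c0_norm u <= (rnorm (Top (J u)))%:E)].

Definition orlicz_property_V : Prop :=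
  forall (Z : completeNormedModType (Cplx R)) (Top : (T -> Cplx R) -> Z),
    bounded_linear_on_orlicz Top -> ~ weakly_compact_op Top -> fixes_c0 Top.
End PropertyV.

(* Main.v *)
Require Import Defs.
From HB Require Import structures.
From mathcomp Require Import all_boot all_order all_algebra.
From mathcomp Require Import all_classical all_reals all_analysis.
From mathcomp.real_closed Require Import complex.
From mathcomp Require Import ring lra measurable_realfun.
Set Implicit Arguments. Unset Strict Implicit. Unset Printing Implicit Defensive.
Import Order.TTheory GRing.Theory Num.Theory numFieldNormedType.Exports.
Local Open Scope ring_scope.
Local Open Scope classical_set_scope.

(* The contrapositive is proved: if [Top] fixes no copy of c_0, the image of the
   unit ball is relatively weakly compact. By an argument in the style of James,
   this follows once every sequence [f_k] in the ball admits, for each [e], convex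
   combinations [u] of [f_0, ..., f_{m-1}] and [v] of [f_m, f_{m+1}, ...] with
   [|Top u - Top v| < e].

   Minimizing the strictly convex functional [\int sqrt (1 + g^2)] over the convex
   hulls of the tails yields convex blocks converging in measure to some [f] in
   L^Psi. A subsequence of the differences splits as (uniformly small) + (pairwise
   disjoint) + (dominated by one function [s] of L^Psi). Since the complementary
   function satisfies Delta_2, [Psi] satisfies nabla_2, and averages of a disjoint
   bounded sequence tend to 0 in norm. On the order interval [[-s, s]], finitely
   many of the finitely additive measures [A |-> |phi o Top| (s 1_A)] control [Top]
   up to [e]: otherwise one extracts disjoint elements of the interval on which
   [Top] stays bounded below, and Rosenthal's lemma produces a copy of c_0 fixed by
   [Top]. Minimizing [sqrt (s^2 + t^2)] against these measures finishes the proof. *)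

(** The obstacle is that the norm of L^Psi need not be order continuous, because [Psi] itself may
    fail Delta_2. The measures [A |-> |phi o Top| (s 1_A)] are then only finitely additive and need
    not be controlled by [P], and cutting [s] down to sets of small probability need not make its
    norm small. This is why elements of [[[-s, s]]] are compared through functionals on the range of
    [Top], and why truncations are estimated in the modular, where dominated convergence holds. Both
    minimizations rest on one fact: near-minimizers over a decreasing sequence of convex sets have a
    small midpoint gap, which strict convexity turns into closeness, so that no minimizer has to
    exist and no compactness is involved. Working with tails of convex hulls makes each new block a
    block of the previous ones; estimates that are convex in the block therefore survive the later
    passes. *)

Section RealNorm.
Variables (R : realType) (Z : normedModType (Cplx R)).
Implicit Types (x y z : Z) (t : R).
Local Notation toC := (@real_complex R : R -> Cplx R).

Lemma normr_rnorm z : `|z| = toC (rnorm z) :> Cplx R.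
Proof.
have := normr_ge0 z; rewrite /rnorm; case: (`|z| : R[i]) => a b.
by rewrite lecE /= => /andP[/eqP -> _].
Qed.

Lemma normc_normr (a : Cplx R) : `|a| = toC (ComplexField.Normc.normc (a : R[i])).
Proof. by []. Qed.

Lemma toC_le t1 t2 : (toC t1 <= toC t2 :> Cplx R) = (t1 <= t2).
Proof. exact: lecR. Qed.

Lemma toC_lt t1 t2 : (toC t1 < toC t2 :> Cplx R) = (t1 < t2).
Proof. exact: ltcR. Qed.

Lemma toCD t1 t2 : toC (t1 + t2) = toC t1 + toC t2.
Proof. exact: (rmorphD (real_complex R)). Qed.

Lemma toCM t1 t2 : toC (t1 * t2) = toC t1 * toC t2.
Proof. exact: (rmorphM (real_complex R)). Qed.

Lemma toCB t1 t2 : toC (t1 - t2) = toC t1 - toC t2.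
Proof. exact: (rmorphB (real_complex R)). Qed.

Lemma toCN t1 : toC (- t1) = - toC t1.
Proof. exact: (rmorphN (real_complex R)). Qed.

Lemma rnorm_ge0 z : 0 <= rnorm z.
Proof. by rewrite -toC_le -normr_rnorm; exact: normr_ge0. Qed.

Lemma rnormD x y : rnorm (x + y) <= rnorm x + rnorm y.
Proof.
rewrite -toC_le toCD -!normr_rnorm; exact: ler_normD.
Qed.

Lemma rnormZ (a : Cplx R) z :
  rnorm (a *: z) = ComplexField.Normc.normc (a : R[i]) * rnorm z.
Proof.
have := normrZ a z; rewrite !normr_rnorm normc_normr -toCM; exact: complexI.
Qed.

Lemma normc_toC t : ComplexField.Normc.normc (toC t : R[i]) = `|t|.
Proof. by rewrite /= expr0n addr0 sqrtr_sqr. Qed.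

Lemma rnormZr t z : rnorm (toC t *: z) = `|t| * rnorm z.
Proof. by rewrite rnormZ normc_toC. Qed.

Lemma rnorm0 : rnorm (0 : Z) = 0.
Proof. by rewrite /rnorm normr0. Qed.

Lemma rnormN z : rnorm (- z) = rnorm z.
Proof. by rewrite /rnorm normrN. Qed.

Lemma rnorm_eq0 z : rnorm z = 0 -> z = 0.
Proof. by move=> z0; apply: normr0_eq0; rewrite normr_rnorm z0. Qed.

Lemma rnorm_distC x y : rnorm (x - y) = rnorm (y - x).
Proof. by rewrite -rnormN opprB. Qed.

End RealNorm.

(** * Norming functionals *)

Section HahnBanach.
Variables (R : realType) (Z : normedModType (Cplx R)).
Implicit Types (x y z : Z) (t : R) (q : Z -> R).
Local Notation toC := (@real_complex R : R -> Cplx R).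

Definition sublinear q :=
  (forall x y, q (x + y) <= q x + q y) /\
  (forall t x, 0 <= t -> q (toC t *: x) = t * q x).

Lemma sublinear0 q : sublinear q -> q 0 = 0.
Proof. by move=> [_ /(_ 0 0 (lexx 0))]; rewrite scaler0 mul0r. Qed.

Lemma sublinear_opp q x : sublinear q -> - q (- x) <= q x.
Proof.
move=> sq; have := sq.1 x (- x); rewrite subrr (sublinear0 sq); lra.
Qed.

(* The largest sublinear functional below [q] taking the value [- q y] at
   [- y]; a minimal [q] equals all of these, hence is additive. *)
Definition shave q y z := inf [set q (z + toC t *: y) - t * q y | t in [set t | 0 <= t]].

Lemma shave_lb q y z t : sublinear q -> 0 <= t ->
  - q (- z) <= q (z + toC t *: y) - t * q y.
Proof.
move=> sq t0; have := sq.1 (- z) (z + toC t *: y).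
by rewrite addKr (sq.2 _ _ t0); lra.
Qed.

Lemma shave_le q y z t : sublinear q -> 0 <= t ->
  shave q y z <= q (z + toC t *: y) - t * q y.
Proof.
move=> sq t0; apply: ge_inf; last by exists t.
by exists (- q (- z)) => _ [u /= u0 <-]; exact: shave_lb.
Qed.

Lemma shave_le_self q y z : sublinear q -> shave q y z <= q z.
Proof.
move=> sq; have := @shave_le q y z 0 sq (lexx 0).
by rewrite scale0r addr0 mul0r subr0.
Qed.

Lemma shave_ge q y z r : (forall t, 0 <= t -> r <= q (z + toC t *: y) - t * q y) ->
  r <= shave q y z.
Proof.
move=> h; apply: lb_le_inf; first by exists (q (z + toC 0 *: y) - 0 * q y); exists 0 => /=.
by move=> _ [t /= t0 <-]; exact: h.
Qed.

Lemma shave_sublinear q y : sublinear q -> sublinear (shave q y).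
Proof.
move=> sq; split=> [x z|t x].
  rewrite -lerBlDl; apply: shave_ge => t t0; rewrite lerBlDr -lerBlDl.
  apply: shave_ge => u u0; rewrite lerBlDr.
  apply: (le_trans (shave_le y (x + z) sq (addr_ge0 u0 t0))).
  have := sq.1 (x + toC u *: y) (z + toC t *: y).
  rewrite addrACA -scalerDl -toCD; lra.
rewrite le_eqVlt => /orP[/eqP <-|t0].
  rewrite scale0r mul0r; apply/eqP; rewrite eq_le; apply/andP; split.
    by have := shave_le_self y 0 sq; rewrite (sublinear0 sq).
  by apply: shave_ge => u u0; rewrite add0r (sq.2 _ _ u0) subrr.
apply/eqP; rewrite eq_le; apply/andP; split.
  rewrite -ler_pdivrMl//; apply: shave_ge => u u0; rewrite ler_pdivrMl//.
  apply: (le_trans (shave_le y _ sq (mulr_ge0 (ltW t0) u0))).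
  by rewrite toCM -scalerA -scalerDr (sq.2 _ _ (ltW t0)) mulrBr mulrA.
apply: shave_ge => u u0.
have ut : 0 <= t^-1 * u by rewrite mulr_ge0// invr_ge0 ltW.
have := shave_le y x sq ut; rewrite -(ler_pM2l t0) => /le_trans; apply.
rewrite mulrBr -(sq.2 _ _ (ltW t0)) scalerDr scalerA -toCM mulrA.
by rewrite !mulrA divff ?gt_eqF// !mul1r.
Qed.

(** Zorn's lemma for the reversed pointwise order. The lower bound [- p (- z)] keeps the infima over
    a chain finite. *)
Lemma sublinear_minimal p : sublinear p ->
  exists q, [/\ sublinear q, (forall z, q z <= p z) &
    forall q', sublinear q' -> (forall z, q' z <= q z) -> q' = q].
Proof.
move=> sp; pose S := {q : Z -> R | sublinear q /\ forall z, q z <= p z}.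
pose rel (a b : S) := `[< forall z, sval b z <= sval a z >].
have [||||[q [sq qp]] qmin] := @Zorn S rel.
- by move=> a; apply/asboolP.
- move=> r s t /asboolP rs /asboolP st; apply/asboolP => z.
  exact: le_trans (st z) (rs z).
- move=> [s ps] [t pt] /asboolP /= st /asboolP /= ts.
  have e : s = t by apply/funext => z; apply/eqP; rewrite eq_le st ts.
  by subst t; congr exist; exact: Prop_irrelevance.
- move=> A Atot; have [A0|/eqP/set0P[a0 Aa0]] := pselect (A = set0).
    by exists (exist _ p (conj sp (fun z => lexx _))) => s; rewrite A0.
  pose m z := inf [set sval a z | a in A].
  have lbm z : lbound [set sval a z | a in A] (- p (- z)).
    move=> _ [[a [sa pa]] _ <-] /=.
    by apply: le_trans (sublinear_opp z sa); rewrite lerN2.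
  have m_le a z : A a -> m z <= sval a z.
    by move=> Aa; apply: ge_inf; [exists (- p (- z)); exact: lbm|exists a].
  have m_ge r z : (forall a, A a -> r <= sval a z) -> r <= m z.
    move=> h; apply: lb_le_inf; first by exists (sval a0 z); exists a0.
    by move=> _ [a Aa <-]; exact: h.
  have sm : sublinear m.
    split=> [x y|t x t0].
      rewrite -lerBlDl; apply: (m_ge) => a Aa; rewrite lerBlDr -lerBlDl.
      apply: (m_ge) => b Ab; rewrite lerBlDr.
      (* In a chain the smaller of two members serves both arguments, which makes the infimum
         subadditive. *)
      have [/asboolP ab|/asboolP ba] := Atot _ _ Aa Ab.
        apply: (le_trans (m_le b _ Ab)); apply: (le_trans ((svalP b).1.1 _ _)).
        by rewrite lerD2l.
      apply: (le_trans (m_le a _ Aa)); apply: (le_trans ((svalP a).1.1 _ _)).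
      by rewrite lerD2r.
    move: t0; rewrite le_eqVlt => /orP[/eqP <-|t0].
      rewrite scale0r mul0r; apply/eqP; rewrite eq_le.
      rewrite (le_trans (m_le a0 _ Aa0)) ?(sublinear0 (svalP a0).1)//=.
      by apply: (m_ge) => a _; rewrite (sublinear0 (svalP a).1).
    apply/eqP; rewrite eq_le; apply/andP; split.
      rewrite -ler_pdivrMl//; apply: (m_ge) => a Aa; rewrite ler_pdivrMl//.
      by apply: (le_trans (m_le a _ Aa)); rewrite ((svalP a).1.2 _ _ (ltW t0)).
    apply: (m_ge) => a Aa; rewrite ((svalP a).1.2 _ _ (ltW t0)) ler_pM2l//.
    exact: m_le.
  have mp z : m z <= p z by apply: (le_trans (m_le a0 z Aa0)); exact: (svalP a0).2.
  exists (exist _ m (conj sm mp)) => a Aa; apply/asboolP => z /=; exact: m_le.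
exists q; split => // q' sq' q'q.
have q'p z : q' z <= p z by exact: le_trans (q'q z) (qp z).
have := qmin (exist _ q' (conj sq' q'p)).
move=> /(_ (asboolT _))/=; move=> /(_ q'q) [->//].
Qed.

(** A minimal sublinear functional equals each of its shaved versions; [shave q y x = q x] taken at
    [t = 1] gives [q x + q y <= q (x + y)], hence additivity. *)
Lemma dominated_real_functional z0 : exists q : Z -> R,
  [/\ forall x y, q (x + y) = q x + q y,
      forall t x, q (toC t *: x) = t * q x,
      forall z, q z <= rnorm z & q z0 = rnorm z0].
Proof.
have sp : sublinear (@rnorm R Z).
  by split=> [x y|t x t0]; [exact: rnormD|rewrite rnormZr ger0_norm].
(* Shaving the norm at [z0] before minimizing forces [q (- z0) <= - rnorm z0], so that [q] norms
   [z0]. *)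
have [q [sq qp qmin]] := sublinear_minimal (shave_sublinear z0 sp).
have qadd x y : q (x + y) = q x + q y.
  apply/eqP; rewrite eq_le sq.1/=.
  have := qmin _ (shave_sublinear y sq) (fun z => shave_le_self y z sq).
  move=> /(congr1 (fun f => f x)) <-.
  have := shave_le y x sq ler01; rewrite scale1r mul1r; lra.
have q0 := sublinear0 sq.
have qN x : q (- x) = - q x.
  by have := qadd x (- x); rewrite subrr q0; lra.
exists q; split=> // [t x|z|].
- have [t0|t0] := leP 0 t; first exact: sq.2.
  have tN : 0 <= - t by rewrite oppr_ge0 ltW.
  by have := sq.2 _ x tN; rewrite toCN scaleNr qN mulNr => /oppr_inj.
- exact: le_trans (qp z) (shave_le_self z0 z sp).
- apply/eqP; rewrite eq_le (le_trans (qp z0) (shave_le_self z0 z0 sp))/=.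
  have := le_trans (qp (- z0)) (shave_le z0 (- z0) sp ler01).
  rewrite scale1r addNr rnorm0 mul1r qN; lra.
Qed.

(** The complex-linear functionals of norm at most 1. A bound on the real part suffices: multiplying
    the argument by a unimodular scalar turns it into a bound on the modulus. *)
Definition dual_ball (phi : Z -> Cplx R) :=
  (forall (a : Cplx R) x y, phi (a *: x + y) = a * phi x + phi y) /\
  (forall z, complex.Re (phi z : R[i]) <= rnorm z).

(** The real functional [q] is complexified as [q z - i q (i z)], whose real part is [q]. *)
Lemma norming_functional z0 : exists phi : Z -> Cplx R,
  dual_ball phi /\ complex.Re (phi z0 : R[i]) = rnorm z0.
Proof.
have [q [qD qZ qle qz0]] := dominated_real_functional z0.
pose phi (z : Z) : Cplx R := (q z +i* - q (('i%C : Cplx R) *: z))%C.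
exists phi; split=> //; split=> //= a x y.
have q0 : q 0 = 0 by have := qD 0 0; rewrite addr0; lra.
have qN z : q (- z) = - q z by have := qD z (- z); rewrite subrr q0; lra.
have qC (c : Cplx R) z :
    q (c *: z) = complex.Re (c : R[i]) * q z + complex.Im (c : R[i]) * q (('i%C : Cplx R) *: z).
  have -> : c = toC (complex.Re (c : R[i])) + toC (complex.Im (c : R[i])) * ('i%C : Cplx R).
    by rewrite {1}[c]complexE mulrC.
  rewrite scalerDl qD -scalerA !qZ.
  by case: c => u v /=; congr (_ * _ + _ * _); ring.
rewrite /phi scalerDr !qD scalerA (qC a) (qC (_ * a)); case: a => u v /=.
by apply/eqP; rewrite eq_complex /=; apply/andP; split; apply/eqP; ring.
Qed.

End HahnBanach.

(** * The unit ball of the complex dual *)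

Section DualBall.
Variables (R : realType) (Z : normedModType (Cplx R)).
Implicit Types (x y z : Z) (t : R) (phi : Z -> Cplx R).
Local Notation toC := (@real_complex R : R -> Cplx R).
Local Notation normc := (@ComplexField.Normc.normc R).
Local Notation re phi z := (complex.Re (phi z : R[i])).

Section Linear.
Variable phi : Z -> Cplx R.
Hypothesis lin : forall (a : Cplx R) x y, phi (a *: x + y) = a * phi x + phi y.

Lemma lin0 : phi 0 = 0.
Proof.
have := lin 1 0 0; rewrite scaler0 addr0 mul1r => /eqP.
by rewrite -subr_eq subrr eq_sym => /eqP.
Qed.

Lemma linD x y : phi (x + y) = phi x + phi y.
Proof. by have := lin 1 x y; rewrite scale1r mul1r. Qed.

Lemma linZ (a : Cplx R) x : phi (a *: x) = a * phi x.
Proof. by have := lin a x 0; rewrite lin0 !addr0. Qed.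

Lemma linN x : phi (- x) = - phi x.
Proof. by rewrite -scaleN1r linZ mulN1r. Qed.

Lemma linB x y : phi (x - y) = phi x - phi y.
Proof. by rewrite linD linN. Qed.

Lemma re_linD x y : re phi (x + y) = re phi x + re phi y.
Proof. by rewrite linD; case: (phi x) => ? ?; case: (phi y). Qed.

Lemma re_linZ t x : re phi (toC t *: x) = t * re phi x.
Proof. by rewrite linZ; case: (phi x) => a b /=; rewrite mul0r subr0. Qed.

Lemma re_linN x : re phi (- x) = - re phi x.
Proof. by rewrite linN; case: (phi x). Qed.

Lemma re_linB x y : re phi (x - y) = re phi x - re phi y.
Proof. by rewrite re_linD re_linN. Qed.

End Linear.

Lemma norm_re_normc (w : R[i]) : `|complex.Re w| <= normc w.
Proof. by rewrite -toC_le; exact: normc_ge_Re. Qed.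

Lemma normc_rotation (w : R[i]) : exists a : Cplx R, normc a = 1 /\ a * w = toC (normc w).
Proof.
have [->|w0] := eqVneq w 0.
  by exists 1; rewrite mulr0 ComplexField.Normc.normc0 ComplexField.Normc.normc1.
have nw0 : normc w != 0 by apply: contra_neq w0; exact: ComplexField.Normc.eq0_normc.
exists (toC (normc w) / w : Cplx R); split.
  rewrite ComplexField.Normc.normcM ComplexField.Normc.normcV.
  rewrite normc_toC ger0_norm ?divff//; case: (w) => a b; exact: sqrtr_ge0.
exact: mulfVK.
Qed.

Lemma dual_ball_normc phi z : dual_ball phi -> normc (phi z) <= rnorm z.
Proof.
move=> [lin le]; have [a [a1 e]] := normc_rotation (phi z).
by have := le (a *: z); rewrite (linZ lin) e rnormZ a1 mul1r.
Qed.

Lemma dual_ball_norm phi z : dual_ball phi -> `|re phi z| <= rnorm z.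
Proof.
move=> [lin le]; rewrite ler_norml le andbT.
by have := le (- z); rewrite re_linN// rnormN lerNl.
Qed.

Lemma dual_ball_continuous phi : dual_ball phi -> continuous phi.
Proof.
move=> B z; apply/cvgrPdist_lt => e e0; near=> y.
rewrite -(linB B.1); apply: (@le_lt_trans _ _ `|z - y|).
  by rewrite normc_normr normr_rnorm toC_le; exact: dual_ball_normc.
by near: y; move: e0; move: e; apply/cvgrPdist_lt.
Unshelve. all: by end_near. Qed.

(** The weak topology is defined with all continuous functionals; this reduces it to the dual ball.
    With [|phi| < 1] on the ball of radius [r], vectors are scaled to norm [r / 2] so as to lie
    strictly inside, hence the factor [2 / r]. *)
Lemma cdual_rescale (phi : cdual Z) : exists (C : R) (psi : Z -> Cplx R),
  [/\ 0 < C, dual_ball psi & forall z, sval phi z = toC C * psi z].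
Proof.
case: phi => phi [lin cont] /=.
have /cvgrPdist_lt/(_ _ (ltr01 : 0 < (1 : Cplx R))) := cont 0.
rewrite lin0// => /nbhs_ballP[e /= e0 he].
have [r re] : exists r : R, e = toC r.
  exists (complex.Re (e : R[i])); move: e0; case: (e) => a b.
  by rewrite /= ltcE /= => /andP[/eqP -> _].
have r0 : 0 < r by rewrite -toC_lt -re.
exists (2 / r), (fun z => toC (r / 2) * phi z); split; first by rewrite divr_gt0.
- split=> [a x y|z]; first by rewrite lin mulrDr mulrCA.
  rewrite -(linZ lin) re_linZ//.
  have [z0|z0] := eqVneq (rnorm z) 0.
    by rewrite (rnorm_eq0 z0) lin0//= mulr0 rnorm_ge0.
  have zgt0 : 0 < rnorm z by rewrite lt_neqAle eq_sym z0 rnorm_ge0.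
  have : ball (0 : Z) e (toC (r / 2 / rnorm z) *: z).
    rewrite -ball_normE /ball_ /= sub0r normrN normr_rnorm re toC_lt rnormZr.
    rewrite ger0_norm ?divfK//; last by rewrite !divr_ge0// ltW.
    by rewrite ltr_pdivrMr// mulr_natr mulr2n ltrDl.
  move=> /he; rewrite sub0r normrN normc_normr (_ : 1 = toC 1)// toC_lt => h.
  have := le_lt_trans (le_trans (ler_norm _) (norm_re_normc _)) h.
  by rewrite re_linZ// mulrAC ltr_pdivrMr// mul1r => /ltW.
- move=> z; rewrite mulrA -toCM.
  have -> : 2 / r * (r / 2) = 1 by field; rewrite gt_eqF.
  exact: esym (mul1r _).
Qed.

End DualBall.

(** * A criterion for weak compactness *)

Section Hull.
Variables (R : realType) (V : Type) (mix : R -> V -> V -> V).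

(** [mix] is left arbitrary because hulls are formed in [Z], among complex functions, and among
    pairs of a block and a function. *)
Inductive hull (S : set V) : V -> Prop :=
| hull_gen x : S x -> hull S x
| hull_mix t x y : 0 <= t <= 1 -> hull S x -> hull S y -> hull S (mix t x y).

Lemma hull_min (S C : set V) : S `<=` C ->
  (forall t x y, 0 <= t <= 1 -> C x -> C y -> C (mix t x y)) -> hull S `<=` C.
Proof. by move=> SC Cmix x; elim=> // t y z t01 _ Cy _ Cz; exact: Cmix. Qed.

Lemma hullS (S S' : set V) : S `<=` S' -> hull S `<=` hull S'.
Proof.
move=> SS'; apply: hull_min => [x /SS'|t x y t01 hx hy]; first exact: hull_gen.
exact: hull_mix.
Qed.

Lemma hull_initial (x : nat -> V) u : hull (range x) u ->
  exists m, hull [set x k | k in [set k | (k < m)%N]] u.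
Proof.
elim=> [_ [k _ <-]|t a b t01 _ [m ha] _ [n hb]].
  by exists k.+1; apply: hull_gen; exists k => /=.
exists (maxn m n); apply: hull_mix => //.
  by apply: hullS ha => _ [k /= km <-]; exists k => //=; rewrite leq_max km.
by apply: hullS hb => _ [k /= kn <-]; exists k => //=; rewrite leq_max kn orbT.
Qed.

End Hull.

Section WeakCompactness.
Variables (R : realType) (Z : completeNormedModType (Cplx R)).
Implicit Types (x y z : Z) (t : R) (phi : Z -> Cplx R).
Local Notation toC := (@real_complex R : R -> Cplx R).
Local Notation normc := (@ComplexField.Normc.normc R).
Local Notation re phi z := (complex.Re (phi z : R[i])).
Local Notation wZ := (weakly (Phantom Type Z)).

Definition cmix t x y : Z := toC t *: x + toC (1 - t) *: y.

Lemma weak_nbhs phi x e : dual_ball phi -> 0 < e ->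
  nbhs (x : wZ) [set y : wZ | `|re phi y - re phi x| < e].
Proof.
move=> Bphi e0.
pose p : cdual Z := exist _ phi (conj Bphi.1 (dual_ball_continuous Bphi)).
have c1 : (weak_eval (y : Z)) @[y --> (x : wZ)] --> weak_eval (x : Z).
  exact: (@initial_continuous _ _ (@weak_eval R Z) x).
have c2 : (fun g : {ptws cdual Z -> Cplx R} => g p) @ nbhs (weak_eval x) -->
    weak_eval x p.
  have /cvg_sup/(_ p) h : nbhs (weak_eval x) --> weak_eval x by exact: cvg_id.
  by move=> B nB; apply: h; exact: (@initial_continuous _ _
    (fun g : {ptws cdual Z -> Cplx R} => g p) (weak_eval x)).
have /cvgrPdist_lt/(_ (toC e)) : phi y @[y --> (x : wZ)] --> phi x.
  exact: cvg_comp c1 c2.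
rewrite (toC_lt 0) => /(_ e0); apply: filterS => y /=.
rewrite normc_normr toC_lt -(linB Bphi.1).
apply: le_lt_trans; rewrite -(re_linB Bphi.1) -normrN -(re_linN Bphi.1) opprB.
exact: norm_re_normc.
Qed.

Lemma weak_cvg (F : set_system wZ) z : Filter F ->
  (forall phi e, dual_ball phi -> 0 < e -> F [set y : wZ | `|re phi y - re phi z| < e]) ->
  F --> (z : wZ).
Proof.
move=> FF h.
have c : weak_eval (y : Z) @[y --> F] --> weak_eval z.
  apply/cvg_sup => p; have [C [phi [C0 Bphi pE]]] := cdual_rescale p.
  suff cp : weak_eval (y : Z) p @[y --> F] --> weak_eval z p.
    move=> A [_ [[W oW <-] Wz WA]].
    have /cp : nbhs (weak_eval z p) W by rewrite nbhsE; exists W.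
    rewrite nbhs_simpl => hW; rewrite nbhs_simpl.
    by apply: (@filterS _ F FF _ _ _ hW) => y; exact: WA.
  apply/cvgrPdist_lt => e e0.
  have [r er] : exists r : R, e = toC r.
    exists (complex.Re (e : R[i])); move: e0; case: (e) => a b.
    by rewrite /= ltcE /= => /andP[/eqP -> _].
  have r0 : 0 < r by rewrite -toC_lt -er.
  (* The real part of [- i phi] is the imaginary part of [phi], so real parts of functionals in the
     dual ball control complex values. *)
  pose phii y : Cplx R := - ('i%C : Cplx R) * phi y.
  have Bi : dual_ball phii.
    split=> [a x y|y]; first by rewrite /phii Bphi.1 mulrDr mulrCA.
    rewrite /phii -(linZ Bphi.1); apply: (le_trans (Bphi.2 _)).
    by rewrite rnormZ /= oppr0 expr0n sqrrN add0r expr1n sqrtr1 mul1r.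
  have r2 : 0 < r / C / 2 by rewrite !divr_gt0.
  have hI := @filterI _ F FF _ _ (h phi _ Bphi r2) (h phii _ Bi r2).
  apply: (@filterS _ F FF _ _ _ hI) => y /= [h1 h2].
  rewrite /weak_eval er !pE -mulrBr -(linB Bphi.1) normrM !normc_normr -toCM toC_lt.
  rewrite normc_toC gtr0_norm// -ltr_pdivlMl// mulrC.
  have : normc (phi (z - y)) <= `|re phi (z - y)| + `|re phii (z - y)|.
    rewrite /phii; case: (phi (z - y)) => a b /=.
    rewrite !oppr0 !mul0r !add0r mulN1r opprK.
    rewrite -(@ler_pXn2r _ 2) ?nnegrE ?addr_ge0 ?sqrtr_ge0// sqr_sqrtr ?addr_ge0 ?sqr_ge0//.
    rewrite sqrrD !real_normK ?num_real//.
    have := mulr_ge0 (normr_ge0 a) (normr_ge0 b); lra.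
  rewrite (re_linB Bphi.1) (re_linB Bi.1).
  rewrite [`|re phi z - _|]distrC [`|re phii z - _|]distrC; lra.
move=> A /= [_ [[B Bop <-] Bfs sBfA]].
have /c hB : nbhs (weak_eval z) B by rewrite nbhsE; exists B.
exact: (@filterS _ F FF _ _ _ hB).
Qed.

End WeakCompactness.

Lemma ultra_real_limit (R : realType) (X : Type) (V : set_system X) (g : X -> R) (M : R) :
  UltraFilter V -> V [set x | `|g x| <= M] ->
  exists r, forall e, 0 < e -> V [set x | `|g x - r| < e].
Proof.
move=> UV VM; have PV : ProperFilter V by exact: ultra_proper.
have PgV : ProperFilter (g @ V) by exact: fmap_proper_filter.
have gVM : (g @ V) `[- M, M]%classic.
  by apply: (@filterS _ V _ _ _ _ VM) => x; rewrite /= in_itv ler_norml.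
have [r [_ clr]] := segment_compact PgV gVM.
exists r => e e0; have [//|nV] := in_ultra_setVsetC [set x | `|g x - r| < e] UV.
have gN : (g @ V) [set y | ~ `|y - r| < e] by [].
have [y [/= ny yr]] := clr _ _ gN (nbhsx_ballx r _ e0).
by case: ny; move: yr; rewrite -ball_normE /ball_ /= distrC.
Qed.

Lemma archimedean_inv (R : realType) (e : R) : 0 < e -> exists n : nat, n.+1%:R^-1 < e.
Proof.
move=> e0; exists (Num.truncn e^-1); rewrite -[ltRHS]invrK ltf_pV2 ?posrE ?invr_gt0//.
exact: truncnS_gt.
Qed.

Section WeakCriterion.
Variables (R : realType) (Z : completeNormedModType (Cplx R)).
Implicit Types (x y z : Z) (t e th : R) (phi : Z -> Cplx R).
Local Notation toC := (@real_complex R : R -> Cplx R).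
Local Notation re phi z := (complex.Re (phi z : R[i])).
Local Notation wZ := (weakly (Phantom Type Z)).
Local Notation hull := (hull (@cmix R Z)).

(** The coefficients vary independently in [[0, 1]] and need not sum to 1. The set contains the hull
    of the first [m] terms and admits a finite net built one coordinate at a time. *)
Definition zonotope (x : nat -> Z) m u :=
  exists2 a : nat -> R, (forall i, 0 <= a i <= 1) & u = \sum_(i < m) toC (a i) *: x i.

Lemma hull_zonotope (x : nat -> Z) m :
  hull [set x k | k in [set k | (k < m)%N]] `<=` zonotope x m.
Proof.
apply: hull_min => [_ [k /= km <-]|t _ _ /andP[t0 t1] [a a01 ->] [b b01 ->]].
  exists (fun i => (i == k)%:R) => [i|]; first by case: eqP; rewrite /= ?lexx ler01.
  rewrite (bigD1 (Ordinal km))//= eqxx scale1r big1 ?addr0// => i ik.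
  by rewrite (_ : (i == k :> nat) = false) ?scale0r//; apply/negbTE.
exists (fun i => t * a i + (1 - t) * b i).
  move=> i; have /andP[a0 a1] := a01 i; have /andP[b0 b1] := b01 i; nra.
rewrite /cmix !scaler_sumr -big_split /=; apply: eq_bigr => i _.
by rewrite !scalerA -!toCM -scalerDl -toCD.
Qed.

Lemma zonotope_net (x : nat -> Z) m e : 0 < e ->
  exists S : seq Z, forall u, zonotope x m u -> exists2 z, z \in S & rnorm (u - z) <= e.
Proof.
elim: m e => [|m IH] e e0.
  exists [:: 0] => u [a _ ->]; exists 0; rewrite ?inE//.
  by rewrite big_ord0 subr0 rnorm0 ltW.
have [S SP] := IH _ (divr_gt0 e0 (ltr0n R 2)).
have e1 : 0 < (e / 2) / (rnorm (x m) + 1).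
  by rewrite !divr_gt0//; have := rnorm_ge0 (x m); lra.
have [N NP] := archimedean_inv e1.
(* [N.+2] grid values are listed because a coefficient equal to 1 is rounded to [k = N.+1]. *)
exists [seq z + toC (k%:R / N.+1%:R) *: x m | z <- S, k <- iota 0 N.+2] => u [a a01 ->].
have [z zS zP] : exists2 z, z \in S & rnorm (\sum_(i < m) toC (a i) *: x i - z) <= e / 2.
  by apply: SP; exists a.
have /andP[a0 a1] := a01 m.
pose k := Num.truncn (a m * N.+1%:R).
have aN0 : 0 <= a m * N.+1%:R by rewrite mulr_ge0.
have /andP[k1 k2] := truncn_itv aN0.
exists (z + toC (k%:R / N.+1%:R) *: x m).
  apply/allpairsP; exists (z, k); split; [exact: zS| |by []].
  rewrite -[_.2]/k mem_iota add0n leq0n andTb -(ltr_nat R).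
  apply: (le_lt_trans k1); apply: (@le_lt_trans _ _ N.+1%:R); rewrite ?ltr_nat//.
  by rewrite -[leRHS]mul1r ler_wpM2r.
rewrite big_ord_recr /= opprD addrACA -scalerBl -toCB.
apply: (le_trans (rnormD _ _)); rewrite (splitr e) lerD// rnormZr.
have N0 : 0 < N.+1%:R :> R by rewrite ltr0n.
have : `|a m - k%:R / N.+1%:R| <= N.+1%:R^-1.
  rewrite -(ler_pM2r N0) mulVf ?gt_eqF// -[X in `|_| * X](gtr0_norm N0) -normrM mulrBl.
  by rewrite divfK ?gt_eqF// ler_norml; move: k1 k2; rewrite -/k -natr1; lra.
move=> /le_trans/(_ (ltW NP)); have x0 := rnorm_ge0 (x m).
move=> /(ler_wpM2r x0)/le_trans; apply.
rewrite mulrAC ler_pdivrMr; last by lra.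
by rewrite ler_wpM2l ?divr_ge0 ?(ltW e0)//; lra.
Qed.

Section Limit.
Variable A : set Z.
Hypothesis Ablocks : forall x : nat -> Z, (forall k, A (x k)) -> forall e, 0 < e ->
  exists m u v, [/\ hull [set x k | k in [set k | (k < m)%N]] u,
    hull [set x k | k in [set k | (m <= k)%N]] v & rnorm (u - v) < e].
Variable xi : (Z -> Cplx R) -> R.
Hypothesis xiA : forall (s : seq (Z -> Cplx R)) e, (forall phi, List.In phi s -> dual_ball phi) ->
  0 < e -> exists2 a, A a & forall phi, List.In phi s -> `|re phi a - xi phi| < e.

(** If no [z] worked, each [z] would have a functional [F z] with [xi (F z)] further than [th] from
    its value at [z]. Points [x k] of [A] are picked so as to match [xi] nearly on [F z] for all [z]
    in finite nets of the hulls of earlier points. For blocks [u], [v] and a net point [z] near [u],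
    the values of [F z] at [z], [u], [v] and the number [xi (F z)] are then too close. *)
Lemma limit_approx th : 0 < th ->
  exists z, forall phi, dual_ball phi -> `|xi phi - re phi z| <= th.
Proof.
move=> th0; apply/not_existsP => nz.
have /choice[F FP] : forall z, exists phi, dual_ball phi /\ th < `|xi phi - re phi z|.
  move=> z; apply/not_existsP => h; apply: (nz z) => phi Bphi.
  by rewrite leNgt; apply/negP => lt; apply: (h phi).
(* The errors are [th / 8] from the net, [th / 2] from [u - v] and [th / 8] from the tail, together
   below [th]. *)
have th8 : 0 < th / 8 by rewrite divr_gt0.
have /choice[Nt NtP] : forall l : seq Z, exists S : seq Z, forall u,
    zonotope (nth 0 l) (size l) u -> exists2 z, z \in S & rnorm (u - z) <= th / 8.
  by move=> l; exact: zonotope_net.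
(* Nets for all prefixes are served, because the length [m] of the prefix spanning [u] is known only
   once the whole sequence is built. *)
have /choice[next nextP] : forall l : seq Z, exists a, A a /\
    forall j z, (j <= size l)%N -> z \in Nt (take j l) -> `|re (F z) a - xi (F z)| < th / 8.
  move=> l; pose s := [seq F z | j <- iota 0 (size l).+1, z <- Nt (take j l)].
  have sIn j z : (j <= size l)%N -> z \in Nt (take j l) -> List.In (F z) s.
    move=> jl zN; rewrite /s.
    have : j \in iota 0 (size l).+1 by rewrite mem_iota.
    elim: (iota _ _) => //= i r IH; rewrite inE => /orP[/eqP <-|/IH h].
      apply: List.in_or_app; left; elim: (Nt _) zN => //= y q IH2.
      by rewrite inE => /orP[/eqP ->|/IH2]; [left|right].
    by apply: List.in_or_app; right.
  have sB phi : List.In phi s -> dual_ball phi.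
    rewrite /s; elim: (iota _ _) => //= i r IH h; have [|/IH//] := List.in_app_or _ _ _ h.
    move=> {h}.
    by elim: (Nt _) => //= y q IH2 [<-|/IH2//]; exact: (FP y).1.
  by have [a Aa aP] := xiA sB th8; exists a; split=> // j z jl zN; apply/aP/sIn/zN.
pose pre := fix pre k := if k is k'.+1 then rcons (pre k') (next (pre k')) else [::].
pose x k := next (pre k).
have size_pre k : size (pre k) = k by elim: k => //= k IH; rewrite size_rcons IH.
have take_pre j k : (j <= k)%N -> take j (pre k) = pre j.
  elim: k => [|k IH]; first by rewrite leqn0 => /eqP ->.
  rewrite leq_eqVlt => /orP[/eqP ->|]; first by rewrite -{1}[k.+1]size_pre take_size.
  rewrite ltnS => jk; rewrite /= -cats1 takel_cat ?size_pre//; exact: IH.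
have nth_pre m i : (i < m)%N -> nth 0 (pre m) i = x i.
  move=> im; rewrite -(nth_take _ (ltnSn i)) take_pre//= nth_rcons.
  by rewrite size_pre ltnn eqxx.
have xA k : A (x k) by exact: (nextP _).1.
have [m [u [v [hu hv uv]]]] := Ablocks xA (divr_gt0 th0 (ltr0n R 2)).
have [z zN zu] : exists2 z, z \in Nt (pre m) & rnorm (u - z) <= th / 8.
  apply: NtP; rewrite size_pre; have [a a01 ->] := hull_zonotope hu.
  by exists a => //; apply: eq_bigr => i _; rewrite nth_pre.
have [BF ltF] := FP z.
(* The estimate is convex in the point, so it passes from the [x k] with [k >= m] to [v]. *)
have /= : [set w | `|re (F z) w - xi (F z)| <= th / 8] v.
  apply: (hull_min _ _ hv) => [_ [k /= mk <-]|t a b /andP[t0 t1]].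
    by apply/ltW/((nextP _).2 m); rewrite ?size_pre ?take_pre.
  rewrite /= /cmix (re_linD BF.1) !(re_linZ BF.1) !ler_norml => /andP[? ?] /andP[? ?].
  by apply/andP; split; nra.
have := dual_ball_norm (u - z) BF; have := dual_ball_norm (u - v) BF.
rewrite !(re_linB BF.1) => h1 h2 h3.
have : `|xi (F z) - re (F z) z| <= th.
  move: (le_trans h2 zu) (le_trans h1 (ltW uv)) h3.
  by rewrite !ler_norml => /andP[? ?] /andP[? ?] /andP[? ?]; apply/andP; split; lra.
by rewrite leNgt ltF.
Qed.

(** Approximations within [1 / (n + 1)] form a Cauchy sequence, by norming functionals; completeness
    of [Z] supplies the vector. *)
Lemma limit_attained : exists z, forall phi, dual_ball phi -> xi phi = re phi z.
Proof.
have /choice[z zP] : forall n : nat, exists z, forall phi, dual_ball phi ->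
    `|xi phi - re phi z| <= n.+1%:R^-1.
  by move=> n; apply: limit_approx; rewrite invr_gt0 ltr0n.
have zz m n : rnorm (z m - z n) <= m.+1%:R^-1 + n.+1%:R^-1.
  have [phi [Bphi <-]] := norming_functional (z m - z n).
  rewrite (re_linB Bphi.1); have := zP m _ Bphi; have := zP n _ Bphi.
  move: (m.+1%:R^-1) (n.+1%:R^-1) => a b.
  by rewrite !ler_norml => /andP[? ?] /andP[? ?]; lra.
have : cvg (z @ \oo).
  apply/cauchy_cvgP/cauchy_exP => e e0.
  have [r er] : exists r : R, e = toC r.
    exists (complex.Re (e : R[i])); move: e0; case: (e) => a b.
    by rewrite /= ltcE /= => /andP[/eqP -> _].
  have r0 : 0 < r / 2 by rewrite divr_gt0// -toC_lt -er.
  have [N NP] := archimedean_inv r0.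
  exists (z N); exists N => // n /= Nn.
  rewrite -ball_normE /ball_ /= er normr_rnorm toC_lt.
  apply: (le_lt_trans (zz _ _)).
  have : n.+1%:R^-1 <= N.+1%:R^-1 :> R by rewrite lef_pV2 ?posrE ?ltr0n// ler_nat.
  by move: NP; move: (n.+1%:R^-1) (N.+1%:R^-1) => a b; lra.
move=> /cvg_ex[/= l /cvgrPdist_lt zl]; exists l => phi Bphi.
apply/eqP; rewrite -subr_eq0 -normr_le0; apply/ler_addgt0Pr => e e0; rewrite add0r.
have e2 : 0 < e / 2 by rewrite divr_gt0.
have [N NP] := archimedean_inv e2.
have [K _ KP] := zl (toC (e / 2)) (etrans (toC_lt 0 (e / 2)) e2).
have := KP (maxn N K) (leq_maxr _ _); rewrite normr_rnorm toC_lt => h1.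
have h2 := zP (maxn N K) _ Bphi.
have h3 : (maxn N K).+1%:R^-1 <= N.+1%:R^-1 :> R.
  by rewrite lef_pV2 ?posrE ?ltr0n// ler_nat ltnS leq_maxl.
have h4 := dual_ball_norm (l - z (maxn N K)) Bphi; rewrite (re_linB Bphi.1) in h4.
have -> : xi phi - re phi l = (xi phi - re phi (z (maxn N K))) - (re phi l - re phi (z (maxn N K))).
  by ring.
apply: (le_trans (ler_normB _ _)); move: h2 h3 NP.
by move: ((maxn N K).+1%:R^-1) (N.+1%:R^-1) => a b; lra.
Qed.

End Limit.

(** The limits of [re phi] along an ultrafilter [V] on the weak closure form an element [xi] of the
    bidual. They exist by boundedness, and any finite number of them is nearly attained at a point
    of [A]; [limit_attained] then represents [xi] by a vector, to which [V] converges weakly. *)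
Lemma weakly_compact_of_blocks (A : set Z) (M : R) :
  (forall x, A x -> rnorm x <= M) ->
  (forall x : nat -> Z, (forall k, A (x k)) -> forall e, 0 < e ->
    exists m u v, [/\ hull [set x k | k in [set k | (k < m)%N]] u,
      hull [set x k | k in [set k | (m <= k)%N]] v & rnorm (u - v) < e]) ->
  rel_weakly_compact A.
Proof.
move=> AM Ablocks; rewrite /rel_weakly_compact precompactE compact_ultra => V UV VA.
have PV : ProperFilter V by exact: ultra_proper.
have clA x phi e : closure (A : set wZ) x -> dual_ball phi -> 0 < e ->
    exists2 a, A a & `|re phi a - re phi x| < e.
  move=> clx Bphi e0; have [a [Aa /= h]] := clx _ (weak_nbhs x Bphi e0).
  by exists a.
have /choice[xi xiP] : forall phi, exists r, dual_ball phi -> forall e, 0 < e ->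
    V [set x | `|re phi x - r| < e].
  move=> phi; have [Bphi|?] := pselect (dual_ball phi); last by exists 0.
  have [|r rP] := @ultra_real_limit R wZ V (fun x => re phi x) (M + 1) UV; last by exists r.
  apply: filterS VA => x clx; have [a Aa] := clA _ _ _ clx Bphi ltr01.
  have := le_trans (dual_ball_norm a Bphi) (AM _ Aa).
  rewrite /= ler_norml ltr_norml ler_norml => /andP[? ?] /andP[? ?].
  by apply/andP; split; lra.
have [|z zP] := @limit_attained A Ablocks xi.
  move=> s e sB e0.
  have VsB : V [set x | forall phi, List.In phi s -> `|re phi x - xi phi| < e / 2].
    elim: s sB => [|phi s IH] sB; first by apply: filterS VA => x _ phi.
    have e2 : 0 < e / 2 by rewrite divr_gt0.
    have h1 := xiP phi (sB _ (or_introl erefl)) _ e2.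
    have h2 := IH (fun p ps => sB p (or_intror ps)).
    by apply: filterS (filterI h1 h2) => x [? h] p [<-//|]; exact: h.
  have [x [xs clx]] := filter_ex (filterI VsB VA).
  (* A point of the closure is exchanged for a point of [A] at the cost of a second [e / 2]. *)
  pose N := [set y : wZ | forall phi, List.In phi s -> `|re phi y - re phi x| < e / 2].
  have nN : nbhs (x : wZ) N.
    rewrite /N; elim: s sB {xs VsB N} => [|phi s IH] sB; first by apply: filterS filterT => y _ p.
    have e2 : 0 < e / 2 by rewrite divr_gt0.
    have h1 := weak_nbhs x (sB _ (or_introl erefl)) e2.
    have h2 := IH (fun p ps => sB p (or_intror ps)).
    by apply: filterS (filterI h1 h2) => y [? h] p [<-//|]; exact: h.
  have [a [Aa aN]] := clx _ nN.
  exists a => // phi ps; have := aN _ ps; have := xs _ ps.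
  by rewrite !ltr_norml => /andP[? ?] /andP[? ?]; apply/andP; split; lra.
have Vz : V --> (z : wZ).
  by apply: weak_cvg => phi e Bphi e0; have := xiP phi Bphi e e0; rewrite zP.
exists z; split => //; have := @closed_closure _ (A : set wZ).
move=> /closure_id ->; move=> B nB.
have VB := Vz _ nB.
exact: filter_ex (filterI VA VB).
Qed.

End WeakCriterion.

(** * The Orlicz function and its modular *)

Section OrliczFunction.
Variables (R : realType) (Psi : \bar R -> \bar R).
Hypothesis OPsi : Orlicz_function Psi.
Implicit Types (x y t : R).

(* The even real-valued extension of [Psi]: strict convexity excludes the value [+oo]. *)
Definition psi x : R := fine (Psi (`|x|)%:E).

(** Were the value [+oo] at [|x|], monotonicity would make it [+oo] at the midpoint of [|x|] and
    [|x| + 2], where strict convexity bounds it strictly from above. *)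
Lemma psiE x : Psi (`|x|)%:E = (psi x)%:E.
Proof.
have [_ [_ [Pge0 [Ple [_ [_ [Pstrict _]]]]]]] := OPsi.
rewrite /psi fineK// ge0_fin_numE; last by apply: Pge0; rewrite lee_fin.
rewrite ltNge; apply/negP; rewrite leye_eq => /eqP Pinf.
have x0 := normr_ge0 x.
have x2 : 0 <= `|x| + 2 by lra.
have ne : `|x| != `|x| + 2 by rewrite -subr_eq0 opprD addNKr oppr_eq0.
have half : 0 < (2^-1 : R) < 1 by apply/andP; split; lra.
have := Pstrict _ _ _ x0 x2 ne half.
suff -> : Psi (2^-1 * `|x| + (1 - 2^-1) * (`|x| + 2))%:E = +oo%E by rewrite ltNge leey.
apply/eqP; rewrite -leye_eq -Pinf; apply: Ple; rewrite lee_fin//; lra.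
Qed.

Lemma psi_ge0 x : 0 <= psi x.
Proof.
have [_ [_ [Pge0 _]]] := OPsi.
by rewrite -lee_fin -psiE; apply: Pge0; rewrite lee_fin.
Qed.

Lemma psi0 : psi 0 = 0.
Proof. by have [P0 _] := OPsi; rewrite /psi normr0 P0. Qed.

Lemma psi_norm x : psi `|x| = psi x.
Proof. by rewrite /psi normr_id. Qed.

Lemma psi_le x y : `|x| <= `|y| -> psi x <= psi y.
Proof.
have [_ [_ [_ [Ple _]]]] := OPsi => xy.
by rewrite -lee_fin -!psiE; apply: Ple; rewrite lee_fin.
Qed.

Lemma psi_convex t x y : 0 <= t <= 1 ->
  psi (t * x + (1 - t) * y) <= t * psi x + (1 - t) * psi y.
Proof.
have [_ [_ [_ [_ [Pconv _]]]]] := OPsi => /andP[t0 t1].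
have s0 : 0 <= 1 - t by rewrite subr_ge0.
apply: (@le_trans _ _ (psi (t * `|x| + (1 - t) * `|y|))).
  apply: psi_le; rewrite [leRHS]ger0_norm ?addr_ge0 ?mulr_ge0//.
  by apply: (le_trans (ler_normD _ _)); rewrite !normrM (ger0_norm t0) (ger0_norm s0).
rewrite -lee_fin -psiE ger0_norm ?addr_ge0 ?mulr_ge0//.
rewrite [leRHS]EFinD [(t * _)%:E]EFinM [(_ * psi y)%:E]EFinM -!psiE.
by apply: Pconv => //; rewrite t0 t1.
Qed.

Lemma psi_scale t x : 0 <= t <= 1 -> psi (t * x) <= t * psi x.
Proof.
by move=> t01; have := @psi_convex t x 0 t01; rewrite mulr0 addr0 psi0 mulr0 addr0.
Qed.

Lemma psi_small : exists2 t, 0 < t & psi t <= 1.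
Proof.
have [_ [_ [_ [_ [_ [/fine_cvgP[_ P0] _]]]]]] := OPsi.
have /cvgrPdist_lt/(_ _ ltr01) P01 := P0.
near (0 : R)^'+ => t.
have t0 : 0 < t by [].
exists t => //; have : `|0 - fine (Psi t%:E)| < 1 by near: t.
rewrite sub0r normrN -[X in Psi X%:E](gtr0_norm t0) -/(psi t).
by rewrite ger0_norm ?psi_ge0// => /ltW.
Unshelve. all: by end_near. Qed.

Lemma psi_superlinear K : exists2 x1, 0 < x1 & forall x, x1 <= x -> K * x <= psi x.
Proof.
have [_ [_ [_ [_ [_ [_ [_ Pinf]]]]]]] := OPsi.
have /cvgeyPge/(_ K)[M [_ MP]] := Pinf.
exists (Num.max M 0 + 1) => [|x Mx]; first by rewrite ltr_wpDl// le_max lexx orbT.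
have x0 : 0 < x.
  by apply: lt_le_trans Mx; rewrite ltr_wpDl// le_max lexx orbT.
have : M < x by apply: lt_le_trans Mx; rewrite ltr_pwDr// le_max lexx.
move=> /MP; rewrite -[X in Psi X%:E](gtr0_norm x0) psiE -EFinM lee_fin.
by rewrite ler_pdivlMr.
Qed.

Lemma measurable_psi : measurable_fun setT psi.
Proof.
have -> : psi = (fun x => psi (Num.max x 0)) \o Num.norm.
  by apply/funext => x /=; rewrite max_l// psi_norm.
apply: measurableT_comp; last exact: normr_measurable.
apply: nondecreasing_measurable => // x y xy; apply: psi_le.
rewrite !ger0_norm ?le_max ?lexx ?orbT//; move: xy.
by rewrite /Order.max; case: ltP; case: ltP; lra.
Qed.

(** The slope is the supremum of the chord slopes to the left of [y1], that is, the left derivative;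
    by convexity every chord slope to the right is at least as large. *)
Lemma psi_subgradient y1 : 0 < y1 ->
  exists a, forall y, 0 <= y -> psi y1 + a * (y - y1) <= psi y.
Proof.
move=> y10; pose S := [set (psi y1 - psi z) / (y1 - z) | z in [set z | 0 <= z < y1]].
have Sle w : y1 < w -> ubound S ((psi w - psi y1) / (w - y1)).
  move=> y1w _ [z /= /andP[z0 zy] <-].
  have wz : 0 < w - z by lra.
  pose t := (w - y1) / (w - z).
  have t01 : 0 <= t <= 1.
    by rewrite divr_ge0 ?ler_pdivrMr ?mul1r//=; lra.
  have := @psi_convex t z w t01.
  have -> : t * z + (1 - t) * w = y1 by rewrite /t; field; lra.
  have tE : t * (w - z) = w - y1 by rewrite /t divfK//; lra.
  move=> /(ler_wpM2r (ltW wz)).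
  rewrite (_ : (t * psi z + (1 - t) * psi w) * (w - z) =
    (t * (w - z)) * psi z + ((w - z) - t * (w - z)) * psi w); last by ring.
  rewrite tE => h.
  rewrite ler_pdivrMr; last by lra.
  rewrite mulrAC ler_pdivlMr; last by lra.
  by lra.
have S0 : S !=set0 by exists ((psi y1 - psi 0) / (y1 - 0)); exists 0 => //=; rewrite lexx.
have hS : has_sup S by split=> //; exists ((psi (y1 + 1) - psi y1) / (y1 + 1 - y1)); apply: Sle; lra.
exists (sup S) => y y0; have [yy1|yy1|<-] := ltgtP y y1; last by rewrite subrr mulr0 addr0.
- have : (psi y1 - psi y) / (y1 - y) <= sup S.
    by apply: ub_le_sup; [exact: hS.2|exists y => //=; rewrite y0].
  by rewrite ler_pdivrMr; nra.
- have : sup S <= (psi y - psi y1) / (y - y1) by apply: ge_sup => //; exact: Sle.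
  by rewrite ler_pdivlMr; nra.
Qed.

Lemma complementary_tangent y1 a :
  (forall y, 0 <= y -> psi y1 + a * (y - y1) <= psi y) ->
  (complementary Psi a <= (a * y1 - psi y1)%:E)%E.
Proof.
move=> tan; apply: ub_ereal_sup => _ [y /= y0 <-].
rewrite -[X in Psi X%:E](ger0_norm y0) psiE -EFinB lee_fin.
by have := tan y y0; lra.
Qed.

Lemma complementary_young a y : 0 <= y -> ((a * y - psi y)%:E <= complementary Psi a)%E.
Proof.
move=> y0; apply: ereal_sup_ubound; exists y => //.
by rewrite -[X in Psi X%:E](ger0_norm y0) psiE EFinB.
Qed.

(** Let [a] be a subgradient slope at [y1 = x / n], where Young's inequality is an equality. Young's
    inequality for [2 ^ j a] and [x], with Delta_2 iterated [j] times, gives [2 ^ j a x - psi x <= K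
    ^ j (a y1 - psi y1)]. With [n >= K ^ j] this yields [2 ^ j n psi y1 <= psi x]. *)
Lemma nabla2 e : Delta2 (complementary Psi) -> 0 < e ->
  exists (n : nat) (x1 : R), [/\ (0 < n)%N, 0 < x1 &
    forall x, x1 <= x -> psi (x / n%:R) <= e / n%:R * psi x].
Proof.
move=> [K [x0 [K0 [x00 D2]]]] e0.
have D2j j a : x0 <= a -> (complementary Psi (2 ^+ j * a) <= (K ^+ j)%:E * complementary Psi a)%E.
  elim: j a => [|j IH] a xa; first by rewrite !expr0 mul1r mul1e.
  rewrite exprS -mulrA; apply: (le_trans (D2 _ _)).
    have : 1 <= (2 : R) ^+ j by rewrite exprn_ege1//; lra.
    nra.
  by rewrite exprS EFinM -muleA; apply: lee_wpmul2l; [rewrite lee_fin ltW|exact: IH].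
have [j jP] : exists j : nat, (2 ^+ j)^-1 <= e.
  have [j jP] := archimedean_inv e0; exists j.
  apply: le_trans (ltW jP); rewrite lef_pV2 ?posrE ?ltr0n ?exprn_gt0//.
  by rewrite -natrX ler_nat; exact: ltn_expl.
pose n := (Num.truncn (K ^+ j)).+1.
have nK : K ^+ j <= n%:R by apply/ltW/truncnS_gt.
have n0 : 0 < n%:R :> R by rewrite ltr0n.
(* Beyond [Y] the quotient [psi y / y], and with it the slope [a], is at least [x0], the range in
   which Delta_2 holds. *)
have [Y Y0 YP] := psi_superlinear x0.
exists n, (n%:R * Y); split => //; first by rewrite mulr_gt0.
move=> x xY; pose y1 := x / n%:R.
have xE : x = n%:R * y1 by rewrite /y1 mulrC divfK// gt_eqF.
have y1Y : Y <= y1 by rewrite /y1 ler_pdivlMr// mulrC.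
have y10 : 0 < y1 by apply: lt_le_trans y1Y.
have [a aP] := psi_subgradient y10.
have ay : psi y1 <= a * y1 by have := aP 0 (lexx 0); rewrite psi0; lra.
have ax0 : x0 <= a.
  by rewrite -(ler_pM2r y10); apply: le_trans ay; exact: YP.
have x_ge0 : 0 <= x by rewrite xE mulr_ge0 ?ltW.
have Kj0 : 0 <= K ^+ j by rewrite exprn_ge0// ltW.
have := le_trans (complementary_young (2 ^+ j * a) x_ge0) (D2j j a ax0).
move=> /le_trans/(_ (lee_wpmul2l _ (complementary_tangent aP))).
rewrite lee_fin Kj0 => /(_ isT); rewrite -EFinM lee_fin => h.
have twoj : 1 <= (2 : R) ^+ j by rewrite exprn_ege1//; lra.
have h2 : 2 ^+ j * n%:R * psi y1 <= psi x.
  rewrite {1}xE in h.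
  have : 0 <= (2 ^+ j * n%:R - K ^+ j) * (a * y1 - psi y1).
    rewrite mulr_ge0 ?subr_ge0//; apply: (le_trans nK).
    by rewrite ler_peMl// ltW.
  nra.
have p0 := psi_ge0 x.
rewrite -/y1 mulrAC ler_pdivlMr// mulrC.
apply: (@le_trans _ _ ((2 ^+ j)^-1 * psi x)); last by rewrite ler_wpM2r.
by rewrite ler_pdivlMl ?exprn_gt0// mulrA.
Qed.

End OrliczFunction.

Section Modular.
Context (d : measure_display) (T : measurableType d) (R : realType).
Variables (P : probability T R) (Psi : \bar R -> \bar R).
Hypothesis OPsi : Orlicz_function Psi.
Implicit Types (f g : T -> R) (c a : R).
Local Notation psi := (psi Psi).
Local Notation toC := (@real_complex R : R -> Cplx R).
Local Notation normc := (@ComplexField.Normc.normc R).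

Definition modular f c : \bar R := (\int[P]_x (psi (f x / c))%:E)%E.

Lemma modularE f c : modular f c = (\int[P]_x (psi (f x / c))%:E)%E.
Proof. by []. Qed.

(** For [c > 0] this makes [c] a witness in the infimum defining the Luxemburg norm. Working with
    witnesses avoids asking whether that infimum is attained. *)
Definition mball c f := measurable_fun setT f /\ (modular f c <= 1)%E.

Lemma measurable_psi_comp f c : measurable_fun setT f ->
  measurable_fun setT (fun x => (psi (f x / c))%:E).
Proof.
move=> mf; apply/measurable_EFinP.
apply: (measurableT_comp (measurable_psi OPsi)).
exact: measurable_funM.
Qed.

Lemma le_modular f g c c' : measurable_fun setT f -> measurable_fun setT g ->
  (forall x, psi (f x / c) <= psi (g x / c')) -> (modular f c <= modular g c')%E.
Proof.
move=> mf mg fg; apply: ge0_le_integral => //.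
- by move=> x _; rewrite lee_fin psi_ge0.
- exact: measurable_psi_comp.
- exact: measurable_psi_comp.
- by move=> x _; rewrite lee_fin.
Qed.

Lemma mball_le f g c : 0 < c -> measurable_fun setT g -> (forall x, `|g x| <= `|f x|) ->
  mball c f -> mball c g.
Proof.
move=> c0 mg gf [mf fc]; split=> //; apply: le_trans fc; apply: le_modular => // x.
by apply: psi_le => //; rewrite !normrM ler_wpM2r.
Qed.

Lemma mballW c c' f : 0 < c -> c <= c' -> mball c f -> mball c' f.
Proof.
move=> c0 cc' [mf fc]; split=> //; apply: le_trans fc; apply: le_modular => // x.
apply: psi_le => //; rewrite !normrM ler_wpM2l// !normfV lef_pV2 ?posrE ?normr_gt0 ?gt_eqF//.
  by rewrite !gtr0_norm// (lt_le_trans c0).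
exact: lt_le_trans cc'.
Qed.

Lemma modular_mix t f g c c' : 0 <= t <= 1 -> measurable_fun setT f -> measurable_fun setT g ->
  (\int[P]_x (psi (t * (f x / c) + (1 - t) * (g x / c')))%:E <=
   t%:E * modular f c + (1 - t)%:E * modular g c')%E.
Proof.
move=> t01 mf mg; have /andP[t0 t1] := t01.
have mfc := measurable_psi_comp c mf; have mgc := measurable_psi_comp c' mg.
have s0 : 0 <= 1 - t by rewrite subr_ge0.
rewrite /modular -!ge0_integralZl_EFin//; try by move=> x _; rewrite lee_fin psi_ge0.
rewrite -ge0_integralD//; last 4 first.
- by move=> x _; rewrite mule_ge0// lee_fin// psi_ge0.
- exact: measurable_funeM.
- by move=> x _; rewrite mule_ge0// lee_fin// psi_ge0.
- exact: measurable_funeM.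
apply: ge0_le_integral => //.
- by move=> x _; rewrite lee_fin psi_ge0.
- apply/measurable_EFinP; apply: (measurableT_comp (measurable_psi OPsi)).
  by apply: measurable_funD; apply: measurable_funM => //; exact: measurable_funM.
- by apply: emeasurable_funD; exact: measurable_funeM.
- by move=> x _; rewrite -!EFinM -EFinD lee_fin psi_convex.
Qed.

(** Convexity with weights [c / (c + c')] and [c' / (c + c')]: the triangle inequality of the
    Luxemburg norm. *)
Lemma mballD c c' f g : 0 < c -> 0 < c' -> mball c f -> mball c' g ->
  mball (c + c') (fun x => f x + g x).
Proof.
move=> c0 c'0 [mf fc] [mg gc]; split; first exact: measurable_funD.
pose t := c / (c + c').
have t01 : 0 <= t <= 1.
  by rewrite divr_ge0 ?ler_pdivrMr ?mul1r ?lerDl//=; lra.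
have /andP[t0 t1] := t01.
have -> : modular (fun x => f x + g x) (c + c') =
    (\int[P]_x (psi (t * (f x / c) + (1 - t) * (g x / c')))%:E)%E.
  apply: eq_integral => x _; congr ((psi _)%:E); rewrite /t; field.
  by rewrite !gt_eqF ?addr_gt0.
apply: (le_trans (modular_mix _ _ t01 mf mg)).
apply: (@le_trans _ _ (t%:E * 1 + (1 - t)%:E * 1)%E).
  by apply: leeD; apply: lee_wpmul2l => //; rewrite lee_fin ?subr_ge0.
by rewrite !mule1 -EFinD subrKC.
Qed.

Lemma mball_mix c t f g : 0 <= t <= 1 -> mball c f -> mball c g ->
  mball c (fun x => t * f x + (1 - t) * g x).
Proof.
move=> t01 [mf fc] [mg gc]; have /andP[t0 t1] := t01; split.
  by apply: measurable_funD; exact: measurable_funM.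
have -> : modular (fun x => t * f x + (1 - t) * g x) c =
    (\int[P]_x (psi (t * (f x / c) + (1 - t) * (g x / c)))%:E)%E.
  by apply: eq_integral => x _; congr ((psi _)%:E); rewrite mulrDl !mulrA.
apply: (le_trans (modular_mix _ _ t01 mf mg)).
apply: (@le_trans _ _ (t%:E * 1 + (1 - t)%:E * 1)%E).
  by apply: leeD; apply: lee_wpmul2l => //; rewrite lee_fin ?subr_ge0.
by rewrite !mule1 -EFinD subrKC.
Qed.

Lemma mballZ c a f : a != 0 -> mball c f -> mball (`|a| * c) (fun x => a * f x).
Proof.
move=> a0 [mf fc]; split; first exact: measurable_funM.
have aa0 : 0 < `|a| by rewrite normr_gt0.
apply: le_trans fc; apply: le_modular => //; first exact: measurable_funM.
move=> x; apply: psi_le => //; rewrite !normrM !normfV normrM normr_id.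
rewrite invfM mulrACA divff ?mul1r//; exact: lt0r_neq0.
Qed.

Lemma mball_bounded t a f : 0 < t -> psi t <= 1 -> 0 < a -> measurable_fun setT f ->
  (forall x, `|f x| <= a) -> mball (a / t) f.
Proof.
move=> t0 pt a0 mf fa; split=> //.
apply: (@le_trans _ _ (\int[P]_(x in setT) (cst 1%E x))%E); last first.
  by rewrite integral_cst// mul1e; exact: probability_le1.
apply: ge0_le_integral => //.
- by move=> x _; rewrite lee_fin psi_ge0.
- exact: measurable_psi_comp.
- move=> x _; rewrite lee_fin; apply: le_trans pt; apply: psi_le => //.
  rewrite normrM normfV (gtr0_norm (divr_gt0 a0 t0)) (gtr0_norm t0).
  by rewrite ler_pdivrMr ?divr_gt0// mulrC divfK ?gt_eqF.
Qed.

(** Convexity and [psi 0 = 0] give [psi (x / N) <= psi x / N], which trades a modular bound for a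
    larger radius. *)
Lemma mball_modular f c N : 0 < c -> 1 <= N -> measurable_fun setT f ->
  (modular f c <= N%:E)%E -> mball (N * c) f.
Proof.
move=> c0 N1 mf fN; split=> //.
have N0 : 0 < N by apply: lt_le_trans N1.
apply: (@le_trans _ _ ((N^-1)%:E * modular f c)%E); last first.
  by rewrite muleC lee_pdivrMr// mul1e.
rewrite /modular -ge0_integralZl_EFin//; last 3 first.
- by move=> x _; rewrite lee_fin psi_ge0.
- exact: measurable_psi_comp.
- by rewrite invr_ge0 ltW.
apply: ge0_le_integral => //.
- by move=> x _; rewrite lee_fin psi_ge0.
- exact: measurable_psi_comp.
- by apply: measurable_funeM; exact: measurable_psi_comp.
- move=> x _; rewrite -EFinM lee_fin invfM mulrCA; apply: psi_scale => //.
  by rewrite invr_ge0 ltW//= invf_le1.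
Qed.

Lemma mball_null f c : measurable_fun setT f -> P [set x | f x != 0] = 0 -> mball c f.
Proof.
move=> mf f0; split=> //; rewrite /modular.
rewrite (_ : (\int[P]_x (psi (f x / c))%:E)%E = 0%E) ?lee01//.
transitivity (\int[P]_x (cst 0%E x))%E; last by rewrite integral0.
apply: ae_eq_integral => //; first exact: measurable_psi_comp.
exists [set x | f x != 0]; split => //.
  rewrite (_ : [set x | f x != 0] = f @^-1` [set~ 0]).
    by rewrite -[X in measurable X]setTI; apply: mf => //; exact: measurableC.
  by apply/seteqP; split=> x /=; [move/eqP|move=> ?; apply/eqP].
move=> x /= h; apply/negP => fx0; apply: h => _.
by rewrite (eqP fx0) mul0r psi0.
Qed.

End Modular.

(** * The operator and its restriction to real functions *)

Section Operator.
Context (d : measure_display) (T : measurableType d) (R : realType).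
Variables (P : probability T R) (Psi : \bar R -> \bar R).
Hypothesis OPsi : Orlicz_function Psi.
Implicit Types (f g : T -> R) (F G : T -> Cplx R) (c a : R).
Local Notation psi := (psi Psi).
Local Notation toC := (@real_complex R : R -> Cplx R).
Local Notation normc := (@ComplexField.Normc.normc R).
Local Notation Cre F := (fun x => complex.Re (F x : R[i])).
Local Notation Cim F := (fun x => complex.Im (F x : R[i])).

Lemma cmeasurable_normc F : cmeasurable F -> measurable_fun setT (fun x => normc (F x)).
Proof.
move=> [mr mi].
have -> : (fun x => normc (F x)) =
    Num.sqrt \o (fun x => complex.Re (F x : R[i]) ^+ 2 + complex.Im (F x : R[i]) ^+ 2).
  by apply/funext => x /=; case: (F x).
apply: measurableT_comp; first by apply: nondecreasing_measurable => // x y; exact: ler_wsqrtr.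
by apply: measurable_funD; exact: measurable_funX.
Qed.

Lemma cmeasurable_real f : measurable_fun setT f -> cmeasurable (fun x => toC (f x)).
Proof. by move=> mf; split=> //=; exact: measurable_cst. Qed.

Lemma cmeasurable_lin (z : Cplx R) F G : cmeasurable F -> cmeasurable G ->
  cmeasurable (fun x => z * F x + G x).
Proof.
move=> [mFr mFi] [mGr mGi]; case: z => u v; split.
  rewrite (_ : (fun x => _) = (fun x => (u * complex.Re (F x : R[i]) -
      v * complex.Im (F x : R[i])) + complex.Re (G x : R[i]))); last first.
    by apply/funext => x; case: (F x) => ? ?; case: (G x).
  apply: measurable_funD => //; apply: measurable_funB; exact: measurable_funM.
rewrite (_ : (fun x => _) = (fun x => (u * complex.Im (F x : R[i]) +
    v * complex.Re (F x : R[i])) + complex.Im (G x : R[i]))); last first.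
  by apply/funext => x; case: (F x) => ? ?; case: (G x) => ? ? /=.
apply: measurable_funD => //; apply: measurable_funD; exact: measurable_funM.
Qed.

Definition cball c F := cmeasurable F /\ mball P Psi c (fun x => normc (F x)).

Lemma normc_ge0 (z : R[i]) : 0 <= normc z.
Proof. by case: z => ? ?; exact: sqrtr_ge0. Qed.

Lemma orlicz_modularE F c : 0 < c ->
  orlicz_modular P Psi F c = modular P Psi (fun x => normc (F x)) c.
Proof.
move=> c0; apply: eq_integral => x _.
rewrite -(psiE OPsi) ger0_norm// divr_ge0 ?(ltW c0)//; exact: normc_ge0.
Qed.

Lemma cball_orlicz c F : 0 < c -> cball c F ->
  in_orlicz P Psi F /\ (luxemburg P Psi F <= c%:E)%E.
Proof.
move=> c0 [mF [_ Fc]]; split.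
  split=> //; exists c; split=> //; rewrite orlicz_modularE//.
  by apply: le_lt_trans Fc _; rewrite ltry.
by apply: ereal_inf_lbound; exists c => //=; rewrite orlicz_modularE.
Qed.

(** Norm at most 1 directly yields witnesses only above 1. The choice of 2 is the source of the
    radius 2 in the later sections. *)
Lemma luxemburg_ball F : in_orlicz P Psi F -> (luxemburg P Psi F <= 1)%E -> cball 2 F.
Proof.
move=> [mF _] F1.
have /ereal_inf_lt[_ [c [c0 cP] <-]] : (luxemburg P Psi F < 2%:E)%E.
  by apply: le_lt_trans F1 _; rewrite lte_fin ltr1n.
rewrite lte_fin => c2; split=> //; apply: (mballW OPsi c0 (ltW c2)).
by split; [exact: cmeasurable_normc|rewrite -orlicz_modularE].
Qed.

Variables (Z : completeNormedModType (Cplx R)) (Top : (T -> Cplx R) -> Z).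
Hypothesis blT : bounded_linear_on_orlicz P Psi Top.

Lemma operator_bound : exists2 M, 0 < M & forall c F, 0 < c -> cball c F ->
  rnorm (Top F) <= M * c.
Proof.
have [_ [M MP]] := blT; exists (Num.max M 1) => [|c F c0 FB].
  by rewrite lt_max ltr01 orbT.
have [FX Fc] := cball_orlicz c0 FB.
rewrite -lee_fin EFinM; apply: (le_trans (MP _ FX)).
have M0 : (0 <= (Num.max M 1)%:E)%E by rewrite lee_fin le_max ler01 orbT.
apply: (@le_trans _ _ ((Num.max M 1)%:E * luxemburg P Psi F)%E); last exact: lee_wpmul2l.
apply: lee_wpmul2r; last by rewrite lee_fin le_max lexx.
by apply: le_ereal_inf_tmp => _ [r [r0 _] <-]; rewrite lee_fin ltW.
Qed.

Lemma Top_lin (z : Cplx R) F G c c' : 0 < c -> 0 < c' -> cball c F -> cball c' G ->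
  Top (fun x => z * F x + G x) = z *: Top F + Top G.
Proof.
move=> c0 c'0 /(cball_orlicz c0)[FX _] /(cball_orlicz c'0)[GX _].
exact: blT.1.
Qed.

Definition Lop f := Top (fun x => toC (f x)).

Lemma LopE f : Lop f = Top (fun x => toC (f x)).
Proof. by []. Qed.

Definition Espace f := exists2 c, 0 < c & mball P Psi c f.

Lemma cball_real c f : 0 < c -> mball P Psi c f -> cball c (fun x => toC (f x)).
Proof.
move=> c0 fc; split; first by apply: cmeasurable_real; exact: fc.1.
apply: (mball_le OPsi c0 _ _ fc) => [|x]; last by rewrite normc_toC normr_id.
by apply: cmeasurable_normc; apply: cmeasurable_real; exact: fc.1.
Qed.

Lemma Lop_lin a f g : Espace f -> Espace g ->
  Lop (fun x => a * f x + g x) = toC a *: Lop f + Lop g.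
Proof.
move=> [c c0 fc] [c' c'0 gc]; rewrite /Lop.
rewrite -(Top_lin _ c0 c'0 (cball_real c0 fc) (cball_real c'0 gc)).
by congr Top; apply/funext => x; rewrite toCD toCM.
Qed.

Lemma EspaceD f g : Espace f -> Espace g -> Espace (fun x => f x + g x).
Proof.
by move=> [c c0 fc] [c' c'0 gc]; exists (c + c'); [exact: addr_gt0|exact: mballD].
Qed.

Lemma Espace0 : Espace (fun=> 0).
Proof.
exists 1 => //; apply: mball_null => //.
by rewrite (_ : [set x | _] = set0) ?measure0//; apply/seteqP; split=> x //=; rewrite eqxx.
Qed.

Lemma EspaceZ a f : Espace f -> Espace (fun x => a * f x).
Proof.
have [->|a0] := eqVneq a 0.
  by rewrite (_ : (fun x => 0 * f x) = fun=> 0) => [_|]; [exact: Espace0|apply/funext => x; rewrite mul0r].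
by move=> [c c0 fc]; exists (`|a| * c); [rewrite mulr_gt0 ?normr_gt0|exact: mballZ].
Qed.

Lemma EspaceB f g : Espace f -> Espace g -> Espace (fun x => f x - g x).
Proof.
move=> Ef /(EspaceZ (-1)) Eg; have := EspaceD Ef Eg.
by congr Espace; apply/funext => x; rewrite mulN1r.
Qed.

Lemma Espace_le f g : measurable_fun setT g -> (forall x, `|g x| <= `|f x|) ->
  Espace f -> Espace g.
Proof. by move=> mg gf [c c0 fc]; exists c => //; exact: mball_le fc. Qed.

Lemma Espace_measurable f : Espace f -> measurable_fun setT f.
Proof. by move=> [c _ []]. Qed.

Lemma LopD f g : Espace f -> Espace g -> Lop (fun x => f x + g x) = Lop f + Lop g.
Proof.
move=> Ef Eg; have := Lop_lin 1 Ef Eg.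
by rewrite [LHS](_ : _ = Lop (fun x => f x + g x)) ?scale1r//; congr Lop; apply/funext => x; rewrite mul1r.
Qed.

Lemma Lop0 : Lop (fun=> 0) = 0.
Proof.
have := LopD Espace0 Espace0.
rewrite [LHS](_ : _ = Lop (fun=> 0)); last by congr Lop; apply/funext => x; rewrite addr0.
by move=> /eqP; rewrite -subr_eq subrr eq_sym => /eqP.
Qed.

Lemma LopZ a f : Espace f -> Lop (fun x => a * f x) = toC a *: Lop f.
Proof.
move=> Ef; have := Lop_lin a Ef Espace0; rewrite Lop0 addr0 => <-.
by congr Lop; apply/funext => x; rewrite addr0.
Qed.

Lemma LopN f : Espace f -> Lop (fun x => - f x) = - Lop f.
Proof.
move=> Ef; have := LopZ (-1) Ef; rewrite toCN scaleN1r => <-.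
by congr Lop; apply/funext => x; rewrite mulN1r.
Qed.

Lemma LopB f g : Espace f -> Espace g -> Lop (fun x => f x - g x) = Lop f - Lop g.
Proof.
move=> Ef Eg; rewrite -(LopN Eg) -LopD//.
by have := EspaceZ (-1) Eg; congr Espace; apply/funext => x; rewrite mulN1r.
Qed.

Lemma Lop_bound : exists2 M, 0 < M & forall c f, 0 < c -> mball P Psi c f ->
  rnorm (Lop f) <= M * c.
Proof.
have [M M0 MP] := operator_bound; exists M => // c f c0 fc.
by apply: MP => //; exact: cball_real.
Qed.

(** [Top] acts on representatives. A null function lies in [mball c] for every [c > 0], so the
    operator bound forces the value 0. *)
Lemma Lop_null f : measurable_fun setT f -> P [set x | f x != 0] = 0 -> Lop f = 0.
Proof.
move=> mf f0; have [M M0 MP] := Lop_bound.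
apply: rnorm_eq0; apply/eqP; rewrite eq_le rnorm_ge0 andbT.
apply/ler_addgt0Pr => e e0; rewrite add0r.
have := MP (e / M) f (divr_gt0 e0 M0) (mball_null OPsi _ mf f0).
by rewrite mulrC divfK// gt_eqF.
Qed.

End Operator.

(** * Disjoint sequences and copies of c_0 *)

(* Rosenthal's lemma. Each failure of the conclusion along all rows of a
   partition into infinitely many infinite sets lowers the total mass by [e]. *)
Lemma rosenthal (R : realType) (nu : nat -> set nat -> R) (K e : R) :
  (forall n A, 0 <= nu n A <= K) ->
  (forall n A B, A `&` B = set0 -> nu n A + nu n B <= nu n (A `|` B)) -> 0 < e ->
  exists2 s : nat -> nat, injective s &
    forall n, nu (s n) [set s m | m in [set m | m != n]] <= e.
Proof.
move=> nuK nuD e0.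
have nuS n A B : A `<=` B -> nu n A <= nu n B.
  move=> AB; rewrite -(setDUK AB); apply: le_trans (nuD n _ _ (setDIK A B)).
  by rewrite lerDl; have /andP[] := nuK n (B `\` A).
have main k : forall t : nat -> nat, injective t ->
    (forall n, nu (t n) (range t) <= k%:R * e) ->
    exists2 s : nat -> nat, injective s &
      forall n, nu (s n) [set s m | m in [set m | m != n]] <= e.
  elim: k => [|k IH] t tinj tk.
    exists t => // n; apply: le_trans (ltW e0); have := tk n; rewrite mul0r.
    by apply: le_trans; apply: nuS => _ [m _ <-]; exists m.
  pose pr (p i : nat) := t (pickle (p, i)).
  have prinj p i q j : pr p i = pr q j -> p = q /\ i = j.
    by move=> /tinj/(pcan_inj pickleK)[-> ->].
  have [[p hp]|np] := pselect (exists p, forall i,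
      nu (pr p i) [set pr p j | j in [set j | j != i]] <= e).
    by exists (pr p) => // i j /prinj[].
  have /choice[ii iiP] : forall p, exists i,
      e < nu (pr p i) [set pr p j | j in [set j | j != i]].
    move=> p; apply/not_existsP => h; apply: np; exists p => i.
    by rewrite leNgt; apply/negP; exact: h.
  (* One bad index per row: the selected indices are disjoint from the rest of row [p], whose mass
     exceeds [e], so superadditivity leaves them mass at most [k * e]. *)
  apply: (IH (fun p => pr p (ii p))) => [p q /prinj[]//|p].
  have := tk (pickle (p, ii p)); rewrite -[t _]/(pr p (ii p)).
  have disj : range (fun p => pr p (ii p)) `&` [set pr p j | j in [set j | j != ii p]] = set0.
    apply/seteqP; split=> // x [[q _ <-] [j /= jp /prinj[pq]]].
    by rewrite pq in jp *; move=> jE; rewrite jE eqxx in jp.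
  have sub : range (fun p => pr p (ii p)) `|` [set pr p j | j in [set j | j != ii p]] `<=` range t.
    by move=> x [[q _ <-]|[j _ <-]]; eexists.
  have := nuD (pr p (ii p)) _ _ disj; have := nuS (pr p (ii p)) _ _ sub.
  by have := iiP p; rewrite -natr1; lra.
apply: (main (Num.truncn (K / e)).+1 id) => // n; have /andP[_] := nuK n (range id).
move=> /le_trans; apply; rewrite -ler_pdivrMr//; exact/ltW/truncnS_gt.
Qed.

Section C0Embedding.
Context (d : measure_display) (T : measurableType d) (R : realType).
Variables (P : probability T R) (Psi : \bar R -> \bar R).
Hypothesis OPsi : Orlicz_function Psi.
Variables (Z : completeNormedModType (Cplx R)) (Top : (T -> Cplx R) -> Z).
Hypothesis blT : bounded_linear_on_orlicz P Psi Top.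
Local Notation toC := (@real_complex R : R -> Cplx R).
Local Notation normc := (@ComplexField.Normc.normc R).
Local Notation re phi z := (complex.Re (phi z : R[i])).
Local Notation Lop := (Lop Top).
Local Notation cball := (cball P Psi).

Variables (s : T -> R) (c : R).
Hypotheses (c0 : 0 < c) (s0 : forall x, 0 <= s x) (sc : mball P Psi c s).

Lemma cball_dominated C (F : T -> Cplx R) : 0 < C -> cmeasurable F ->
  (forall x, normc (F x) <= C * s x) -> cball (C * c) F.
Proof.
move=> C0 mF FC; split=> //; have sC := mballZ OPsi (lt0r_neq0 C0) sc.
rewrite (gtr0_norm C0) in sC.
apply: (mball_le OPsi _ _ _ sC); rewrite ?mulr_gt0//; first exact: cmeasurable_normc.
move=> x; rewrite !ger0_norm ?mulr_ge0 ?normc_ge0//; exact: ltW.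
Qed.

(** [C = 0] occurs for the zero sequence of c_0. As radii have to be positive, the bound is obtained
    as the limit of [C * c + e]. *)
Lemma luxemburg_dominated C (F : T -> Cplx R) : 0 <= C -> cmeasurable F ->
  (forall x, normc (F x) <= C * s x) ->
  in_orlicz P Psi F /\ (luxemburg P Psi F <= (C * c)%:E)%E.
Proof.
move=> C0 mF FC.
have h e : 0 < e -> cball (C * c + e) F.
  move=> e0; have C'0 : 0 < C + e / c by rewrite ltr_wpDl// divr_gt0.
  have := @cball_dominated (C + e / c) F C'0 mF.
  rewrite mulrDl divfK ?gt_eqF//; apply => x; apply: (le_trans (FC x)).
  by rewrite ler_wpM2r// lerDl divr_ge0// ltW.
have Cc : 0 <= C * c by rewrite mulr_ge0// ltW.
split; first by have [] := cball_orlicz OPsi (ltr_wpDl Cc ltr01) (h 1 ltr01).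
apply/lee_addgt0Pr => e e0; rewrite -EFinD.
by have [] := cball_orlicz OPsi (ltr_wpDl Cc e0) (h e e0).
Qed.

Definition admissible (A : set T) (G : T -> Cplx R) :=
  [/\ cmeasurable G, (forall x, normc (G x) <= s x) & forall x, ~ A x -> G x = 0].

(** The modulus of [re phi o Top] at [s 1_A], over complex competitors, so that the complex
    functions produced by the embedding of c_0 are among them after rescaling. *)
Definition variation (phi : Z -> Cplx R) (A : set T) :=
  sup [set re phi (Top G) | G in admissible A].

Lemma admissible_cball A G : admissible A G -> cball c G.
Proof.
move=> [mG Gs _]; rewrite -[c]mul1r; apply: cball_dominated => // x.
by rewrite mul1r.
Qed.

Lemma admissible0 A : admissible A (fun=> 0).
Proof.
split=> [|x|//]; first by split; exact: measurable_cst.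
by rewrite ComplexField.Normc.normc0.
Qed.

Lemma Top0 : Top (fun=> 0) = 0.
Proof. exact: (Lop0 OPsi blT). Qed.

Lemma variation_bound : exists2 M, 0 < M & forall phi A, dual_ball phi ->
  [/\ 0 <= variation phi A, variation phi A <= M &
    forall G, admissible A G -> re phi (Top G) <= variation phi A].
Proof.
have [M M0 MP] := operator_bound OPsi blT; exists (M * c) => [|phi A Bphi].
  exact: mulr_gt0.
have ub G : admissible A G -> re phi (Top G) <= M * c.
  by move=> /admissible_cball/(MP _ _ c0); apply: le_trans; exact: Bphi.2.
have le G : admissible A G -> re phi (Top G) <= variation phi A.
  move=> GA; apply: ub_le_sup; last by exists G.
  by exists (M * c) => _ [G' G'A <-]; exact: ub.
split=> //.
  by have := le _ (admissible0 A); rewrite Top0 (lin0 Bphi.1).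
apply: ge_sup; first by exists (re phi (Top (fun=> 0))); exists (fun=> 0) => //; exact: admissible0.
by move=> _ [G GA <-]; exact: ub.
Qed.

Lemma variation_superadditive phi A B : dual_ball phi -> A `&` B = set0 ->
  variation phi A + variation phi B <= variation phi (A `|` B).
Proof.
move=> Bphi AB0; have [M M0 MP] := variation_bound.
have varle A' r : (forall G, admissible A' G -> re phi (Top G) <= r) -> variation phi A' <= r.
  move=> h; apply: ge_sup; last by move=> _ [G GA <-]; exact: h.
  by exists (re phi (Top (fun=> 0))); exists (fun=> 0) => //; exact: admissible0.
rewrite -lerBrDr; apply: (varle) => G GA; rewrite lerBrDr -lerBrDl.
apply: (varle) => G' G'B; rewrite lerBrDl.
have [_ _] := MP phi (A `|` B) Bphi; move=> /(_ (fun x => 1 * G x + G' x)).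
rewrite (Top_lin OPsi blT _ c0 c0 (admissible_cball GA) (admissible_cball G'B)).
rewrite scale1r (re_linD Bphi.1); apply.
have [mG Gs GA0] := GA; have [mG' Gs' GB0] := G'B.
split=> [|x|x nAB]; first exact: cmeasurable_lin.
  have [Ax|nAx] := pselect (A x); last by rewrite GA0// mulr0 add0r.
  rewrite GB0 ?addr0 ?mul1r// => Bx.
  by have : (A `&` B) x by []; rewrite AB0.
by rewrite GA0 ?GB0 ?mulr0 ?addr0// => ?; apply: nAB; [right|left].
Qed.

Variables (D : nat -> set T) (e_ : nat -> T -> R) (phi_ : nat -> Z -> Cplx R) (del : R).
Hypotheses (Ddisj : trivIset setT D) (me : forall j, measurable_fun setT (e_ j)).
Hypotheses (es : forall j x, `|e_ j x| <= s x) (eD : forall j x, ~ D j x -> e_ j x = 0).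
Hypotheses (Bphi : forall j, dual_ball (phi_ j)) (del0 : 0 < del).
Hypothesis edel : forall j, del <= re (phi_ j) (Lop (e_ j)).

(** Rosenthal's lemma selects a subsequence along which [phi_ (sg n)] has variation at most
    [del / 2] on the union of the other selected sets. For the pointwise sum [J u] of the
    [u n * e_ (sg n)], domination by [s] gives the upper bound. Evaluating [phi_ (sg n)] gives the
    lower one: the diagonal term beats the rest by [del / 2]. *)
Lemma disjoint_fixes_c0 : fixes_c0 P Psi Top.
Proof.
have [MV MV0 MVP] := variation_bound.
pose nu n (A : set nat) := variation (phi_ n) (\bigcup_(j in A) D j).
have [|||sg sginj sgP] := @rosenthal R nu MV (del / 2).
- by move=> n A; have [-> ->] := MVP (phi_ n) (\bigcup_(j in A) D j) (Bphi n).
- move=> n A B AB; rewrite /nu bigcup_setU; apply: variation_superadditive => //.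
  apply/seteqP; split=> // x [[i Ai Dix] [j Bj Djx]].
  have ij : i = j by apply: (Ddisj I I); exists x.
  have : (A `&` B) i by split=> //; rewrite ij.
  by rewrite AB.
- by rewrite divr_gt0.
(* [ix x] is the only [n] with [x] in [D (sg n)]. If there is none, the default 0 is harmless, since
   [e_ (sg 0)] vanishes at [x]. *)
pose ix x := xget 0%N [set n | D (sg n) x].
have ixP n x : D (sg n) x -> ix x = n.
  move=> Dx; have : [set n | D (sg n) x] (ix x) by apply: (xgetI _ Dx).
  by move=> /= Dx'; apply/sginj/(Ddisj I I); exists x.
pose J (u : nat -> Cplx R) x : Cplx R := u (ix x) * toC (e_ (sg (ix x)) x).
have JE u n x : D (sg n) x -> J u x = u n * toC (e_ (sg n) x).
  by move=> /ixP; rewrite /J => ->.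
have J0 u x : (forall n, ~ D (sg n) x) -> J u x = 0.
  by move=> nD; rewrite /J eD// mulr0.
have Jlin a u v x : J (fun n => a * u n + v n) x = a * J u x + J v x.
  by rewrite /J mulrDl mulrA.
(* At each point the partial sums are eventually constant; measurability of [J u] comes from this
   limit. *)
have Jcvg (r : nat -> R) x : (\sum_(0 <= m < N) r m * e_ (sg m) x) @[N --> \oo] -->
    r (ix x) * e_ (sg (ix x)) x.
  apply: cvg_near_cst; exists (ix x).+1 => // N /= ixN.
  rewrite (bigD1_seq (ix x)) ?mem_index_iota ?iota_uniq//= big1 ?addr0// => m mx.
  by rewrite eD ?mulr0// => /ixP mE; rewrite mE eqxx in mx.
have mJ u : cmeasurable (J u).
  split.
    rewrite (_ : (fun x => _) = fun x => complex.Re (u (ix x) : R[i]) * e_ (sg (ix x)) x).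
      apply: (@measurable_fun_cvg _ _ _ _
        (fun N x => \sum_(0 <= m < N) complex.Re (u m : R[i]) * e_ (sg m) x)).
        by move=> N; apply: measurable_sum => m; exact: measurable_funM.
      by move=> x _; exact: (Jcvg (fun m => complex.Re (u m : R[i]))).
    by apply/funext => x; rewrite /J; case: (u (ix x)) => a b /=; rewrite mulr0 subr0.
  rewrite (_ : (fun x => _) = fun x => complex.Im (u (ix x) : R[i]) * e_ (sg (ix x)) x).
    apply: (@measurable_fun_cvg _ _ _ _
      (fun N x => \sum_(0 <= m < N) complex.Im (u m : R[i]) * e_ (sg m) x)).
      by move=> N; apply: measurable_sum => m; exact: measurable_funM.
    by move=> x _; exact: (Jcvg (fun m => complex.Im (u m : R[i]))).
  by apply/funext => x; rewrite /J; case: (u (ix x)) => a b /=; rewrite mulr0 add0r.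
have Jle u C x : (forall n, normc (u n) <= C) -> normc (J u x) <= C * s x.
  move=> uC; rewrite /J ComplexField.Normc.normcM normc_toC.
  by apply: ler_pM => //; exact: normc_ge0.
have c0P u : in_c0 u -> exists C : R, [/\ 0 <= C, c0_norm u = C%:E & forall n, normc (u n) <= C].
  move=> u0; have /cvgrPdist_lt/(_ 1 ltr01)[N _ NP] := u0.
  pose B := \sum_(i < N) normc (u i) + 1.
  have uB n : normc (u n) <= B.
    have [nN|Nn] := ltnP n N.
      rewrite /B (bigD1 (Ordinal nN))//= -addrA lerDl addr_ge0// sumr_ge0// => i _.
      exact: normc_ge0.
    have := NP n Nn; rewrite sub0r normrN normc_normr (_ : 1 = toC 1)// toC_lt => /ltW.
    move=> /le_trans; apply; rewrite /B lerDr sumr_ge0// => i _; exact: normc_ge0.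
  have cge n : ((normc (u n))%:E <= c0_norm u)%E by apply: ereal_sup_ubound; exists n.
  have cB : (c0_norm u <= B%:E)%E by apply: ub_ereal_sup => _ [n _ <-]; rewrite lee_fin.
  have cfin : c0_norm u \is a fin_num.
    rewrite ge0_fin_numE; first by apply: le_lt_trans cB _; rewrite ltry.
    by apply: le_trans (cge 0%N); rewrite lee_fin normc_ge0.
  exists (fine (c0_norm u)); split; rewrite ?fineK//.
    rewrite -lee_fin fineK//; apply: le_trans (cge 0%N); rewrite lee_fin; exact: normc_ge0.
  by move=> n; rewrite -lee_fin fineK.
have low u C : 0 <= C -> c0_norm u = C%:E -> (forall n, normc (u n) <= C) ->
    del / 2 * C <= rnorm (Top (J u)).
  move=> C0 uC uleC; have := C0; rewrite le_eqVlt => /orP[/eqP <-|Cgt0].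
    by rewrite mulr0 rnorm_ge0.
  suff h n : normc (u n) <= (rnorm (Top (J u)) + del / 2 * C) / del.
    have : (C%:E <= ((rnorm (Top (J u)) + del / 2 * C) / del)%:E)%E.
      by rewrite -uC; apply: ub_ereal_sup => _ [n _ <-]; rewrite lee_fin.
    by rewrite lee_fin ler_pdivlMr//; lra.
  rewrite ler_pdivlMr//.
  have [a [a1 aun]] := normc_rotation (u n).
  have [JuX _] := luxemburg_dominated C0 (mJ u) (Jle u C ^~ uleC).
  have Jcb u' : (forall m, normc (u' m) <= C) -> cball (C * c) (J u').
    by move=> u'C; apply: cball_dominated => // x; exact: Jle.
  have Cc0 : 0 < C * c by rewrite mulr_gt0.
  (* After rotation, [a * J u] is [|u n| e_ (sg n)] plus the image of [w], the rotated sequence with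
     its [n]-th entry deleted. *)
  pose w m := if m == n then 0 else a * u m.
  have wC m : normc (w m) <= C.
    rewrite /w; case: eqP => _; first by rewrite ComplexField.Normc.normc0.
    by rewrite ComplexField.Normc.normcM a1 mul1r.
  have e1 : (fun x => a * J u x + (fun=> 0) x) =
      (fun x => toC (normc (u n)) * toC (e_ (sg n) x) + J w x).
    apply/funext => x; rewrite addr0.
    have [[m Dx]|nD] := pselect (exists m, D (sg m) x); last first.
      have nD' m : ~ D (sg m) x by move=> Dm; apply: nD; exists m.
      by rewrite !J0// eD// !mulr0 addr0.
    rewrite !(JE _ m)// /w; case: eqP => [->|mn].
      by rewrite mul0r addr0 mulrA aun.
    rewrite (@eD (sg n)) ?mulr0 ?add0r ?mulrA// => Dn.
    by apply: mn; rewrite -(ixP _ _ Dx) (ixP _ _ Dn).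
  have zc : cball c (fun=> 0) by apply: (@admissible_cball setT); exact: admissible0.
  have eball : cball c (fun x => toC (e_ (sg n) x)).
    apply: (@admissible_cball setT); split => [|x|x /(_ I)//]; first exact: cmeasurable_real.
    by rewrite normc_toC.
  have := congr1 Top e1.
  rewrite (Top_lin OPsi blT _ Cc0 c0 (Jcb u uleC) zc) Top0 addr0.
  rewrite (Top_lin OPsi blT _ c0 Cc0 eball (Jcb w wC)) => TE.
  have nuC : re (phi_ (sg n)) (- Top (J w)) <= C * (del / 2).
    have := sgP n; rewrite /nu.
    have [_ _ le] := MVP (phi_ (sg n)) (\bigcup_(j in [set sg m | m in [set m | m != n]]) D j) (Bphi (sg n)).
    (* Division by [C] makes [J w] admissible; the sign turns a bound from above into the required
       bound from below. *)
    pose z := toC (- C^-1) : Cplx R.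
    have zE : Top (fun x => z * J w x + (fun=> 0) x) = z *: Top (J w).
      by rewrite (Top_lin OPsi blT _ Cc0 c0 (Jcb w wC) zc) Top0 addr0.
    have adm : admissible (\bigcup_(j in [set sg m | m in [set m | m != n]]) D j)
        (fun x => z * J w x + (fun=> 0) x).
      split=> [|x|x nD]; first by apply: cmeasurable_lin => //; exact: zc.1.
        rewrite addr0 ComplexField.Normc.normcM normc_toC normrN normfV (gtr0_norm Cgt0).
        by rewrite ler_pdivrMl//; exact: Jle.
      rewrite addr0; have [[m Dx]|nDx] := pselect (exists m, D (sg m) x); last first.
        by rewrite J0 ?mulr0// => m Dm; apply: nDx; exists m.
      rewrite (JE _ m)// /w; case: eqP => [_|/eqP mn]; first by rewrite mul0r mulr0.
      by case: nD; exists (sg m) => //; exists m.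
    move=> h; have := le_trans (le _ adm) h; rewrite zE (re_linZ (Bphi _).1).
    by rewrite (re_linN (Bphi _).1) mulNr -mulrN ler_pdivrMl.
  have := (Bphi (sg n)).2 (a *: Top (J u)).
  rewrite rnormZ a1 mul1r TE (re_linD (Bphi _).1) (re_linZ (Bphi _).1).
  rewrite (re_linN (Bphi _).1) in nuC.
  have := ler_wpM2l (normc_ge0 (u n)) (edel (sg n)); rewrite LopE.
  by move: nuC; rewrite [C * _]mulrC; lra.
exists J; split.
- move=> u /c0P[C [C0 _ uC]].
  by have [] := luxemburg_dominated C0 (mJ u) (Jle u C ^~ uC).
- move=> a u v _ _; apply/eqP; rewrite eq_le; apply/andP; split; last first.
    by apply: le_ereal_inf_tmp => _ [r [r0 _] <-]; rewrite lee_fin ltW.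
  have -> : (fun x => J (fun n => a * u n + v n) x - (a * J u x + J v x)) = fun=> 0.
    by apply/funext => x; rewrite Jlin subrr.
  have [|x|_] := @luxemburg_dominated 0 (fun=> 0) (lexx 0); last by rewrite mul0r.
    by split; exact: measurable_cst.
  by rewrite mul0r ComplexField.Normc.normc0.
- have [_ [M MP]] := blT; pose M' := Num.max M 1.
  have M'0 : 0 < M' by rewrite lt_max ltr01 orbT.
  exists (del / 2 / M'), c; split; first by rewrite !divr_gt0.
  split=> // u /c0P[C [C0 uE uC]]; rewrite uE -!EFinM.
  have [JX JC] := luxemburg_dominated C0 (mJ u) (Jle u C ^~ uC).
  split; last by rewrite mulrC.
  have := MP _ JX; have lux0 : (0 <= luxemburg P Psi (J u))%E.
    by apply: le_ereal_inf_tmp => _ [r [r0 _] <-]; rewrite lee_fin ltW.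
  have luxfin : luxemburg P Psi (J u) \is a fin_num.
    by rewrite ge0_fin_numE//; apply: le_lt_trans JC _; rewrite ltry.
  rewrite -(fineK luxfin) -EFinM !lee_fin => h.
  rewrite mulrAC ler_pdivrMr//; apply: (le_trans (low u C C0 uE uC)).
  apply: (le_trans h); rewrite mulrC ler_wpM2l//; last by rewrite le_max lexx.
  by rewrite -lee_fin fineK.
- exists (del / 2); split; first by rewrite divr_gt0.
  by move=> u /c0P[C [C0 uE uC]]; rewrite uE -EFinM lee_fin; exact: low.
Qed.

End C0Embedding.

(** * Operators on an order interval *)

Section Variation.
Context (d : measure_display) (T : measurableType d) (R : realType).
Variables (P : probability T R) (Psi : \bar R -> \bar R).
Hypothesis OPsi : Orlicz_function Psi.
Variables (Z : completeNormedModType (Cplx R)) (Top : (T -> Cplx R) -> Z).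
Hypothesis blT : bounded_linear_on_orlicz P Psi Top.
Local Notation toC := (@real_complex R : R -> Cplx R).
Local Notation re phi z := (complex.Re (phi z : R[i])).
Local Notation Lop := (Lop Top).
Local Notation Espace := (Espace P Psi).
Implicit Types (w t : T -> R) (K r : R) (phi : Z -> Cplx R).

Variables (s : T -> R) (c : R).
Hypotheses (c0 : 0 < c) (s0 : forall x, 0 <= s x) (sc : mball P Psi c s).

Let ms : measurable_fun setT s := sc.1.

Definition below w t := measurable_fun setT t /\ forall x, `|t x| <= w x.

(* The value at [w] of the absolute value of the functional [re phi \o Lop]. *)
Definition absmu phi w := sup [set re phi (Lop t) | t in below w].

(** The positive cone of the ideal generated by [s], on which [absmu] is finite and additive. *)
Definition order_bounded w := exists2 K, 0 < K & forall x, 0 <= w x <= K * s x.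

Lemma below_mball K w t : 0 < K -> (forall x, w x <= K * s x) -> below w t ->
  mball P Psi (K * c) t.
Proof.
move=> K0 wK [mt tw]; have sK := mballZ OPsi (lt0r_neq0 K0) sc.
rewrite (gtr0_norm K0) in sK.
apply: (mball_le OPsi _ _ _ sK); rewrite ?mulr_gt0// => x.
by rewrite [leRHS]ger0_norm ?mulr_ge0 ?(ltW K0)//; apply: le_trans (tw x) (wK x).
Qed.

Lemma below_Espace w t : order_bounded w -> below w t -> Espace t.
Proof.
move=> [K K0 wK] tw; exists (K * c); first exact: mulr_gt0.
by apply: below_mball tw => // x; have /andP[] := wK x.
Qed.

Lemma below0 w : (forall x, 0 <= w x) -> below w (fun=> 0).
Proof. by move=> w0; split=> // x; rewrite normr0. Qed.

Section Functional.
Variable phi : Z -> Cplx R.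
Hypothesis Bphi : dual_ball phi.

Lemma absmu_le w r : (forall x, 0 <= w x) ->
  (forall t, below w t -> re phi (Lop t) <= r) -> absmu phi w <= r.
Proof.
move=> w0 h; apply: ge_sup; last by move=> _ [t tw <-]; exact: h.
by exists (re phi (Lop (fun=> 0))); exists (fun=> 0) => //; exact: below0.
Qed.

Lemma absmu_ge w t : order_bounded w -> below w t -> re phi (Lop t) <= absmu phi w.
Proof.
move=> [K K0 wK] tw; apply: ub_le_sup; last by exists t.
have [M M0 MP] := Lop_bound OPsi blT; exists (M * (K * c)) => _ [t' t'w <-].
apply: (le_trans (Bphi.2 _)); apply: MP; first exact: mulr_gt0.
by apply: below_mball t'w => // x; have /andP[] := wK x.
Qed.

Lemma absmu_ge0 w : order_bounded w -> 0 <= absmu phi w.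
Proof.
move=> ow; have [K K0 wK] := ow.
have := absmu_ge ow (below0 (fun x => proj1 (andP (wK x)))).
by rewrite (Lop0 OPsi blT) (lin0 Bphi.1).
Qed.

Lemma absmu_mono w w' : (forall x, 0 <= w x <= w' x) -> order_bounded w' ->
  absmu phi w <= absmu phi w'.
Proof.
move=> ww' ow'; apply: absmu_le => [x|t [mt tw]]; first by have /andP[] := ww' x.
apply: absmu_ge => //; split=> // x; apply: (le_trans (tw x)).
by have /andP[] := ww' x.
Qed.

(** The Riesz-Kantorovich argument: a competitor for [w + w'] is truncated to [[-w, w]], and what
    remains is bounded by [w']. *)
Lemma absmuD w w' : measurable_fun setT w -> order_bounded w -> order_bounded w' ->
  absmu phi (fun x => w x + w' x) = absmu phi w + absmu phi w'.
Proof.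
move=> mw ow ow'; have [K K0 wK] := ow; have [K' K'0 wK'] := ow'.
have w0 x : 0 <= w x by have /andP[] := wK x.
have w'0 x : 0 <= w' x by have /andP[] := wK' x.
have oww : order_bounded (fun x => w x + w' x).
  exists (K + K') => [|x]; first exact: addr_gt0.
  by have /andP[? ?] := wK x; have /andP[? ?] := wK' x; rewrite mulrDl addr_ge0//= lerD.
apply/eqP; rewrite eq_le; apply/andP; split.
  apply: absmu_le => [x|t [mt tw]]; first exact: addr_ge0.
  pose t1 x := Num.max (Num.min (t x) (w x)) (- w x).
  have bt1 : below w t1.
    split=> [|x].
      apply: measurable_maxr; first exact: measurable_minr.
      exact: measurableT_comp.
    rewrite /t1 ler_norml le_max lexx orbT/=; have := w0 x.
    by rewrite /Num.max /Num.min; do 2 case: ifP; lra.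
  have bt2 : below w' (fun x => t x - t1 x).
    split=> [|x]; first by apply: measurable_funB => //; exact: bt1.1.
    have := tw x; have := w0 x; have := w'0 x; rewrite /t1 !ler_norml => ? ? /andP[? ?].
    by case: (leP (t x) (w x)) => ?; case: (leP _ (- w x)) => ?; apply/andP; split; lra.
  have -> : Lop t = Lop t1 + Lop (fun x => t x - t1 x).
    rewrite -(LopD OPsi blT (below_Espace ow bt1) (below_Espace ow' bt2)).
    by congr Lop; apply/funext => x; rewrite subrKC.
  by rewrite (re_linD Bphi.1) lerD// absmu_ge.
rewrite -lerBrDr; apply: absmu_le => // t bt; rewrite lerBrDr -lerBrDl.
apply: absmu_le => // t' bt'; rewrite lerBrDl.
rewrite -(re_linD Bphi.1) -(LopD OPsi blT (below_Espace ow bt) (below_Espace ow' bt')).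
apply: absmu_ge => //; split; first by apply: measurable_funD; [exact: bt.1|exact: bt'.1].
by move=> x; apply: (le_trans (ler_normD _ _)); rewrite lerD ?bt.2 ?bt'.2.
Qed.

Lemma order_boundedZ a w : 0 < a -> order_bounded w -> order_bounded (fun x => a * w x).
Proof.
move=> a0 [K K0 wK]; exists (a * K) => [|x]; first exact: mulr_gt0.
by have /andP[? ?] := wK x; rewrite mulr_ge0 ?(ltW a0)//= -mulrA ler_pM2l.
Qed.

Lemma absmuZ_ge a w : 0 < a -> order_bounded w ->
  a * absmu phi w <= absmu phi (fun x => a * w x).
Proof.
move=> a0 ow; have [K K0 wK] := ow.
rewrite -ler_pdivlMl//; apply: absmu_le => [x|t bt]; first by have /andP[] := wK x.
rewrite ler_pdivlMl// -(re_linZ Bphi.1) -(LopZ OPsi blT _ (below_Espace ow bt)).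
apply: absmu_ge; first exact: order_boundedZ.
split=> [|x]; first by apply: measurable_funM => //; exact: bt.1.
by rewrite normrM (gtr0_norm a0) ler_pM2l// bt.2.
Qed.

Lemma absmuZ a w : 0 < a -> order_bounded w ->
  absmu phi (fun x => a * w x) = a * absmu phi w.
Proof.
move=> a0 ow; apply/eqP; rewrite eq_le absmuZ_ge// andbT.
have ai : 0 < a^-1 by rewrite invr_gt0.
rewrite -ler_pdivrMl//; apply: (le_trans (absmuZ_ge ai (order_boundedZ a0 ow))).
rewrite (_ : (fun x => a^-1 * (a * w x)) = w)//; apply/funext => x.
by rewrite mulKf// gt_eqF.
Qed.

End Functional.

Lemma order_bounded_indic A : order_bounded (fun x => s x * \1_A x).
Proof.
exists 1 => // x; rewrite mul1r indicE; have := s0 x.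
by case: (x \in A); rewrite ?mulr1 ?mulr0 ?lexx => ->.
Qed.

Lemma measurable_s_indic A : measurable A -> measurable_fun setT (fun x => s x * \1_A x).
Proof. by move=> mA; apply: measurable_funM => //; exact: measurable_indic. Qed.

Lemma absmu_cover phi (A A' B : set T) : dual_ball phi -> measurable A' ->
  A `<=` A' `|` B ->
  absmu phi (fun x => s x * \1_A x) <=
  absmu phi (fun x => s x * \1_A' x) + absmu phi (fun x => s x * \1_B x).
Proof.
move=> Bphi mA' AB.
have oA' := order_bounded_indic A'; have oB := order_bounded_indic B.
rewrite -absmuD//; last exact: measurable_s_indic.
apply: absmu_mono => // [x|].
  rewrite -mulrDr !indicE mulr_ge0//= ler_wpM2l//.
  have [/set_mem/AB[xA'|xB]|] := boolP (x \in A); last by rewrite addr_ge0.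
    by rewrite (mem_set xA') lerDl.
  by rewrite (mem_set xB) lerDr.
have [K K0 wK] := oA'; have [K' K'0 wK'] := oB.
exists (K + K') => [|x]; first exact: addr_gt0.
by have /andP[? ?] := wK x; have /andP[? ?] := wK' x; rewrite mulrDl addr_ge0//= lerD.
Qed.

Lemma absmu_set0 phi : dual_ball phi -> absmu phi (fun x => s x * \1_(@set0 T) x) = 0.
Proof.
move=> Bphi; apply/eqP; rewrite eq_le absmu_ge0// ?andbT; last exact: order_bounded_indic.
apply: absmu_le => [x|t [_ t0]]; first by rewrite indic0 mulr0.
rewrite (_ : t = fun=> 0) ?(Lop0 OPsi blT) ?(lin0 Bphi.1)//; apply/funext => x.
by apply/eqP; rewrite -normr_le0; apply: le_trans (t0 x) _; rewrite indic0 mulr0.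
Qed.

End Variation.

(** * Exhaustive submeasures and escaping mass *)

Section Control.
Context (d : measure_display) (T : measurableType d) (R : realType).
Variables (P : probability T R) (Psi : \bar R -> \bar R).
Hypothesis OPsi : Orlicz_function Psi.
Variables (Z : completeNormedModType (Cplx R)) (Top : (T -> Cplx R) -> Z).
Hypothesis blT : bounded_linear_on_orlicz P Psi Top.
Hypothesis nofix : ~ fixes_c0 P Psi Top.
Local Notation re phi z := (complex.Re (phi z : R[i])).
Local Notation Lop := (Lop Top).

Variables (s : T -> R) (c : R).
Hypotheses (c0 : 0 < c) (s0 : forall x, 0 <= s x) (sc : mball P Psi c s).

Local Notation mass phi A := (absmu Top phi (fun x => s x * \1_A x)).

Section Submeasure.
Variable phi_ : nat -> Z -> Cplx R.
Hypothesis Bphi : forall j, dual_ball (phi_ j).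

Definition supmass (A : set T) := sup (range (fun j => mass (phi_ j) A)).

Lemma mass_supmass j A : mass (phi_ j) A <= supmass A.
Proof.
apply: ub_le_sup; last by exists j.
have [M M0 MP] := Lop_bound OPsi blT; exists (M * (1 * c)) => _ [i _ <-].
have oA := order_bounded_indic s0 A; have [K K0 sK] := oA.
apply: absmu_le => [x|t bt]; first by have /andP[] := sK x.
apply: (le_trans ((Bphi i).2 _)); apply: MP; first by rewrite mul1r.
apply: (below_mball OPsi c0 s0 sc ltr01 _ bt) => x; rewrite mul1r indicE.
by have := s0 x; case: (x \in A); rewrite ?mulr1 ?mulr0.
Qed.

Lemma supmass_le A r : (forall j, mass (phi_ j) A <= r) -> supmass A <= r.
Proof.
move=> h; apply: ge_sup; last by move=> _ [j _ <-]; exact: h.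
by exists (mass (phi_ 0%N) A); exists 0%N.
Qed.

Lemma supmass_cover A A' B : measurable A' -> A `<=` A' `|` B ->
  supmass A <= supmass A' + supmass B.
Proof.
move=> mA' AB; apply: supmass_le => j.
apply: (le_trans (absmu_cover OPsi blT c0 s0 sc (Bphi j) mA' AB)).
by apply: lerD; exact: mass_supmass.
Qed.

Lemma supmass_set0 : supmass set0 = 0.
Proof.
apply/eqP; rewrite eq_le; apply/andP; split.
  by apply: supmass_le => j; rewrite (absmu_set0 OPsi blT c0 s0 sc).
by have := mass_supmass 0%N set0; rewrite (absmu_set0 OPsi blT c0 s0 sc).
Qed.

Lemma supmass_mono A B : measurable B -> A `<=` B -> supmass A <= supmass B.
Proof.
move=> mB AB; have := @supmass_cover A B set0 mB.
by rewrite setU0 supmass_set0 addr0; apply.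
Qed.

(** The absence of a fixed copy of c_0 enters here: disjoint sets with [supmass] above [del] would
    carry functions below [s] on which functionals of the dual ball keep [Top] bounded below. *)
Lemma supmass_exhaustive (D : nat -> set T) del : (forall j, measurable (D j)) ->
  trivIset setT D -> 0 < del -> exists j, supmass (D j) <= del.
Proof.
move=> mD Ddisj del0; apply/not_existsP => h; apply: nofix.
have /choice[n nP] : forall j, exists n, del < mass (phi_ n) (D j).
  move=> j; apply/not_existsP => hn; apply: (h j); apply: supmass_le => n.
  by rewrite leNgt; apply/negP; exact: hn.
have /choice[e eP] : forall j, exists t, below (fun x => s x * \1_(D j) x) t /\
    del <= re (phi_ (n j)) (Lop t).
  move=> j; apply/not_existsP => ht; have := nP j; rewrite ltNge => /negP; apply.
  apply: absmu_le => [x|t bt].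
    by have [K K0 sK] := order_bounded_indic s0 (D j); have /andP[] := sK x.
  by rewrite leNgt; apply/negP => /ltW dt; apply: (ht t).
apply: (@disjoint_fixes_c0 _ _ _ P Psi OPsi _ Top blT s c c0 s0 sc D e (phi_ \o n) del) => //.
- by move=> j; exact: (eP j).1.1.
- move=> j x; apply: (le_trans ((eP j).1.2 x)); rewrite indicE.
  by have := s0 x; case: (x \in D j); rewrite ?mulr1 ?mulr0.
- move=> j x nDx; apply/eqP; rewrite -normr_le0; apply: (le_trans ((eP j).1.2 x)).
  by rewrite indicE memNset// mulr0.
- by move=> j /=; exact: Bphi.
- by move=> j /=; exact: (eP j).2.
Qed.

(** The substitute for continuity from below. Infinitely many jumps above [e] along an increasing
    sequence would occur on pairwise disjoint differences. *)
Lemma supmass_increasing (U : nat -> set T) e : (forall n, measurable (U n)) ->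
  (forall m n, (m <= n)%N -> U m `<=` U n) -> 0 < e ->
  exists N, forall n, (N <= n)%N -> supmass (U n `\` U N) <= e.
Proof.
move=> mU Umono e0; apply/not_existsP => h.
have /choice[f fP] : forall N, exists n, (N <= n)%N /\ e < supmass (U n `\` U N).
  move=> N; apply/not_existsP => hn; apply: (h N) => n Nn.
  by rewrite leNgt; apply/negP => lt; apply: (hn n).
pose N k := iter k f 0%N.
have Nmono k l : (k <= l)%N -> (N k <= N l)%N.
  move=> /subnK <-; elim: (l - k)%N => [|i IH]; first by rewrite add0n.
  by apply: (leq_trans IH); rewrite addSn; exact: (fP _).1.
have [||//|j] := @supmass_exhaustive (fun k => U (N k.+1) `\` U (N k)) e.
- by move=> k; exact: measurableD.
- apply/trivIsetP => i j _ _; wlog ij : i j / (i < j)%N.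
    move=> H; rewrite neq_ltn => /orP[ij|ji]; first by apply: H => //; rewrite ltn_eqF.
    by rewrite setIC; apply: H => //; rewrite ltn_eqF.
  move=> _; apply/seteqP; split=> // x [[Ui _] [_ nUj]]; apply: nUj.
  exact: (Umono _ _ (Nmono _ _ ij)).
- by rewrite leNgt /N iterS (fP _).2.
Qed.

Lemma supmass_decreasing (H : nat -> set T) e : (forall n, measurable (H n)) ->
  (forall m n, (m <= n)%N -> H n `<=` H m) -> 0 < e ->
  exists N, forall n, (N <= n)%N -> supmass (H N `\` H n) <= e.
Proof.
move=> mH Hmono e0.
have [||//|N NP] := @supmass_increasing (fun n => ~` H n) e.
- by move=> n; exact: measurableC.
- by move=> m n mn; apply: subsetC; exact: Hmono.
exists N => n Nn; have := NP n Nn; congr (supmass _ <= _).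
by rewrite setDE setCK setIC -setDE.
Qed.

Variables (E : nat -> set T) (e : R).
Hypotheses (mE : forall j, measurable (E j)) (e0 : 0 < e).
Hypothesis small : forall i j, (i < j)%N -> mass (phi_ i) (E j) <= 2^-1 ^+ j.
Hypothesis large : forall j, e < mass (phi_ j) (E j).

Let U m K := [set x | exists2 j, (j < K)%N & E (m + j)%N x].

Let U0 m : U m 0 = set0.
Proof. by apply/seteqP; split=> x // [j]. Qed.

Let US m K : U m K.+1 = U m K `|` E (m + K)%N.
Proof.
apply/seteqP; split=> x.
  move=> [j]; rewrite ltnS leq_eqVlt => /orP[/eqP ->|jK Ex]; first by right.
  by left; exists j.
by move=> [[j jK Ex]|Ex]; [exists j => //; exact: ltnW|exists K].
Qed.

Let mU m K : measurable (U m K).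
Proof. by elim: K => [|K IH]; rewrite ?U0// US; exact: measurableU. Qed.

Let Umass i m K : (i < m)%N -> mass (phi_ i) (U m K) <= 2 * 2^-1 ^+ m.
Proof.
move=> im.
(* The exact geometric sum from [2^-m] to [2^-(m+K-1)], so that the induction closes. *)
suff : mass (phi_ i) (U m K) <= 2 * 2^-1 ^+ m - 2 * 2^-1 ^+ (m + K).
  have : 0 <= 2^-1 ^+ (m + K) :> R by rewrite exprn_ge0.
  by move: (mass _ _) (_ ^+ (m + K)) (_ ^+ m) => a b f; lra.
elim: K => [|K IH].
  by rewrite U0 (absmu_set0 OPsi blT c0 s0 sc)// addn0 subrr.
rewrite US; apply: (le_trans (absmu_cover OPsi blT c0 s0 sc (Bphi i) (mU m K) (fun _ h => h))).
have := small (leq_trans im (leq_addr K m)).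
rewrite addnS (exprS _ (m + K)); move: IH.
by move: (mass _ _) (mass _ _) (_ ^+ (m + K)) (_ ^+ m) => a a' b f; lra.
Qed.

(* [G m] approximates the union of the [E j], [j >= m], up to [supmass]-error
   [e 2^-m / 8]; no countable additivity is available here. *)
Lemma no_escaping_mass : False.
Proof.
have e2 m : 0 < e / 8 * 2^-1 ^+ m by rewrite mulr_gt0 ?divr_gt0 ?exprn_gt0// invr_gt0.
have /choice[N NP] : forall m, exists N, forall n, (N <= n)%N ->
    supmass (U m n `\` U m N) <= e / 8 * 2^-1 ^+ m.
  move=> m; apply: supmass_increasing => // k l kl x [j jk Ex].
  by exists j => //; exact: leq_trans kl.
(* The successor guarantees one term at least, so that [E m] is contained in [G m]. *)
pose G m := U m (N m).+1.
have mG m : measurable (G m) by exact: mU.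
have GD i m : (i <= m)%N -> supmass (G m `\` G i) <= e / 8 * 2^-1 ^+ i.
  move=> im.
  have [le|lt] := leqP (N i) (m - i + (N m).+1)%N.
    apply: le_trans (NP i _ le); apply: supmass_mono; first exact: measurableD.
    move=> x [[j jm Ex] nG]; split.
      exists (m - i + j)%N; first by rewrite ltn_add2l.
      by rewrite addnA subnKC.
    by apply: contra_not nG => -[k kN Ek]; exists k => //; exact: ltnW.
  rewrite (_ : _ `\` _ = set0) ?supmass_set0 ?ltW//; apply/seteqP; split=> // x [[j jm Ex] nG].
  apply: nG; exists (m - i + j)%N; last by rewrite addnA subnKC.
  by rewrite ltnS ltnW// (leq_trans _ lt)// ltnS leq_add2l ltnW.
pose H m := [set x | forall i, (i <= m)%N -> G i x].
have HS m : H m.+1 = H m `&` G m.+1.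
  apply/seteqP; split=> x => [h|[h1 h2] i].
    by split=> [i im|]; apply: h => //; exact: leqW.
  by rewrite leq_eqVlt => /orP[/eqP ->//|]; rewrite ltnS; exact: h1.
have mH m : measurable (H m).
  elim: m => [|m IH]; last by rewrite HS; exact: measurableI.
  rewrite (_ : H 0%N = G 0%N)//; apply/seteqP; split=> x; first exact.
  by move=> Gx i; rewrite leqn0 => /eqP ->.
have Hmono m n : (m <= n)%N -> H n `<=` H m.
  by move=> mn x Hx i im; apply: Hx; exact: leq_trans mn.
(* Intersecting with [G 0], ..., [G k] loses at most the sum of the [e / 8 * 2^-i], which is below
   [e / 4]; hence [H m] keeps [3 / 4 * e]. *)
have GH m k : (k <= m)%N -> supmass (G m) <= supmass (G m `&` H k) + e / 4 * (1 - 2^-1 ^+ k.+1).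
  elim: k => [|k IH] km.
    have := @supmass_cover (G m) (G m `&` H 0%N) (G m `\` G 0%N) (measurableI _ _ (mG m) (mH 0%N)).
    have cov : G m `<=` G m `&` H 0%N `|` G m `\` G 0%N.
      move=> x Gx; have [G0|nG0] := pselect (G 0%N x); [left|by right].
      by split=> // i; rewrite leqn0 => /eqP ->.
    move=> /(_ cov); have := GD 0%N m (leq0n _); rewrite expr0 expr1.
    by move: (supmass _) (supmass _) (supmass _) => a b f; lra.
  have cov : G m `&` H k `<=` G m `&` H k.+1 `|` G m `\` G k.+1.
    move=> x [Gx Hx]; have [Gk|nGk] := pselect (G k.+1 x); [left|by right].
    by rewrite HS.
  have := supmass_cover (measurableI _ _ (mG m) (mH k.+1)) cov.
  have := GD k.+1 m km; have := IH (ltnW km); rewrite !exprS.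
  move: (supmass (G m)) (supmass (_ `&` H k)) (supmass (_ `&` H k.+1)) (supmass (_ `\` _)).
  by move: (2^-1 ^+ k) => b a1 a2 a3 a4; lra.
have Hlarge m : 3 / 4 * e <= supmass (H m).
  have := GH m m (leqnn m); rewrite (_ : G m `&` H m = H m); last first.
    by apply/setIidPr => x; exact.
  have := le_trans (ltW (large m)) (mass_supmass m (E m)).
  have : supmass (E m) <= supmass (G m).
    by apply: supmass_mono => // x Ex; exists 0%N => //; rewrite addn0.
  have : 0 <= e * 2^-1 ^+ m.+1 :> R by rewrite mulr_ge0 ?exprn_ge0// ltW.
  by move: (_ ^+ _) (supmass _) (supmass _) (supmass _) => a b f g; lra.
have e4 : 0 < e / 4 by rewrite divr_gt0.
have [N0 N0P] := supmass_decreasing mH Hmono e4.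
(* For a fixed functional, [H n] with [n] large has mass at most [2 * 2^-n <= e / 4], and passing
   from [H n] to [H N0] adds at most [e / 4]. This contradicts [Hlarge]. *)
have : supmass (H N0) <= e / 2.
  apply: supmass_le => i.
  have e8 : 0 < e / 8 by rewrite divr_gt0.
  have [k kP] := archimedean_inv e8.
  pose n := (N0 + i + k).+1.
  have Nn : (N0 <= n)%N by rewrite /n -addnA; apply: leqW; exact: leq_addr.
  have inn : (i < n)%N by rewrite /n ltnS addnAC leq_addl.
  have cov : H N0 `<=` H n `|` H N0 `\` H n.
    by move=> x Hx; have [?|?] := pselect (H n x); [left|right].
  have := absmu_cover OPsi blT c0 s0 sc (Bphi i) (mH n) cov.
  have := le_trans (mass_supmass i (H N0 `\` H n)) (N0P n Nn).
  have HG : H n `<=` G n `|` set0 by move=> x Hx; left; exact: Hx.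
  have := absmu_cover OPsi blT c0 s0 sc (Bphi i) (mG n) HG.
  rewrite (absmu_set0 OPsi blT c0 s0 sc)// addr0.
  have := Umass (N n).+1 inn; rewrite -/(G n).
  have : 2^-1 ^+ n <= k.+1%:R^-1 :> R.
    rewrite exprVn lef_pV2 ?posrE ?exprn_gt0 ?ltr0n// -natrX ler_nat.
    apply: leq_trans (ltnW (ltn_expl n (isT : (1 < 2)%N))).
    by rewrite /n ltnS leq_addl.
  move: kP; move: (k.+1%:R^-1) (2^-1 ^+ n) (mass _ _) (mass _ _) (mass _ _) (mass _ _).
  by move=> a b a1 a2 a3 a4; lra.
have := Hlarge N0; move: (supmass _) => a; lra.
Qed.

End Submeasure.
End Control.

(** * Near-minimizers and midpoint gaps *)

(** The infima of [J] over the [C m] increase to a finite limit [I]. For large [m] and [l] the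
    values at [u m] and [u l] are at most [I + g / 2], while their midpoint lies in a set [C N2]
    whose infimum exceeds [I - g / 2]. *)
Lemma gap_sequence (R : realType) (V : Type) (mid : V -> V -> V) (C : nat -> set V)
    (J : V -> R) (B : R) :
  (forall m, C m !=set0) -> (forall m n, (m <= n)%N -> C n `<=` C m) ->
  (forall m u v, C m u -> C m v -> C m (mid u v)) ->
  (forall u, C 0%N u -> 0 <= J u <= B) ->
  exists2 u : nat -> V, (forall m, C m (u m)) &
    forall g, 0 < g -> exists N, forall m l, (N <= m)%N -> (N <= l)%N ->
      (J (u m) + J (u l)) / 2 - J (mid (u m) (u l)) <= g.
Proof.
move=> Cne Cmono Cmid JB.
pose i m := inf [set J u | u in C m].
have JC m u : C m u -> 0 <= J u <= B by move=> /(Cmono 0%N m (leq0n _)); exact: JB.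
have ile m u : C m u -> i m <= J u.
  move=> Cu; apply: ge_inf; last by exists u.
  by exists 0 => _ [v /JC/andP[Jv _] <-].
have iB m : i m <= B.
  by have [u Cu] := Cne m; apply: (le_trans (ile _ _ Cu)); have /andP[] := JC _ _ Cu.
have hsup : has_sup (range i).
  by split; [exists (i 0%N), 0%N|exists B => _ [m _ <-]].
pose I := sup (range i).
have iI m : i m <= I by apply: ub_le_sup; [exact: hsup.2|exists m].
have imono m n : (m <= n)%N -> i m <= i n.
  move=> mn; apply: lb_le_inf; first by have [u Cu] := Cne n; exists (J u), u.
  by move=> _ [u /(Cmono _ _ mn) Cu <-]; exact: ile.
have /choice[u uP] : forall m, exists u, C m u /\ J u < i m + m.+1%:R^-1.
  move=> m; have hinf : has_inf [set J u | u in C m].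
    split; first by have [u Cu] := Cne m; exists (J u), u.
    by exists 0 => _ [v /JC/andP[Jv _] <-].
  have m0 : 0 < m.+1%:R^-1 :> R by rewrite invr_gt0 ltr0n.
  by have [_ [u Cu <-] lt] := inf_adherent m0 hinf; exists u.
exists u => [m|g g0]; first exact: (uP m).1.
have g2 : 0 < g / 2 by rewrite divr_gt0.
have [N1 N1P] := archimedean_inv g2.
have [_ [N2 _ <-] N2P] := sup_adherent g2 hsup.
exists (maxn N1 N2) => m l; rewrite !geq_max => /andP[m1 m2] /andP[l1 l2].
have hm k : (N1 <= k)%N -> (N2 <= k)%N -> J (u k) <= I + g / 2.
  move=> k1 k2; apply/ltW; apply: (lt_le_trans (uP k).2); apply: lerD => //.
  by apply: le_trans (ltW N1P); rewrite lef_pV2 ?posrE ?ltr0n// ler_nat.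
have := hm m m1 m2; have := hm l l1 l2.
have : i N2 <= J (mid (u m) (u l)).
  by apply: ile; apply: Cmid; [exact: (Cmono _ _ m2 _ (uP m).1)|exact: (Cmono _ _ l2 _ (uP l).1)].
by move: N2P; rewrite -/I; lra.
Qed.

Section SqrtGap.
Variable R : realType.
Implicit Types (s x y : R).

(** Positively homogeneous in the pair [(s, x)], so that its convexity gap scales with the weight
    [s]; the weight 1 serves convergence in measure. *)
Definition hyp s x : R := Num.sqrt (s ^+ 2 + x ^+ 2).

Lemma hyp_ge0 s x : 0 <= hyp s x.
Proof. exact: sqrtr_ge0. Qed.

Lemma hyp_sqr s x : hyp s x ^+ 2 = s ^+ 2 + x ^+ 2.
Proof. by rewrite sqr_sqrtr// addr_ge0// sqr_ge0. Qed.

Lemma hyp_le K s x : 0 <= s -> 0 <= K -> `|x| <= K * s -> hyp s x <= (1 + K) * s.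
Proof.
move=> s0 K0 xK; rewrite -(@ler_pXn2r _ 2) ?nnegrE ?hyp_ge0 ?mulr_ge0 ?addr_ge0// hyp_sqr.
have : x ^+ 2 <= (K * s) ^+ 2.
  by rewrite -real_normK ?num_real// ler_pXn2r ?nnegrE ?mulr_ge0.
have := mulr_ge0 K0 (sqr_ge0 s); rewrite !expr2; nra.
Qed.

Lemma hyp_gap_sqr s x y :
  hyp s x * hyp s y - s ^+ 2 - x * y =
  2 * (((hyp s x + hyp s y) / 2) ^+ 2 - hyp s ((x + y) / 2) ^+ 2).
Proof.
have := hyp_sqr s x; have := hyp_sqr s y; have := hyp_sqr s ((x + y) / 2).
move: (hyp s x) (hyp s y) (hyp s _) => a b m; rewrite !expr2; lra.
Qed.

Lemma hyp_cauchy_schwarz s x y : s ^+ 2 + x * y <= hyp s x * hyp s y.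
Proof.
have [neg|pos] := lerP (s ^+ 2 + x * y) 0.
  by apply: (le_trans neg); rewrite mulr_ge0// hyp_ge0.
rewrite -(@ler_pXn2r _ 2) ?nnegrE ?mulr_ge0 ?hyp_ge0 ?(ltW pos)//.
rewrite exprMn !hyp_sqr; have := mulr_ge0 (sqr_ge0 s) (sqr_ge0 (x - y)).
rewrite !expr2; nra.
Qed.

Lemma hyp_mid s x y : hyp s ((x + y) / 2) <= (hyp s x + hyp s y) / 2.
Proof.
rewrite -(@ler_pXn2r _ 2) ?nnegrE ?divr_ge0 ?addr_ge0 ?hyp_ge0//.
by have := hyp_gap_sqr s x y; have := hyp_cauchy_schwarz s x y; lra.
Qed.

(** Let [a], [b], [m] be the values at [x], [y] and the midpoint, and [q] the gap. Then [(ab - s^2 -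
    xy)(ab + s^2 + xy) = s^2 (x - y)^2] and [ab - s^2 - xy = 2 q ((a + b) / 2 + m)]. All values are
    at most [L = (1 + K) s], whence [e^2 s^4 <= 8 L^3 q]. *)
Lemma hyp_gap K e s x y : 0 < s -> 0 <= K -> 0 <= e -> `|x| <= K * s -> `|y| <= K * s ->
  e * s <= `|x - y| ->
  e ^+ 2 / (8 * (1 + K) ^+ 3) * s <= (hyp s x + hyp s y) / 2 - hyp s ((x + y) / 2).
Proof.
move=> s0 K0 e0 xK yK exy.
have aL := hyp_le (ltW s0) K0 xK; have bL := hyp_le (ltW s0) K0 yK.
have gap := hyp_gap_sqr s x y; have cs := hyp_cauchy_schwarz s x y.
have mid := hyp_mid s x y; have m0 := hyp_ge0 s ((x + y) / 2).
have a0 := hyp_ge0 s x; have b0 := hyp_ge0 s y.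
have sq : (hyp s x * hyp s y - s ^+ 2 - x * y) * (hyp s x * hyp s y + (s ^+ 2 + x * y)) =
    s ^+ 2 * (x - y) ^+ 2.
  have -> : (hyp s x * hyp s y - s ^+ 2 - x * y) * (hyp s x * hyp s y + (s ^+ 2 + x * y)) =
      hyp s x ^+ 2 * hyp s y ^+ 2 - (s ^+ 2 + x * y) ^+ 2 by ring.
  by rewrite !hyp_sqr; ring.
have xy2 : (e * s) ^+ 2 <= (x - y) ^+ 2.
  by rewrite -[leRHS]real_normK ?num_real// ler_pXn2r ?nnegrE ?mulr_ge0 ?(ltW s0).
set L := (1 + K) * s in aL bL.
have L0 : 0 < L by rewrite mulr_gt0//; lra.
move: gap cs mid m0 a0 b0 aL bL sq.
move: (hyp s x) (hyp s y) (hyp s ((x + y) / 2)) => a b m gap cs mid m0 a0 b0 aL bL sq.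
have ab : a * b <= L ^+ 2 by rewrite expr2; apply: ler_pM.
pose q := (a + b) / 2 - m.
have q0 : 0 <= q by rewrite /q subr_ge0.
have gE : a * b - s ^+ 2 - x * y = 2 * q * ((a + b) / 2 + m) by rewrite gap /q; ring.
have gle : a * b - s ^+ 2 - x * y <= 4 * L * q.
  rewrite gE; have : (a + b) / 2 + m <= 2 * L by lra.
  move=> /(ler_wpM2l q0); nra.
have le1 : s ^+ 2 * (e * s) ^+ 2 <= 8 * L ^+ 3 * q.
  apply: (@le_trans _ _ (s ^+ 2 * (x - y) ^+ 2)); first by rewrite ler_wpM2l// sqr_ge0.
  rewrite -sq; apply: (@le_trans _ _ ((4 * L * q) * (2 * L ^+ 2))).
    apply: ler_pM => //; [lra| |lra].
    have [|] := lerP 0 (s ^+ 2 + x * y); first by move=> ?; rewrite addr_ge0// mulr_ge0.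
    move=> neg; rewrite -(@pmulr_rge0 _ (a * b - s ^+ 2 - x * y)) ?sq.
      by rewrite mulr_ge0 ?sqr_ge0.
    have := mulr_ge0 a0 b0; lra.
  by rewrite le_eqVlt; apply/orP; left; apply/eqP; ring.
rewrite -/q mulrAC ler_pdivrMr; last by rewrite mulr_gt0// exprn_gt0//; lra.
rewrite -(ler_pM2r (exprn_gt0 3 s0)).
rewrite (_ : e ^+ 2 * s * s ^+ 3 = s ^+ 2 * (e * s) ^+ 2); last by ring.
rewrite (_ : q * (8 * (1 + K) ^+ 3) * s ^+ 3 = 8 * L ^+ 3 * q)//; by rewrite /L; ring.
Qed.

Lemma measurable_hyp d (T : measurableType d) (f g : T -> R) :
  measurable_fun setT f -> measurable_fun setT g ->
  measurable_fun setT (fun z => hyp (f z) (g z)).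
Proof.
move=> mf mg; apply: (measurableT_comp (f := @Num.sqrt R)).
  by apply: nondecreasing_measurable => // x y; exact: ler_wsqrtr.
by apply: measurable_funD; exact: measurable_funX.
Qed.

End SqrtGap.

(** * Convex blocks in an order interval *)

Section OrderBounded.
Context (d : measure_display) (T : measurableType d) (R : realType).
Variables (P : probability T R) (Psi : \bar R -> \bar R).
Hypothesis OPsi : Orlicz_function Psi.
Variables (Z : completeNormedModType (Cplx R)) (Top : (T -> Cplx R) -> Z).
Hypothesis blT : bounded_linear_on_orlicz P Psi Top.
Hypothesis nofix : ~ fixes_c0 P Psi Top.
Local Notation re phi z := (complex.Re (phi z : R[i])).
Local Notation toC := (@real_complex R : R -> Cplx R).
Local Notation Lop := (Lop Top).
Local Notation Espace := (Espace P Psi).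

Variables (s : T -> R) (c : R).
Hypotheses (c0 : 0 < c) (spos : forall x, 0 < s x) (sc : mball P Psi c s).

Let s0 x : 0 <= s x. Proof. exact: ltW. Qed.
Let ms : measurable_fun setT s := sc.1.

Local Notation mass phi A := (absmu Top phi (fun x => s x * \1_A x)).

(** Otherwise sets and functionals are chosen inductively: at stage [k] the previous functionals
    with threshold [2^-k] admit a bad set [E k], and a functional norming the bad image becomes
    [phi_ k]. This is the situation excluded by [no_escaping_mass]. *)
Lemma control e : 0 < e -> exists (n : nat) (phi_ : nat -> Z -> Cplx R) (del : R),
  [/\ forall i, dual_ball (phi_ i), 0 < del &
    forall E, measurable E -> (forall i, (i < n)%N -> mass (phi_ i) E <= del) ->
      forall t, below (fun x => s x * \1_E x) t -> rnorm (Lop t) <= e].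
Proof.
move=> e0; apply: contrapT => nh.
(* The default value of [nth], chosen inside the dual ball so that no index is exceptional. *)
pose z0 : Z -> Cplx R := fun=> 0.
have Bz0 : dual_ball z0.
  by split=> [a x y|z]; [rewrite /z0 mulr0 addr0|exact: rnorm_ge0].
have /choice[next nextP] : forall l : seq (Z -> Cplx R), exists Ep : set T * (Z -> Cplx R),
    (forall i, dual_ball (nth z0 l i)) ->
    [/\ measurable Ep.1, dual_ball Ep.2, e < mass Ep.2 Ep.1 &
      forall i, (i < size l)%N -> mass (nth z0 l i) Ep.1 <= 2^-1 ^+ size l].
  move=> l; have [Bl|nBl] := pselect (forall i, dual_ball (nth z0 l i)); last by exists (set0, z0).
  apply: contrapT => nEp; apply: nh; exists (size l), (nth z0 l), (2^-1 ^+ size l).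
  split=> [//||E mE Esmall t bt]; first by rewrite exprn_gt0// invr_gt0.
  rewrite leNgt; apply/negP => lt; apply: nEp.
  have [phi [Bphi phit]] := norming_functional (Lop t).
  exists (E, phi) => _; split=> //=; apply: (lt_le_trans lt); rewrite -phit.
  by apply: (absmu_ge OPsi blT c0 s0 sc Bphi) => //; exact: order_bounded_indic.
pose pre := fix pre k := if k is k'.+1 then rcons (pre k') (next (pre k')).2 else [::].
have size_pre k : size (pre k) = k by elim: k => //= k IH; rewrite size_rcons IH.
have Bpre k i : dual_ball (nth z0 (pre k) i).
  elim: k i => [|k IH] i /=; first by rewrite nth_nil.
  rewrite nth_rcons; case: ifP => // _; case: ifP => // _.
  by have [] := nextP _ IH.
pose phi_ k := (next (pre k)).2; pose E k := (next (pre k)).1.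
have nth_pre k i : (i < k)%N -> nth z0 (pre k) i = phi_ i.
  elim: k => // k IH; rewrite ltnS leq_eqVlt /= nth_rcons size_pre => /orP[/eqP ->|ik].
    by rewrite ltnn eqxx.
  by rewrite ik IH.
apply: (@no_escaping_mass _ _ _ P Psi OPsi Z Top blT nofix s c c0 s0 sc phi_ _ E e _ e0).
- by move=> j; have [] := nextP _ (Bpre j).
- by move=> j; have [] := nextP _ (Bpre j).
- move=> i j ij; have [_ _ _ h] := nextP _ (Bpre j).
  by have := h i; rewrite size_pre nth_pre//; apply.
- by move=> j; have [] := nextP _ (Bpre j).
Qed.

Variables (V : Type) (mid : V -> V -> V) (C : nat -> set V) (tau : V -> T -> R).
Hypothesis Cne : forall m, C m !=set0.
Hypothesis Cmono : forall m n, (m <= n)%N -> C n `<=` C m.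
Hypothesis Cmid : forall m u v, C m u -> C m v -> C m (mid u v).
Hypothesis taumid : forall u v x, tau (mid u v) x = (tau u x + tau v x) / 2.
Hypothesis tau_s : forall u, C 0%N u -> below s (tau u).

(** [J] sums the controlling measures of [hyp s (tau u)]. A small midpoint gap forces small masses
    on the set where the difference of two blocks exceeds [eta * s]. On that set [control] bounds
    the image; outside it the norm is small. *)
Lemma order_bounded_blocks e : 0 < e -> exists2 u : nat -> V, (forall m, C m (u m)) &
  forall m l, rnorm (Lop (fun x => tau (u m) x - tau (u l) x)) <= e.
Proof.
move=> e0; have [M M0 MP] := Lop_bound OPsi blT.
have e4 : 0 < e / 4 by rewrite divr_gt0.
have [n [phi_ [del [Bphi del0 ctl]]]] := control e4.
pose w u x := hyp (s x) (tau u x).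
have C0 m u : C m u -> C 0%N u by exact: Cmono.
have mw u : C 0%N u -> measurable_fun setT (w u).
  by move=> /tau_s[mt _]; exact: measurable_hyp.
have w2 u x : C 0%N u -> 0 <= w u x <= 2 * s x.
  move=> /tau_s[_ /(_ x) tx]; rewrite hyp_ge0 /= (_ : 2 = 1 + 1 :> R)//.
  by apply: hyp_le; rewrite ?mul1r.
have ow u : C 0%N u -> order_bounded s (w u).
  by move=> Cu; exists 2 => // x; exact: w2.
have o2s : order_bounded s (fun x => 2 * s x).
  by exists 2 => // x; rewrite lexx mulr_ge0.
pose J u := \sum_(i < n) absmu Top (phi_ i) (w u).
pose B := \sum_(i < n) absmu Top (phi_ i) (fun x => 2 * s x).
have JB u : C 0%N u -> 0 <= J u <= B.
  move=> Cu; apply/andP; split.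
    by apply: sumr_ge0 => i _; exact: (absmu_ge0 OPsi blT c0 s0 sc (Bphi i) (ow _ Cu)).
  apply: ler_sum => i _; apply: (absmu_mono OPsi blT c0 s0 sc (Bphi i)) => // x.
  exact: w2.
have [u uC uJ] := gap_sequence Cne Cmono Cmid JB.
(* A function below [eta * s] has an image of norm at most [M * eta * c = e / 2]; [kap] is the
   constant of [hyp_gap] for [K = 1]. *)
pose eta := e / (2 * M * c).
have eta0 : 0 < eta by rewrite divr_gt0// !mulr_gt0.
pose kap : R := eta ^+ 2 / (8 * (1 + 1) ^+ 3).
have kap0 : 0 < kap by rewrite divr_gt0 ?exprn_gt0// mulr_gt0 ?exprn_gt0//; lra.
have [N NP] := uJ (kap * del) (mulr_gt0 kap0 del0).
exists (fun m => u (m + N)%N) => [m|m l]; first exact: (Cmono (leq_addr N m) (uC _)).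
have := NP _ _ (leq_addl m N) (leq_addl l N).
have := C0 _ _ (uC (m + N)%N); have := C0 _ _ (uC (l + N)%N).
move: (u (m + N)%N) (u (l + N)%N) => a b Cb Ca gapJ.
have Cab := Cmid Ca Cb.
have [ma sa] := tau_s Ca; have [mb sb] := tau_s Cb.
have Ea : Espace (tau a) by apply: (below_Espace OPsi c0 s0 sc (w := s)) => //; exists 1 => // x; rewrite mul1r s0/=.
have Eb : Espace (tau b) by apply: (below_Espace OPsi c0 s0 sc (w := s)) => //; exists 1 => // x; rewrite mul1r s0/=.
pose dif x := tau a x - tau b x.
have mdif : measurable_fun setT dif by exact: measurable_funB.
pose E := [set x | eta * s x < `|dif x|].
have mE : measurable E.
  rewrite (_ : E = (fun x => `|dif x| - eta * s x) @^-1` `]0, +oo[%classic).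
    rewrite -[X in measurable X]setTI; apply: measurable_funB => //.
      exact: measurableT_comp.
    exact: measurable_funM.
  by apply/seteqP; split=> x /=; rewrite in_itv/= andbT subr_gt0.
pose g x := (w a x + w b x) / 2 - w (mid a b) x.
have mg : measurable_fun setT g.
  apply: measurable_funB; last exact: mw.
  by apply: measurable_funM => //; apply: measurable_funD; exact: mw.
have g0 x : 0 <= g x <= 2 * s x.
  have hmid : w (mid a b) x <= (w a x + w b x) / 2 by rewrite /w taumid; exact: hyp_mid.
  have /andP[_ ha] := w2 a x Ca; have /andP[_ hb] := w2 b x Cb.
  by have /andP[hm _] := w2 _ x Cab; rewrite /g; apply/andP; split; lra.
have og : order_bounded s g by exists 2.
have massE i : (i < n)%N -> mass (phi_ i) E <= del.
  move=> ilt.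
  have gapE : (J a + J b) / 2 - J (mid a b) = \sum_(i < n) absmu Top (phi_ i) g.
    rewrite /J -big_split /= mulr_suml -sumrB; apply: eq_bigr => j _.
    have h1 := absmuD OPsi blT c0 s0 sc (Bphi j) (mw _ Ca) (ow _ Ca) (ow _ Cb).
    have oab : order_bounded s (fun x => w a x + w b x).
      exists (2 + 2) => // x; have /andP[? ha] := w2 a x Ca; have /andP[? hb] := w2 b x Cb.
      by rewrite addr_ge0//= mulrDl lerD.
    have half0 : 0 < 2^-1 :> R by rewrite invr_gt0.
    have h2 := absmuZ OPsi blT c0 s0 sc (Bphi j) half0 oab.
    have h3 := absmuD OPsi blT c0 s0 sc (Bphi j) (mw _ Cab) (ow _ Cab) og.
    rewrite -h1 mulrC -h2.
    rewrite (_ : (fun x => 2^-1 * (w a x + w b x)) = (fun x => w (mid a b) x + g x)).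
      by rewrite h3 addrAC subrr add0r.
    by apply/funext => x; rewrite /g subrKC mulrC.
  have : absmu Top (phi_ i) g <= kap * del.
    apply: le_trans gapJ; rewrite gapE (bigD1 (Ordinal ilt))//= lerDl.
    by apply: sumr_ge0 => j _; exact: (absmu_ge0 OPsi blT c0 s0 sc (Bphi j) og).
  have osE := order_bounded_indic s0 E.
  have : absmu Top (phi_ i) (fun x => kap * (s x * \1_E x)) <= absmu Top (phi_ i) g.
    apply: (absmu_mono OPsi blT c0 s0 sc (Bphi i)) => // x.
    rewrite indicE; have [/set_mem xE|_] := boolP (x \in E); last first.
      by rewrite !mulr0 lexx; have /andP[] := g0 x.
    rewrite mulr1 mulr_ge0 ?(ltW kap0)//=; rewrite /g /w taumid.
    by apply: hyp_gap; rewrite ?mul1r ?(ltW eta0)//; exact: ltW xE.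
  rewrite (absmuZ OPsi blT c0 s0 sc (Bphi i) kap0 osE) => h1 h2.
  by rewrite -(ler_pM2l kap0); exact: le_trans h1 h2.
(* The difference is bounded by [2 * s], hence the factor 1/2 in [d1]; control with [e / 4] then
   contributes [e / 2]. *)
pose d1 x := 2^-1 * (dif x * \1_E x); pose d2 x := dif x * \1_(~` E) x.
have mi A : measurable A -> measurable_fun setT (\1_A : T -> R).
  by move=> mA; exact: measurable_indic.
have md1 : measurable_fun setT d1.
  by apply: measurable_funM => //; apply: measurable_funM => //; exact: mi.
have md2 : measurable_fun setT d2.
  by apply: measurable_funM => //; apply: mi; exact: measurableC.
have bd1 : below (fun x => s x * \1_E x) d1.
  split=> // x; rewrite /d1 !normrM [`|2^-1|]ger0_norm; last by rewrite invr_ge0.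
  rewrite [`|\1_E x|]ger0_norm; last by rewrite indicE.
  rewrite mulrA ler_wpM2r// ler_pdivrMl//.
  by apply: (le_trans (ler_normB _ _)); have := sa x; have := sb x; lra.
have bd2 : below (fun x => eta * s x) d2.
  split=> // x; rewrite /d2 indicE; have [/set_mem xE|_] := boolP (x \in ~` E).
    by rewrite mulr1 leNgt; apply/negP.
  by rewrite mulr0 normr0 mulr_ge0// ltW.
have E1 : Espace d1 by apply: (below_Espace OPsi c0 s0 sc _ bd1); exact: order_bounded_indic.
have md2c := below_mball OPsi c0 s0 sc eta0 (fun x => lexx _) bd2.
have ec0 : 0 < eta * c by rewrite mulr_gt0.
have E2 : Espace d2 by exists (eta * c).
rewrite (_ : (fun x => tau a x - tau b x) = (fun x => 2 * d1 x + d2 x)); last first.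
  apply/funext => x; rewrite /d1 /d2 mulrA divff// mul1r -mulrDr !indicE in_setC.
  by case: (x \in E); rewrite ?addr0 ?add0r mulr1.
rewrite (Lop_lin OPsi blT _ E1 E2); apply: (le_trans (rnormD _ _)).
rewrite rnormZr ger0_norm//; have h1 := ctl E mE massE _ bd1.
have := MP _ _ ec0 md2c; have -> : M * (eta * c) = e / 2.
  by rewrite /eta; field; rewrite !gt_eqF.
lra.
Qed.

End OrderBounded.

(** * Blocks converging in measure *)

Section MeasureFacts.
Context (d : measure_display) (T : measurableType d) (R : realType).
Variable P : probability T R.
Local Notation hp j := ((2^-1 : R) ^+ j).

Lemma tail_union (A : nat -> set T) k : (forall j, measurable (A j)) ->
  (forall j, (P (A j) <= (hp j.+1)%:E)%E) -> (P (\bigcup_j A (j + k)%N) <= (hp k)%:E)%E.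
Proof.
move=> mA PA; have mU : measurable (\bigcup_j A (j + k)%N) by exact: bigcup_measurable.
apply: (le_trans (measure_sigma_subadditive P (fun j => mA (j + k)%N) mU (fun _ h => h))).
have := cvg_lim (@ereal_hausdorff R) (@cvg_geometric_eseries_half R 1 k).
rewrite mul1r -exprVn => <-; apply: lee_nneseries => // j _.
by apply: (le_trans (PA _)); rewrite lee_fin mul1r natrX exprVn addnS.
Qed.

Lemma markov_set (E : set T) (h : T -> R) (kap : R) : measurable E ->
  measurable_fun setT h -> (forall x, 0 <= h x) -> 0 <= kap -> (forall x, E x -> kap <= h x) ->
  (kap%:E * P E <= \int[P]_x (h x)%:E)%E.
Proof.
move=> mE mh h0 kap0 hk; rewrite -(integral_cst P mE).
have mh' : measurable_fun setT (fun x => (h x)%:E) by exact/measurable_EFinP.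
apply: (@le_trans _ _ (\int[P]_(x in E) (h x)%:E)%E).
  apply: ge0_le_integral => //.
  exact: measurable_funTS.
by apply: ge0_subset_integral => // x _; rewrite lee_fin.
Qed.

Lemma measurable_gt_norm (f : T -> R) r : measurable_fun setT f ->
  measurable [set x | r < `|f x|].
Proof.
move=> mf; rewrite (_ : [set x | _] = (fun x => `|f x|) @^-1` `]r, +oo[%classic).
  by rewrite -[X in measurable X]setTI; apply: measurableT_comp => //.
by apply/seteqP; split=> x /=; rewrite in_itv/= andbT.
Qed.

Lemma geometric_cauchy (a : nat -> R) k : (forall j, (k <= j)%N -> `|a j.+1 - a j| <= hp j.+1) ->
  exists l, a @ \oo --> l /\ forall j, (k <= j)%N -> `|a j - l| <= hp j.
Proof.
move=> ha.
have dist j i : (k <= j)%N -> `|a j - a (i + j)%N| <= hp j - hp (i + j).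
  move=> kj; elim: i => [|i IH]; first by rewrite add0n !subrr normr0.
  have := ha (i + j)%N (leq_trans kj (leq_addl _ _)); rewrite distrC addSn.
  have := ler_distD (a (i + j)%N) (a j) (a (i + j).+1); rewrite exprS.
  by move: IH; move: (hp (i + j)) (hp j) => b f; lra.
have hp0 j : 0 <= hp j by rewrite exprn_ge0.
have cva : cvg (a @ \oo).
  apply/cauchy_cvgP/cauchy_exP => e e0; have [N NP] := archimedean_inv e0.
  exists (a (maxn k N)); exists (maxn k N) => // j /= kj.
  rewrite -ball_normE /ball_ /= -(subnK kj).
  apply: (le_lt_trans (dist _ _ (leq_maxl k N))).
  apply: (@le_lt_trans _ _ (hp (maxn k N))).
    by rewrite gerBl.
  apply: le_lt_trans NP; rewrite exprVn lef_pV2 ?posrE ?exprn_gt0 ?ltr0n//.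
  rewrite -natrX ler_nat; apply: leq_trans (ltn_expl _ (isT : (1 < 2)%N)).
  by rewrite ltnS leq_maxr.
exists (lim (a @ \oo)); split=> // j kj.
have cv2 : (fun i => `|a j - a i|) @ \oo --> `|a j - lim (a @ \oo)|.
  by apply: cvg_norm; apply: cvgB => //; exact: cvg_cst.
rewrite -(cvg_lim (@Rhausdorff R) cv2); apply: limr_le; first by apply/cvg_ex; eexists; exact: cv2.
exists j => // i /= ji; rewrite -(subnK ji).
by apply: (le_trans (dist _ _ kj)); rewrite gerBl.
Qed.

(** A Borel-Cantelli argument. The exceptional sets [B k] are returned explicitly, since the later
    splitting cuts functions along this decreasing sequence. *)
Lemma limit_in_measure (g : nat -> T -> R) : (forall j, measurable_fun setT (g j)) ->
  (forall j, (P [set x | (hp j.+1 < `|g j.+1 x - g j x|)%R] <= (hp j.+1)%:E)%E) ->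
  exists2 f : T -> R, measurable_fun setT f &
    exists2 B : nat -> set T, (forall k, [/\ measurable (B k), (P (B k) <= (hp k)%:E)%E &
        B k.+1 `<=` B k]) &
      forall k x j, ~ B k x -> (k <= j)%N -> `|g j x - f x| <= hp j.
Proof.
move=> mg gP; pose A j := [set x | hp j.+1 < `|g j.+1 x - g j x|].
have mA j : measurable (A j) by apply: measurable_gt_norm; exact: measurable_funB.
pose B k := \bigcup_j A (j + k)%N.
have mB k : measurable (B k) by exact: bigcup_measurable.
have loc k x : ~ B k x -> forall j, (k <= j)%N -> `|g j.+1 x - g j x| <= hp j.+1.
  move=> nB j kj; rewrite leNgt; apply/negP => lt; apply: nB.
  by exists (j - k)%N => //; rewrite subnK.
pose N := \bigcap_k B k.
have mN : measurable N by exact: bigcap_measurable.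
pose f x := if x \in N then 0 else lim ((g ^~ x) @ \oo).
have notN x : ~ N x -> exists k, ~ B k x.
  by move=> nN; apply: contrapT => h; apply: nN => k _; apply: contrapT => nB; apply: h; exists k.
have fP k x j : ~ B k x -> (k <= j)%N -> `|g j x - f x| <= hp j.
  move=> nB kj; have [l [gl lP]] := geometric_cauchy (loc _ _ nB).
  have nN : x \in N = false by apply: memNset => /(_ k I).
  by rewrite /f nN (cvg_lim (@Rhausdorff R) gl); exact: lP.
exists f; last first.
  exists B => [k|]; [split=> //; first exact: tail_union|exact: fP].
  by move=> x [j _ Ax]; exists j.+1 => //; rewrite addSnnS.
apply: (@measurable_fun_cvg _ _ _ _ (fun j x => g j x * \1_(~` N) x)).
  by move=> j; apply: measurable_funM => //; apply: measurable_indic; exact: measurableC.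
move=> x _; rewrite /f indicE in_setC; have [xN|/negP xN] := boolP (x \in N).
  rewrite (_ : (fun j => _) = fun=> 0); first exact: cvg_cst.
  by apply/funext => j; rewrite mulr0.
have [k nB] := notN x (fun h => xN (mem_set h)).
have [l [gl _]] := geometric_cauchy (loc _ _ nB).
rewrite (_ : (fun j => _) = g ^~ x); last by apply/funext => j; rewrite mulr1.
by rewrite (cvg_lim (@Rhausdorff R) gl).
Qed.

End MeasureFacts.

Section BlocksInMeasure.
Context (d : measure_display) (T : measurableType d) (R : realType).
Variables (P : probability T R) (Psi : \bar R -> \bar R).
Hypothesis OPsi : Orlicz_function Psi.
Local Notation hp j := ((2^-1 : R) ^+ j).
Local Notation psi := (psi Psi).

Lemma norm_le_hyp (x : R) : `|x| <= hyp 1 x.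
Proof.
rewrite -(@ler_pXn2r _ 2) ?nnegrE ?hyp_ge0// hyp_sqr real_normK ?num_real// lerDr.
exact: sqr_ge0.
Qed.

Lemma hyp_integral_bound : exists2 B : R, 0 < B & forall g, mball P Psi 2 g ->
  (\int[P]_x (hyp 1 (g x))%:E <= B%:E)%E.
Proof.
have [x1 x10 x1P] := psi_superlinear OPsi 1.
(* [hyp 1 g <= 1 + |g|], and superlinearity gives [|g| / 2 <= x1 + psi (g / 2)]. *)
exists (1 + 2 * x1 + 2) => [|g [mg gB]]; first by lra.
pose r := 1 + 2 * x1; have r0 : 0 <= r by rewrite /r; lra.
have le x : hyp 1 (g x) <= r + 2 * psi (g x / 2).
  have := @hyp_le _ `|g x| 1 (g x) ler01 (normr_ge0 _); rewrite mulr1 lexx mulr1 => /(_ isT).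
  move=> /le_trans; apply; rewrite /r.
  have := psi_ge0 OPsi (g x / 2); have n0 := normr_ge0 (g x).
  have [h|h] := leP x1 `|g x / 2|.
    have := x1P _ h; rewrite psi_norm mul1r normrM [`|2^-1|]ger0_norm ?invr_ge0//; lra.
  by move: h; rewrite normrM [`|2^-1|]ger0_norm ?invr_ge0//; lra.
have mp := measurable_psi_comp OPsi 2 mg.
apply: (@le_trans _ _ (\int[P]_x (r%:E + 2%:E * (psi (g x / 2))%:E))%E).
  apply: ge0_le_integral => //.
  - by move=> x _; rewrite lee_fin hyp_ge0.
  - by apply/measurable_EFinP; exact: measurable_hyp.
  - by apply: emeasurable_funD => //; exact: measurable_funeM.
  - by move=> x _; rewrite -EFinM -EFinD lee_fin.
rewrite ge0_integralD//; last 2 first.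
- by move=> x _; rewrite -EFinM lee_fin mulr_ge0// psi_ge0.
- exact: measurable_funeM.
rewrite ge0_integralZl_EFin//; last by move=> x _; rewrite lee_fin psi_ge0.
rewrite (_ : (fun=> r%:E) = cst r%:E)// integral_cst//.
rewrite (_ : (1 + 2 * x1 + 2)%:E = (r%:E + 2%:E)%E)//; apply: leeD.
  by rewrite -[leRHS]mule1; apply: lee_wpmul2l; [rewrite lee_fin|exact: probability_le1].
rewrite -[leRHS]mule1; apply: lee_wpmul2l; first by rewrite lee_fin.
exact: gB.
Qed.

Variables (V : Type) (mid : V -> V -> V) (C : nat -> set V) (tau : V -> T -> R).
Hypothesis Cne : forall m, C m !=set0.
Hypothesis Cmono : forall m n, (m <= n)%N -> C n `<=` C m.
Hypothesis Cmid : forall m u v, C m u -> C m v -> C m (mid u v).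
Hypothesis taumid : forall u v x, tau (mid u v) x = (tau u x + tau v x) / 2.
Hypothesis tau_ball : forall u, C 0%N u -> mball P Psi 2 (tau u).

(** [J] is the integral of [hyp 1]. Where both blocks are at most [N] in modulus and differ by more
    than [e], the gap is at least [kap], and Markov's inequality bounds this set by [e / 2]; each of
    the two sets where a block exceeds [N] has probability at most [e / 4]. *)
Lemma blocks_cauchy_in_measure : exists2 u : nat -> V, (forall m, C m (u m)) &
  forall e, 0 < e -> exists N, forall m l, (N <= m)%N -> (N <= l)%N ->
    (P [set x | (e < `|tau (u m) x - tau (u l) x|)%R] <= e%:E)%E.
Proof.
have [B B0 BP] := hyp_integral_bound.
pose I u := (\int[P]_x (hyp 1 (tau u x))%:E)%E; pose J u := fine (I u).
have Ige0 u : (0 <= I u)%E by apply: integral_ge0 => x _; rewrite lee_fin hyp_ge0.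
have IJ u : C 0%N u -> I u = (J u)%:E.
  move=> Cu; rewrite fineK// ge0_fin_numE//.
  by apply: le_lt_trans (BP _ (tau_ball Cu)) _; rewrite ltry.
have JB u : C 0%N u -> 0 <= J u <= B.
  by move=> Cu; rewrite -!lee_fin -IJ// Ige0 BP//; exact: tau_ball.
have [u uC uJ] := gap_sequence Cne Cmono Cmid JB.
exists u => // e e0.
have [K KP] := archimedean_inv (divr_gt0 e0 (mulr_gt0 (ltr0n R 4) B0)).
pose N : R := K.+1%:R.
have N0 : 0 < N by rewrite /N ltr0n.
pose kap := e ^+ 2 / (8 * (1 + N) ^+ 3).
have kap0 : 0 < kap.
  by rewrite divr_gt0 ?exprn_gt0// mulr_gt0 ?exprn_gt0//; lra.
have [N1 N1P] := uJ (kap * (e / 2)) (mulr_gt0 kap0 (divr_gt0 e0 (ltr0n R 2))).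
exists N1 => m l Nm Nl; have := N1P m l Nm Nl.
have := Cmono (leq0n m) (uC m); have := Cmono (leq0n l) (uC l).
move: (u m) (u l) => a b Cb Ca gapJ.
have Cab := Cmid Ca Cb.
have [ma _] := tau_ball Ca; have [mb _] := tau_ball Cb; have [mab _] := tau_ball Cab.
have mh v : C 0%N v -> measurable_fun setT (fun x => hyp 1 (tau v x)).
  by move=> /tau_ball[mv _]; exact: measurable_hyp.
pose g x := (hyp 1 (tau a x) + hyp 1 (tau b x)) / 2 - hyp 1 (tau (mid a b) x).
have g0 x : 0 <= g x by rewrite /g taumid subr_ge0 hyp_mid.
have mg : measurable_fun setT g.
  apply: measurable_funB; last exact: mh.
  by apply: measurable_funM => //; apply: measurable_funD; exact: mh.
have gI : (\int[P]_x (g x)%:E <= (kap * (e / 2))%:E)%E.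
  have e1 : (\int[P]_x (g x)%:E + I (mid a b) = 2^-1%:E * (I a + I b))%E.
    rewrite /I -ge0_integralD//; last 4 first.
    - by move=> x _; rewrite lee_fin.
    - exact/measurable_EFinP.
    - by move=> x _; rewrite lee_fin hyp_ge0.
    - by apply/measurable_EFinP; exact: mh.
    rewrite -ge0_integralD//; last 4 first.
    - by move=> x _; rewrite lee_fin hyp_ge0.
    - by apply/measurable_EFinP; exact: mh.
    - by move=> x _; rewrite lee_fin hyp_ge0.
    - by apply/measurable_EFinP; exact: mh.
    rewrite -ge0_integralZl_EFin//.
    - apply: eq_integral => x _; rewrite -!EFinD -EFinM; congr (_%:E).
      by rewrite /g subrK mulrC.
    - by move=> x _; rewrite -EFinD lee_fin addr_ge0// hyp_ge0.
    - by apply: emeasurable_funD; apply/measurable_EFinP; exact: mh.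
  move: e1; rewrite !IJ// -EFinD -EFinM.
  case: (\int[P]_x (g x)%:E)%E => [r| |]//.
  by rewrite -EFinD => -[] h; rewrite lee_fin; move: gapJ; lra.
have tailN v : C 0%N v -> (P [set x | (N < `|tau v x|)%R] <= (e / 4)%:E)%E.
  move=> Cv; have [mv _] := tau_ball Cv.
  have mE := measurable_gt_norm N mv.
  have := markov_set P mE (mh v Cv) (fun x => hyp_ge0 _ _) (ltW N0).
  move=> /(_ (fun x Ex => le_trans (ltW Ex) (norm_le_hyp _))).
  move=> /le_trans/(_ (BP _ (tau_ball Cv))).
  rewrite -(@lee_pdivlMl _ N)// => /le_trans; apply; rewrite -EFinM lee_fin.
  move: KP; rewrite -/N -(ltr_pM2r B0) => /ltW/le_trans; apply.
  by rewrite le_eqVlt; apply/orP; left; apply/eqP; field; rewrite gt_eqF.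
pose E := [set x | e < `|tau a x - tau b x|] `\` ([set x | N < `|tau a x|] `|` [set x | N < `|tau b x|]).
have mD : measurable [set x | e < `|tau a x - tau b x|].
  by apply: (@measurable_gt_norm _ _ _ (fun x => tau a x - tau b x)); exact: measurable_funB.
have mAa := measurable_gt_norm N ma; have mAb := measurable_gt_norm N mb.
have mE : measurable E by apply: measurableD => //; exact: measurableU.
have PE : (P E <= (e / 2)%:E)%E.
  have := markov_set P mE mg g0 (ltW kap0).
  have Eg x : E x -> kap <= g x.
    move=> [ex nN]; rewrite /g taumid.
    have := @hyp_gap R N e 1 (tau a x) (tau b x) ltr01 (ltW N0) (ltW e0).
    rewrite !mulr1; apply; last exact: ltW.
    - by rewrite leNgt; apply/negP => h; apply: nN; left.
    - by rewrite leNgt; apply/negP => h; apply: nN; right.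
  move=> /(_ Eg)/le_trans/(_ gI).
  by rewrite -(@lee_pdivlMl _ kap)// -EFinM mulKf// gt_eqF.
have cov : [set x | e < `|tau a x - tau b x|] `<=`
    E `|` ([set x | N < `|tau a x|] `|` [set x | N < `|tau b x|]).
  move=> x ex; have [h|h] := pselect (([set x | N < `|tau a x|] `|` [set x | N < `|tau b x|]) x).
    by right.
  by left.
have mAab := measurableU _ _ mAa mAb.
apply: (le_trans (le_measure P (mem_set mD) (mem_set (measurableU _ _ mE mAab)) cov)).
apply: (le_trans (measureU2 P mE mAab)).
have -> : e%:E = ((e / 2)%:E + ((e / 4)%:E + (e / 4)%:E))%E by rewrite -!EFinD; congr (_%:E); field.
by apply: leeD => //; apply: (le_trans (measureU2 P mAa mAb)); apply: leeD; exact: tailN.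
Qed.

Lemma blocks_limit_in_measure : exists2 u : nat -> V, (forall m, C m (u m)) &
  exists2 f : T -> R, measurable_fun setT f &
    exists2 B : nat -> set T, (forall k, [/\ measurable (B k), (P (B k) <= (hp k)%:E)%E &
        B k.+1 `<=` B k]) &
      forall k x j, ~ B k x -> (k <= j)%N -> `|tau (u j) x - f x| <= hp j.
Proof.
have [u uC uP] := blocks_cauchy_in_measure.
have /choice[N NP] : forall j, exists N, forall m l, (N <= m)%N -> (N <= l)%N ->
    (P [set x | (hp j.+1 < `|tau (u m) x - tau (u l) x|)%R] <= (hp j.+1)%:E)%E.
  by move=> j; apply: uP; rewrite exprn_gt0// invr_gt0.
(* The sum makes both [n j] and [n j.+1] at least [N j]; the summand [j] keeps the block in
   [C j]. *)
pose n j := (j + \sum_(i < j.+1) N i)%N.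
have nN j : (N j <= n j)%N by rewrite /n big_ord_recr /= addnA leq_addl.
have nS j : (N j <= n j.+1)%N.
  by apply: (leq_trans (nN j)); rewrite /n [in leqRHS]big_ord_recr /= addSn addnA leqW// leq_addr.
exists (fun j => u (n j)) => [j|]; first exact: (Cmono (leq_addr _ _) (uC _)).
apply: limit_in_measure => j; first by have [] := tau_ball (Cmono (leq0n (n j)) (uC _)).
by apply: NP.
Qed.

End BlocksInMeasure.

(** * Splitting off disjoint and order bounded parts *)

Section ModularLimits.
Context (d : measure_display) (T : measurableType d) (R : realType).
Variables (P : probability T R) (Psi : \bar R -> \bar R).
Hypothesis OPsi : Orlicz_function Psi.
Local Notation psi := (psi Psi).

Lemma decreasing_le (B : nat -> set T) : (forall n, B n.+1 `<=` B n) ->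
  forall m n, (m <= n)%N -> B n `<=` B m.
Proof.
move=> Bdec m n /subnK <-; elim: (n - m)%N => [|k IH]; first by rewrite add0n.
by rewrite addSn; apply: subset_trans IH; exact: Bdec.
Qed.

(** Eventual domination and monotonicity of [psi] give the pointwise inequality with the lower
    limit, to which Fatou's lemma applies. *)
Lemma modular_fatou (g : nat -> T -> R) (f : T -> R) (c r : R) :
  (forall n, measurable_fun setT (g n)) -> (forall n, (modular P Psi (g n) c <= r%:E)%E) ->
  measurable_fun setT f ->
  (forall x, exists N, forall n, (N <= n)%N -> `|f x| <= `|g n x|) ->
  (modular P Psi f c <= r%:E)%E.
Proof.
move=> mg gr mf fg.
have mgc n := measurable_psi_comp OPsi c (mg n).
apply: (@le_trans _ _ (\int[P]_x limn_einf (fun n => (psi (g n x / c))%:E))%E).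
  apply: ge0_le_integral => //.
  - by move=> x _; rewrite lee_fin psi_ge0.
  - exact: measurable_psi_comp.
  - rewrite (_ : (fun x => _) = -%E \o (fun x => limn_esup (-%E \o (fun n => (psi (g n x / c))%:E)))).
      apply: measurableT_comp => //; apply: measurable_fun_limn_esup => n.
      exact: measurableT_comp.
    by apply/funext => x /=; rewrite limn_esupN oppeK.
  - move=> x _; have [N NP] := fg x; rewrite limn_einf_lim.
    apply: lime_ge; first exact: is_cvg_einfs.
    exists N => // n /= Nn; apply: le_ereal_inf_tmp => _ [m /= nm <-].
    rewrite lee_fin; apply: psi_le => //; rewrite !normrM ler_wpM2r//.
    by apply: NP; exact: leq_trans nm.
apply: (le_trans (fatou P measurableT mgc _)).
  by move=> n x _; rewrite lee_fin psi_ge0.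
rewrite limn_einf_lim; apply: lime_le; first exact: is_cvg_einfs.
exists 0%N => // n _; apply: le_trans (gr n).
by apply: ereal_inf_lbound; exists n => //=.
Qed.

(** Dominated convergence at the fixed scale [c]. It concerns the modular: the Luxemburg norms of
    these truncations need not tend to 0. *)
Lemma modular_tail (f : T -> R) (c e : R) (B : nat -> set T) : mball P Psi c f ->
  (forall n, measurable (B n)) -> (forall n, B n.+1 `<=` B n) -> \bigcap_n B n = set0 ->
  0 < e -> exists N, forall n, (N <= n)%N -> (modular P Psi (fun x => (f x * \1_(B n) x)%R) c <= e%:E)%E.
Proof.
move=> [mf fc] mB Bdec B0 e0.
have Bmono := decreasing_le Bdec.
have mfB n : measurable_fun setT (fun x => f x * \1_(B n) x).
  by apply: measurable_funM => //; exact: measurable_indic.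
have : (modular P Psi (fun x => (f x * \1_(B n) x)%R) c @[n --> \oo] --> (\int[P]_x (cst 0 x))%E)%E.
  apply: (@dominated_cvg _ _ _ P setT measurableT
    (fun n x => (psi (f x * \1_(B n) x / c))%:E) (cst 0%E) (fun x => (psi (f x / c))%:E)) => //.
  - by move=> n; exact: measurable_psi_comp.
  - move=> x _; have [k nB] : exists k, ~ B k x.
      apply: contrapT => h; have : (\bigcap_n B n) x.
        by move=> n _; apply: contrapT => nB; apply: h; exists n.
      by rewrite B0.
    apply: cvg_near_cst; exists k => // n /= kn.
    rewrite indicE memNset; last by move=> /(Bmono _ _ kn).
    by rewrite mulr0 mul0r psi0.
  - apply/integrableP; split; first exact: measurable_psi_comp.
    rewrite (eq_integral (fun x => (psi (f x / c))%:E)).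
      by apply: le_lt_trans fc _; rewrite ltry.
    by move=> x _; rewrite gee0_abs// lee_fin psi_ge0.
  - move=> n x _; rewrite gee0_abs ?lee_fin ?psi_ge0//; apply: psi_le => //.
    rewrite !normrM ler_wpM2r// ler_piMr//.
    by rewrite indicE; case: (x \in B n); rewrite ?normr1 ?normr0.
rewrite integral0 => /fine_cvgP[[N1 _ N1P] /cvgrPdist_lt/(_ _ e0)[N2 _ N2P]].
exists (maxn N1 N2) => n; rewrite geq_max => /andP[n1 n2].
rewrite -(fineK (N1P n n1)) lee_fin; apply/ltW.
by have := N2P n n2; rewrite /= sub0r normrN; apply: le_lt_trans; exact: ler_norm.
Qed.

End ModularLimits.

Section Splitting.
Context (d : measure_display) (T : measurableType d) (R : realType).
Variables (P : probability T R) (Psi : \bar R -> \bar R).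
Hypothesis OPsi : Orlicz_function Psi.
Local Notation psi := (psi Psi).
Local Notation hp j := ((2^-1 : R) ^+ j).
Local Notation modular := (modular P Psi).
Local Notation mball := (mball P Psi).

Lemma measurable_mul_indic (f : T -> R) A : measurable_fun setT f -> measurable A ->
  measurable_fun setT (fun x => f x * \1_A x).
Proof. by move=> mf mA; apply: measurable_funM => //; exact: measurable_indic. Qed.

Lemma norm_mul_indic (f : T -> R) A x : `|f x * \1_A x| <= `|f x|.
Proof.
rewrite normrM ler_piMr// indicE; by case: (x \in A); rewrite ?normr1 ?normr0.
Qed.

Lemma indic_mem A (x : T) : A x -> \1_A x = 1 :> R.
Proof. by move=> Ax; rewrite indicE mem_set. Qed.

Lemma indic_notin A (x : T) : ~ A x -> \1_A x = 0 :> R.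
Proof. by move=> Ax; rewrite indicE memNset. Qed.

Lemma half_powers_sum n : \sum_(i < n) hp i <= 2.
Proof.
suff -> : \sum_(i < n) hp i = 2 - 2 * hp n by rewrite gerBl mulr_ge0// exprn_ge0.
elim: n => [|n IH]; first by rewrite big_ord0 expr0 mulr1 subrr.
by rewrite big_ord_recr /= IH exprS; lra.
Qed.

Variables (dd : nat -> T -> R) (c : R) (B : nat -> set T).
Hypotheses (c0 : 0 < c) (ddc : forall j, mball c (dd j)).
Hypotheses (mB : forall k, measurable (B k)) (Bdec : forall k, B k.+1 `<=` B k).
Hypothesis B0 : \bigcap_k B k = set0.
Hypothesis PB : forall k, (P (B k) <= (hp k)%:E)%E.

Let Bmono := decreasing_le Bdec.

Let leaveB x : exists k, ~ B k x.
Proof.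
apply: contrapT => h; have : (\bigcap_k B k) x.
  by move=> n _; apply: contrapT => nB; apply: h; exists n.
by rewrite B0.
Qed.

(** [j k.+1] is taken so large that the part of [dd (j k)] on [B (j k.+1)] has modular at most
    [2^-k]. Since [psi] of a maximum is at most the sum of the values, the pointwise supremum of
    these parts has modular at most 2. *)
Lemma order_bounded_tails : exists2 j : nat -> nat, (forall k, (j k < j k.+1)%N) &
  exists s cs, [/\ 0 < cs, forall x, 0 < s x, mball cs s &
    forall k x, `|dd (j k) x * \1_(B (j k.+1)) x| <= s x].
Proof.
have /choice[N NP] : forall j, exists N, (j < N)%N /\
    (modular (fun x => (dd j x * \1_(B N) x)%R) c <= (hp j)%:E)%E.
  move=> j; have hpj : 0 < hp j by rewrite exprn_gt0// invr_gt0.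
  have [N NP] := modular_tail OPsi (ddc j) mB Bdec B0 hpj.
  by exists (maxn N j.+1); split; [exact: leq_maxr|apply: NP; exact: leq_maxl].
pose j k := iter k N 0%N.
have jS k : (j k < j k.+1)%N by exact: (NP _).1.
have jk k : (k <= j k)%N by elim: k => // k IH; exact: leq_ltn_trans (jS k).
exists j => //.
pose sk k x := dd (j k) x * \1_(B (j k.+1)) x.
have msk k : measurable_fun setT (sk k) by apply: measurable_mul_indic => //; exact: (ddc _).1.
(* Running maxima. Each point leaves the sets [B], so they become stationary there and their limit
   is finite everywhere. *)
pose M := fix M n : T -> R := if n is n'.+1 then (fun x => Num.max (M n' x) `|sk n' x|) else (fun=> 0).
have M0 n x : 0 <= M n x by elim: n => //= n IH; rewrite le_max IH.
have mM n : measurable_fun setT (M n).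
  elim: n => [|n IH] /=; first exact: measurable_cst.
  by apply: measurable_maxr => //; exact: measurableT_comp.
have Mge k n x : (k < n)%N -> `|sk k x| <= M n x.
  elim: n => // n IH; rewrite ltnS leq_eqVlt => /orP[/eqP ->|kn] /=.
    by rewrite le_max lexx orbT.
  by rewrite le_max IH.
have Mstat x : exists m, forall n, (m <= n)%N -> M n x = M m x.
  have [m nB] := leaveB x; exists m => n /subnK <-; elim: (n - m)%N => [|i IH]; first by rewrite add0n.
  rewrite addSn /= IH max_l//; rewrite /sk indic_notin ?mulr0 ?normr0//.
  by move=> /(Bmono _) h; apply: nB; apply: h; apply: leq_trans (jk _); exact: leqW (leq_addl _ _).
have Mmod n : (modular (M n) c <= 2%:E)%E.
  apply: (@le_trans _ _ (\sum_(i < n) hp i)%:E); last by rewrite lee_fin half_powers_sum.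
  elim: n => [|n IH].
    rewrite big_ord0 modularE (_ : (fun x => _) = cst 0%E) ?integral0//.
    by apply/funext => x /=; rewrite mul0r psi0.
  rewrite big_ord_recr /= EFinD.
  apply: (@le_trans _ _ (modular (M n) c + modular (sk n) c)%E); last first.
    apply: leeD => //; apply: (le_trans (NP (j n)).2); rewrite lee_fin.
    by rewrite ler_wiXn2l// ?invr_ge0 ?invf_le1 ?ler1n.
  rewrite !modularE -ge0_integralD//; last 4 first.
  - by move=> x _; rewrite lee_fin psi_ge0.
  - exact: measurable_psi_comp.
  - by move=> x _; rewrite lee_fin psi_ge0.
  - exact: measurable_psi_comp.
  apply: ge0_le_integral => //.
  - by move=> x _; rewrite lee_fin psi_ge0.
  - exact: (measurable_psi_comp OPsi c (mM n.+1)).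
  - by apply: emeasurable_funD; exact: measurable_psi_comp.
  - move=> x _; rewrite -EFinD lee_fin /=.
    have p1 := psi_ge0 OPsi (M n x / c); have p2 := psi_ge0 OPsi (sk n x / c).
    rewrite /Num.max; case: ifP => _; last by rewrite lerDl.
    apply: (@le_trans _ _ (psi (sk n x / c))); last by rewrite lerDr.
    by apply: psi_le => //; rewrite [leLHS]normrM normr_id -normrM.
pose S x := lim ((M ^~ x) @ \oo).
have ScvE x m : (forall n, (m <= n)%N -> M n x = M m x) -> (M ^~ x) @ \oo --> M m x.
  by move=> h; apply: cvg_near_cst; exists m.
have SE x m : (forall n, (m <= n)%N -> M n x = M m x) -> S x = M m x.
  by move=> /ScvE h; exact: cvg_lim h.
have mS : measurable_fun setT S.
  apply: (measurable_fun_cvg mM) => x _; have [m mP] := Mstat x.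
  by rewrite (SE _ _ mP); exact: ScvE.
have Smod : (modular S c <= 2%:E)%E.
  apply: (modular_fatou OPsi mM Mmod mS) => x; have [m mP] := Mstat x.
  by exists m => n mn; rewrite (SE _ _ mP) (mP _ mn).
have Sball : mball (2 * c) S by apply: (mball_modular OPsi) => //; rewrite ler1n.
have [t0 t00 t0P] := psi_small OPsi.
have oneball : mball (1 / t0) (fun=> 1 : R).
  by apply: (mball_bounded P OPsi) => // x; rewrite normr1.
have c20 : 0 < 2 * c by rewrite mulr_gt0.
have i0 : 0 < 1 / t0 by rewrite divr_gt0.
(* The constant 1 makes the dominating function strictly positive, as [hyp_gap] demands of its
   weight. *)
exists (fun x => S x + 1), (2 * c + 1 / t0); split; first exact: addr_gt0.
- by move=> x; have [m mP] := Mstat x; rewrite (SE _ _ mP) ltr_wpDl.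
- exact: mballD.
- move=> k x; have [m mP] := Mstat x; rewrite (SE _ _ mP) -(mP _ (leq_maxl m k.+1)).
  by apply: (@le_trans _ _ (M (maxn m k.+1) x)); [apply: Mge; exact: leq_maxr|rewrite lerDl].
Qed.

Variable j : nat -> nat.
Hypothesis jS : forall k, (j k < j k.+1)%N.

Let jk k : (k <= j k)%N.
Proof. by elim: k => // k IH; exact: leq_ltn_trans (jS k). Qed.

Let jmono k l : (k <= l)%N -> (j k <= j l)%N.
Proof.
move=> /subnK <-; elim: (l - k)%N => [|i IH]; first by rewrite add0n.
by rewrite addSn; apply: (leq_trans IH); exact: ltnW.
Qed.

Definition spike k x := dd (j k) x * \1_(B (j k) `\` B (j k.+1)) x.

Lemma measurable_spike k : measurable_fun setT (spike k).
Proof. by apply: measurable_mul_indic; [exact: (ddc _).1|exact: measurableD]. Qed.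

Lemma spike_disjoint k l x : (k < l)%N -> spike l x != 0 -> spike k x = 0.
Proof.
move=> kl; rewrite /spike; have [Bl|nBl] := pselect ((B (j l) `\` B (j l.+1)) x).
  by move=> _; rewrite [\1_(B (j k) `\` _) x]indic_notin ?mulr0// => -[_]; apply; exact: (Bmono (jmono kl)) Bl.1.
by rewrite [X in _ * X != 0]indic_notin// mulr0 eqxx.
Qed.

(** At each point at most one spike is nonzero, so the average is that spike divided by [n + 1].
    Where it is large, nabla_2 outweighs the sum of [n + 1] modulars; where it is small, [psi] is at
    most [K] and the small probability of [B (j p)] decides. Each part contributes at most 1/2. *)
Lemma spike_average e : Delta2 (complementary Psi) -> 0 < e ->
  exists n p0, forall p, (p0 <= p)%N ->
    mball e (fun x => n.+1%:R^-1 * \sum_(i < n.+1) spike (p + i) x).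
Proof.
move=> D2 e0.
have [q qP] := archimedean_inv (divr_gt0 e0 c0).
pose N2 : R := q.+1%:R; have N20 : 0 < N2 by rewrite /N2 ltr0n.
have eta0 : 0 < 1 / (2 * N2) by rewrite divr_gt0// mulr_gt0.
have [n1 [x1 [n10 x10 nab]]] := nabla2 OPsi D2 eta0.
have n1R : 0 < n1%:R :> R by rewrite ltr0n.
(* [n + 1 = n1 * N2]: the factor [N2] brings the radius [c / N2] below [e], and [1 / (2 * N2)] in
   nabla_2 bounds the sum of the [n + 1] modulars by 1/2. *)
pose n := (n1 * q.+1).-1.
have nE : n.+1 = (n1 * q.+1)%N by rewrite /n prednK// muln_gt0 n10.
have nR : n.+1%:R = n1%:R * N2 :> R by rewrite nE natrM.
pose K := psi (x1 / n1%:R); have K0 : 0 <= K by exact: psi_ge0.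
have K1 : 0 < 2^-1 / (K + 1) by rewrite divr_gt0 ?invr_gt0// ltr_wpDl.
have [p0 p0P] := archimedean_inv K1.
exists n, p0.+1 => p pp0.
pose S x := \sum_(i < n.+1) spike (p + i) x.
have mS : measurable_fun setT S by apply: measurable_sum => i; exact: measurable_spike.
suff : mball (c / N2) (fun x => n.+1%:R^-1 * S x).
  apply: (mballW OPsi); first by rewrite divr_gt0.
  by move: qP; rewrite ltr_pdivlMr// mulrC => /ltW.
split; first exact: measurable_funM.
have pw x : psi (n.+1%:R^-1 * S x / (c / N2)) <=
    K * \1_(B (j p)) x + (1 / (2 * N2) / n1%:R) * \sum_(i < n.+1) psi (spike (p + i) x / c).
  have r0 : 0 <= 1 / (2 * N2) / n1%:R by rewrite divr_ge0 ?(ltW eta0)// ltW.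
  have sum0 : 0 <= \sum_(i < n.+1) psi (spike (p + i) x / c) by apply: sumr_ge0 => i _; exact: psi_ge0.
  have in0 : 0 <= \1_(B (j p)) x :> R by rewrite indicE.
  have [[i si]|none] := pselect (exists i : 'I_n.+1, spike (p + i) x != 0); last first.
    have -> : S x = 0.
      apply: big1 => i _; apply/eqP/negPn/negP => h; apply: none; by exists i.
    by rewrite mulr0 mul0r psi0// addr_ge0// mulr_ge0.
  have SE : S x = spike (p + i) x.
    rewrite /S (bigD1 i)//= big1 ?addr0// => l li.
    apply/eqP/negPn/negP => sl; have [lt|lt|eq] := ltngtP l i.
    - by move: sl; rewrite (spike_disjoint _ si) ?eqxx// ltn_add2l.
    - by move: si; rewrite (spike_disjoint _ sl) ?eqxx// ltn_add2l.
    - by move: li; rewrite (val_inj eq) eqxx.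
  have Bx : B (j p) x.
    apply: contrapT => nB; move: si; rewrite /spike indic_notin ?mulr0 ?eqxx//.
    by move=> -[Bpi _]; apply: nB; exact: (Bmono (jmono (leq_addr i p))) Bpi.
  rewrite SE (indic_mem Bx) mulr1.
  have -> : n.+1%:R^-1 * spike (p + i) x / (c / N2) = spike (p + i) x / c / n1%:R.
    by rewrite nR; field; rewrite !gt_eqF.
  have [h|h] := leP x1 `|spike (p + i) x / c|.
    have := nab _ h; rewrite psi_norm => nb.
    apply: (@le_trans _ _ (psi (`|spike (p + i) x / c| / n1%:R))).
      by apply: psi_le => //; rewrite normrM [leRHS]normrM normr_id.
    apply: (le_trans nb); rewrite -[leLHS]add0r lerD// ler_wpM2l//.
    by rewrite (bigD1 i)//= lerDl sumr_ge0// => l _; exact: psi_ge0.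
  apply: (@le_trans _ _ K); last by rewrite lerDl mulr_ge0.
  rewrite /K; apply: psi_le => //.
  by rewrite normrM [leRHS]normrM ler_wpM2r// (le_trans (ltW h))// ler_norm.
apply: (@le_trans _ _ (\int[P]_x ((K * \1_(B (j p)) x)%:E +
    (1 / (2 * N2) / n1%:R)%:E * (\sum_(i < n.+1) (psi (spike (p + i) x / c))%:E)))%E).
  apply: ge0_le_integral => //.
  - by move=> x _; rewrite lee_fin psi_ge0.
  - by apply: measurable_psi_comp => //; exact: measurable_funM.
  - apply: emeasurable_funD.
      by apply/measurable_EFinP; apply: measurable_funM => //; exact: measurable_indic.
    apply: measurable_funeM; apply: emeasurable_sum => i.
    by apply: measurable_psi_comp => //; exact: measurable_spike.
  - by move=> x _; rewrite sumEFin -EFinM -EFinD lee_fin.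
have r0 : 0 <= 1 / (2 * N2) / n1%:R by rewrite divr_ge0 ?(ltW eta0)// ltW.
have mpsi i : measurable_fun setT (fun x => (psi (spike (p + i) x / c))%:E).
  by apply: measurable_psi_comp => //; exact: measurable_spike.
rewrite ge0_integralD//; last 4 first.
- by move=> x _; rewrite lee_fin mulr_ge0// indicE.
- by apply/measurable_EFinP; apply: measurable_funM => //; exact: measurable_indic.
- move=> x _; rewrite mule_ge0 ?lee_fin// sume_ge0// => i _.
  by rewrite lee_fin psi_ge0.
- by apply: measurable_funeM; exact: emeasurable_sum.
rewrite ge0_integralZl_EFin//; last 2 first.
- by move=> x _; rewrite sume_ge0// => i _; rewrite lee_fin psi_ge0.
- exact: emeasurable_sum.
rewrite ge0_integral_sum//; last by move=> i x _; rewrite lee_fin psi_ge0.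
have spikec i : (\int[P]_x (psi (spike (p + i) x / c))%:E <= 1)%E.
  apply: le_trans (ddc (j (p + i))).2; apply: le_modular => // [||x].
  - exact: measurable_spike.
  - exact: (ddc _).1.
  - by apply: psi_le => //; rewrite normrM [leRHS]normrM ler_wpM2r//; exact: norm_mul_indic.
have -> : 1%E = (2^-1%:E + 2^-1%:E)%E :> \bar R.
  by rewrite -EFinD; congr (_%:E); lra.
apply: leeD.
  under eq_integral do rewrite EFinM.
  rewrite ge0_integralZl_EFin//; last by apply/measurable_EFinP; exact: measurable_indic.
  rewrite integral_indic// setIT.
  have Pp : (P (B (j p)) <= (p0.+1%:R^-1)%:E)%E.
    apply: (le_trans (PB _)); rewrite lee_fin exprVn lef_pV2 ?posrE ?exprn_gt0 ?ltr0n//.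
    rewrite -natrX ler_nat; apply: (leq_trans pp0); apply: (leq_trans (jk p)).
    exact: ltnW (ltn_expl _ _).
  apply: (@le_trans _ _ (K%:E * (p0.+1%:R^-1)%:E)%E).
    by apply: lee_wpmul2l => //; rewrite lee_fin.
  rewrite -EFinM lee_fin; move: p0P; rewrite ltr_pdivlMr ?ltr_wpDl//.
  have : 0 < p0.+1%:R^-1 :> R by rewrite invr_gt0 ltr0n.
  by move: (p0.+1%:R^-1) => a; nra.
apply: (@le_trans _ _ ((1 / (2 * N2) / n1%:R)%:E * (n.+1%:R)%:E)%E).
  apply: lee_wpmul2l; first by rewrite lee_fin.
  apply: (@le_trans _ _ (\sum_(i < n.+1) 1%:E)%E); first by apply: lee_sum.
  by rewrite sumEFin lee_fin sumr_const card_ord.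
rewrite -EFinM lee_fin nR le_eqVlt; apply/orP; left; apply/eqP; field.
by rewrite !gt_eqF.
Qed.

End Splitting.

(** * Assembling convex blocks of real functions *)

Section MainBlocks.
Context (d : measure_display) (T : measurableType d) (R : realType).
Variables (P : probability T R) (Psi : \bar R -> \bar R).
Hypothesis OPsi : Orlicz_function Psi.
Hypothesis D2 : Delta2 (complementary Psi).
Variables (Z : completeNormedModType (Cplx R)) (Top : (T -> Cplx R) -> Z).
Hypothesis blT : bounded_linear_on_orlicz P Psi Top.
Hypothesis nofix : ~ fixes_c0 P Psi Top.
Local Notation toC := (@real_complex R : R -> Cplx R).
Local Notation hp j := ((2^-1 : R) ^+ j).
Local Notation psi := (psi Psi).
Local Notation mball := (mball P Psi).
Local Notation Lop := (Lop Top).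
Local Notation Espace := (Espace P Psi).

Lemma Lop_mix t (f g : T -> R) : Espace f -> Espace g ->
  Lop (fun x => t * f x + (1 - t) * g x) = toC t *: Lop f + toC (1 - t) *: Lop g.
Proof.
move=> Ef Eg; rewrite (Lop_lin OPsi blT _ Ef (EspaceZ OPsi _ Eg)).
by rewrite (LopZ OPsi blT _ Eg).
Qed.

Lemma half_powers_small e : 0 < e -> exists N, forall n, (N <= n)%N -> hp n < e.
Proof.
move=> e0; have [N NP] := archimedean_inv e0; exists N => n Nn.
apply: le_lt_trans NP; rewrite exprVn lef_pV2 ?posrE ?exprn_gt0 ?ltr0n//.
by rewrite -natrX ler_nat; apply: leq_ltn_trans (ltn_expl n (isT : (1 < 2)%N)).
Qed.

Variables (V : Type) (mix : R -> V -> V -> V) (C : nat -> set V) (tau : V -> T -> R).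
Hypothesis Cne : forall m, C m !=set0.
Hypothesis Cmono : forall m n, (m <= n)%N -> C n `<=` C m.
Hypothesis Cmix : forall m t u v, 0 <= t <= 1 -> C m u -> C m v -> C m (mix t u v).
Hypothesis taumix : forall t u v x, tau (mix t u v) x = t * tau u x + (1 - t) * tau v x.
Hypothesis tau_ball : forall u, C 0%N u -> mball 2 (tau u).

(** Only [mix] is available on [V], so averages with equal weights are built recursively. *)
Fixpoint avg n (v : nat -> V) : V :=
  if n is n'.+1 then mix n'.+2%:R^-1 (v n'.+1) (avg n' v) else v 0%N.

Lemma tau_avg n v x : tau (avg n v) x = n.+1%:R^-1 * \sum_(i < n.+1) tau (v i) x.
Proof.
elim: n => [|n IH]; first by rewrite big_ord_recl big_ord0 addr0 invr1 mul1r.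
rewrite /= taumix IH [in RHS]big_ord_recr /=.
have n1 : n.+1%:R != 0 :> R by rewrite pnatr_eq0.
have n2 : n.+2%:R != 0 :> R by rewrite pnatr_eq0.
have e : (1 - n.+2%:R^-1) * n.+1%:R^-1 = n.+2%:R^-1 :> R.
  move: n1 n2; rewrite -[n.+2%:R]natr1; move: (n.+1%:R) => a a0 a1.
  by field; rewrite a0 a1.
by rewrite mulrA e mulrDr addrC.
Qed.

Lemma avg_C n v m : (forall i, (i <= n)%N -> C m (v i)) -> C m (avg n v).
Proof.
elim: n => [|n IH] h /=; first exact: h.
apply: Cmix; [|exact: h|by apply: IH => i ile; apply: h; exact: leqW].
by rewrite invr_ge0 ler0n/= invf_le1 ?ltr0n// ler1n.
Qed.

(** The null intersection [N] of the exceptional sets is removed, so that the remaining [B k] have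
    empty intersection. Fatou is applied to [f / 2], which the blocks eventually dominate; this
    gives radius 4 for [f] and [2 + 4 = 6] for the differences. *)
Lemma centered_blocks : exists2 u : nat -> V, (forall m, C m (u m)) &
  exists N f B, [/\ measurable N /\ P N = 0, mball 4 f,
    (forall k, [/\ measurable (B k), (P (B k) <= (hp k)%:E)%E & B k.+1 `<=` B k]),
    \bigcap_k B k = set0 &
    forall j, let dd x := tau (u j) x * \1_(~` N) x - f x in
      mball 6 dd /\ forall x, ~ B j x -> `|dd x| <= hp j].
Proof.
pose mid u v := mix 2^-1 u v.
have half : 0 <= (2^-1 : R) <= 1 by rewrite invr_ge0 ler0n/= invf_le1 ?ltr0n// ler1n.
have Cmid m u v : C m u -> C m v -> C m (mid u v) by exact: Cmix.
have taumid u v x : tau (mid u v) x = (tau u x + tau v x) / 2.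
  by rewrite /mid taumix; lra.
have [u uC [f mf [B BP fP]]] := blocks_limit_in_measure OPsi Cne Cmono Cmid taumid tau_ball.
exists u => //; pose N := \bigcap_k B k.
have mB k : measurable (B k) by have [] := BP k.
have mN : measurable N by exact: bigcap_measurable.
have mCN : measurable (~` N) by exact: measurableC.
have PN : P N = 0.
  apply/eqP; rewrite eq_le measure_ge0 andbT; apply/lee_addgt0Pr => e e0; rewrite add0e.
  have [k kP] := half_powers_small e0.
  have [_ PBk _] := BP k; apply: le_trans (_ : (P (B k) <= _)%E).
    by apply: le_measure; rewrite ?inE// => x; exact.
  by apply: (le_trans PBk); rewrite lee_fin; exact/ltW/kP.
have tb j : mball 2 (tau (u j)) by apply: tau_ball; exact: (Cmono (leq0n j) (uC j)).
pose f' x := f x * \1_(~` N) x.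
have mf' : measurable_fun setT f' by exact: measurable_mul_indic.
have f'4 : mball 4 f'.
  have f'2 : mball 2 (fun x => 2^-1 * f' x).
    split; first exact: measurable_funM.
    apply: (modular_fatou OPsi (g := fun n => tau (u n))) => //.
    - by move=> n; exact: (tb n).1.
    - by move=> n; exact: (tb n).2.
    - exact: measurable_funM.
    move=> x; rewrite /f'; have [Nx|nN] := pselect (N x).
      by exists 0%N => n _; rewrite indic_notin ?mulr0 ?normr0// => /(_ Nx).
    rewrite (indic_mem R (nN : (~` N) x)) mulr1.
    have [fx0|fx0] := eqVneq (f x) 0; first by exists 0%N => n _; rewrite fx0 mulr0 normr0.
    have [k nB] : exists k, ~ B k x.
      by apply: contrapT => h; apply: nN => k _; apply: contrapT => nB; apply: h; exists k.
    have f20 : 0 < `|f x| / 2 by rewrite divr_gt0 ?normr_gt0.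
    have [K KP] := half_powers_small f20.
    exists (maxn k K) => n; rewrite geq_max => /andP[kn Kn].
    rewrite normrM [`|2^-1|]ger0_norm ?invr_ge0// mulrC.
    have := fP k x n nB kn; have := KP n Kn; have := lerB_dist (f x) (tau (u n) x).
    rewrite [`|f x - _|]distrC; move: (hp n) => a; lra.
  have := mballZ OPsi (lt0r_neq0 (ltr0n R 2 : 0 < 2)) f'2.
  rewrite ger0_norm// (_ : 2 * 2 = 4 :> R); last by lra.
  by congr mball; apply/funext => x; rewrite mulrA divff ?mul1r.
exists N, f', (fun k => B k `\` N); split=> // [k||j dd].
- have [_ PBk Bk] := BP k; split; first exact: measurableD.
    apply: le_trans PBk; apply: le_measure; rewrite ?inE//; first exact: measurableD.
  by move=> x [/Bk Bx nN].
- apply/seteqP; split=> // x h; have [_ nN] := h 0%N I.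
  by apply: nN => k _; have [] := h k I.
have ddE x : dd x = (tau (u j) x - f x) * \1_(~` N) x by rewrite /dd /f' mulrBl.
split.
  have h1 : mball 2 (fun x => tau (u j) x * \1_(~` N) x).
    apply: (mball_le OPsi _ _ _ (tb j)) => //; last by move=> x; exact: norm_mul_indic.
    by apply: measurable_mul_indic => //; exact: (tb j).1.
  have h2 := mballZ OPsi (_ : -1 != 0 :> R) f'4.
  rewrite normrN1 mul1r in h2; have := mballD OPsi _ _ h1 (h2 _).
  rewrite (_ : 2 + 4 = 6 :> R); last by lra.
  rewrite (_ : (fun x => _) = dd); last by apply/funext => x; rewrite /dd mulN1r.
  by apply; rewrite ?oppr_eq0 ?oner_eq0.
move=> x nBx; rewrite ddE; have [Nx|nN] := pselect (N x).
  by rewrite indic_notin ?mulr0 ?normr0 ?exprn_ge0// => /(_ Nx).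
rewrite (indic_mem R (nN : (~` N) x)) mulr1; apply: (fP j) => // Bx.
by apply: nBx.
Qed.

(** Averaged over a window of [n + 1] indices, the spikes and the uniformly small parts have images
    of norm at most [e / 8] each, so up to [e / 4] only the order bounded part is left.
    [order_bounded_blocks] handles it, and three errors of [e / 4] remain. *)
Lemma convex_blocks e : 0 < e -> exists2 u : nat -> V, (forall m, C m (u m)) &
  forall m l, rnorm (Lop (fun x => tau (u m) x - tau (u l) x)) <= e.
Proof.
move=> e0; have [u uC [N [f [B [[mN PN] f4 BP B0 ddP]]]]] := centered_blocks.
pose dd j x := tau (u j) x * \1_(~` N) x - f x.
have mB k : measurable (B k) by have [] := BP k.
have PB k : (P (B k) <= (hp k)%:E)%E by have [] := BP k.
have Bdec k : B k.+1 `<=` B k by have [] := BP k.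
have Bmono := decreasing_le Bdec.
have dd6 j : mball 6 (dd j) := (ddP j).1.
have ddB j x : ~ B j x -> `|dd j x| <= hp j by exact: (ddP j).2.
have six0 : 0 < 6 :> R by [].
have [j jS [s [cs [cs0 spos sc sP]]]] := order_bounded_tails OPsi six0 dd6 mB Bdec B0.
have jk k : (k <= j k)%N by elim: k => // k IH; exact: leq_ltn_trans (jS k).
have [M M0 MP] := Lop_bound OPsi blT.
have e1 : 0 < e / (8 * M) by rewrite divr_gt0// mulr_gt0.
have [n [p0 p0P]] := spike_average OPsi six0 dd6 mB Bdec PB jS D2 e1.
have [t0 t00 t0P] := psi_small OPsi.
(* [t0] appears because a function bounded by [a] lies in the ball of radius [a / t0]. *)
have e2 : 0 < e / (8 * M) * t0 by rewrite mulr_gt0.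
have [p1 p1P] := half_powers_small e2.
pose p := maxn p0 p1.
have n0 : 0 < n.+1%:R :> R by rewrite ltr0n.
(* Windows of [n + 1] consecutive indices beyond [p]; the [k]-th starts at [k] or later, which puts
   [W k] in [C k]. *)
pose pk k := (p + k * n.+1)%N.
pose W k := avg n (fun i => u (j (pk k + i)%N)).
pose sk k x := dd (j k) x * \1_(B (j k.+1)) x.
pose rk k x := dd (j k) x * \1_(~` B (j k)) x.
pose av (g : nat -> T -> R) k x := n.+1%:R^-1 * \sum_(i < n.+1) g (pk k + i)%N x.
have msum g k : (forall i, measurable_fun setT (g i)) -> measurable_fun setT (av g k).
  by move=> mg; apply: measurable_funM => //; exact: measurable_sum.
have av_le (g : nat -> T -> R) k x r : (forall i, `|g (pk k + i)%N x| <= r) -> `|av g k x| <= r.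
  move=> gr; rewrite normrM ger0_norm ?invr_ge0// ler_pdivrMl//.
  apply: (le_trans (ler_norm_sum _ _ _)).
  apply: (@le_trans _ _ (\sum_(i < n.+1) r)); first by apply: ler_sum => i _; exact: gr.
  by rewrite sumr_const card_ord mulr_natl.
have CW k : C k (W k).
  apply: avg_C => i _; apply: (Cmono _ (uC _)); apply: leq_trans (jk _).
  by rewrite /pk -addnA addnCA; apply: leq_trans (leq_addr _ _); rewrite leq_pmulr.
have msk k : measurable_fun setT (sk k) by apply: measurable_mul_indic => //; exact: (dd6 _).1.
have mrk k : measurable_fun setT (rk k).
  by apply: measurable_mul_indic; [exact: (dd6 _).1|exact: measurableC].
have bS k : below s (av sk k).
  by split=> [|x]; [exact: msum|apply: av_le => i; exact: sP].
have s0 x : 0 <= s x by exact: ltW.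
have os : order_bounded s s by exists 1 => // x; rewrite mul1r s0/=.
have ES t : below s t -> Espace t by move=> bt; exact: (below_Espace OPsi cs0 s0 sc os bt).
have HB k : mball (e / (8 * M)) (av (spike dd B j) k).
  by apply: p0P; rewrite /pk; apply: leq_trans (leq_addr _ _); exact: leq_maxl.
have RB k : mball (e / (8 * M)) (av rk k).
  rewrite -[e / (8 * M)](mulfK (lt0r_neq0 t00)); apply: (mball_bounded P OPsi) => //; first exact: msum.
  move=> x; apply: av_le => i; rewrite /rk.
  have hpp : hp (j (pk k + i)%N) <= e / (8 * M) * t0.
    apply/ltW/p1P; apply: leq_trans (jk _); rewrite /pk -addnA.
    by apply: leq_trans (leq_addr _ _); exact: leq_maxr.
  have [Bx|nB] := pselect (B (j (pk k + i)%N) x).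
    by rewrite indic_notin ?mulr0 ?normr0 ?(ltW e2)// => /(_ Bx).
  by rewrite (indic_mem R (nB : (~` _) x)) mulr1; exact: le_trans (ddB _ _ nB) hpp.
have EH k : Espace (av (spike dd B j) k) by exists (e / (8 * M)).
have ER k : Espace (av rk k) by exists (e / (8 * M)).
have Ef : Espace f by exists 4.
have Etau v : C 0%N v -> Espace (tau v) by move=> Cv; exists 2 => //; exact: tau_ball.
have mCN : measurable (~` N) by exact: measurableC.
have close k : rnorm (Lop (tau (W k)) - Lop f - Lop (av sk k)) <= e / 4.
  have CW0 := Cmono (leq0n k) (CW k); have EW := Etau _ CW0.
  have mW := Espace_measurable EW.
  have EW1 : Espace (fun x => tau (W k) x * \1_(~` N) x).
    apply: (Espace_le OPsi _ _ EW); first exact: measurable_mul_indic.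
    by move=> x; exact: norm_mul_indic.
  have EW2 : Espace (fun x => tau (W k) x * \1_N x).
    apply: (Espace_le OPsi _ _ EW); first exact: measurable_mul_indic.
    by move=> x; exact: norm_mul_indic.
  have W2 : Lop (fun x => tau (W k) x * \1_N x) = 0.
    apply: (Lop_null OPsi blT); first exact: measurable_mul_indic.
    apply/eqP; rewrite eq_le measure_ge0 andbT -PN; apply: le_measure; rewrite ?inE//.
      rewrite (_ : [set x | _] = (fun x => tau (W k) x * \1_N x) @^-1` [set~ 0]).
        rewrite -[X in measurable X]setTI; apply: measurable_mul_indic => //.
        exact: measurableC.
      by apply/seteqP; split=> x /=; [move/eqP|move=> ?; apply/eqP].
    by move=> x /= h; apply: contrapT => nN; move: h; rewrite indic_notin// mulr0 eqxx.
  have -> : Lop (tau (W k)) = Lop (fun x => tau (W k) x * \1_(~` N) x).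
    rewrite -[RHS]addr0 -W2 -(LopD OPsi blT EW1 EW2); congr Lop; apply/funext => x.
    by rewrite !indicE in_setC; case: (x \in N); rewrite /= ?mulr1 ?mulr0 ?addr0 ?add0r.
  have ESk := ES _ (bS k).
  rewrite -(LopB OPsi blT EW1 Ef) -(LopB OPsi blT (EspaceB OPsi EW1 Ef) ESk).
  (* Once the part on [B (j k.+1)] is subtracted, the layer between [B (j k.+1)] and [B (j k)] and
     the complement of [B (j k)] are left. *)
  rewrite (_ : (fun x => _) = (fun x => av (spike dd B j) k x + av rk k x)); last first.
    apply/funext => x; rewrite /W tau_avg.
    have -> : n.+1%:R^-1 * (\sum_(i < n.+1) tau (u (j (pk k + i)%N)) x) * \1_(~` N) x - f x =
        n.+1%:R^-1 * \sum_(i < n.+1) dd (j (pk k + i)%N) x.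
      rewrite /dd sumrB sumr_const card_ord -mulr_suml mulrBr mulrA; congr (_ - _).
      by rewrite -[f x *+ _]mulr_natl mulKf// gt_eqF.
    rewrite /av -mulrBr -mulrDr -sumrB -big_split /=; congr (_ * _); apply: eq_bigr => i _.
    rewrite /sk /rk /spike -[X in X - _]mulr1 -mulrBr -mulrDr; congr (_ * _).
    rewrite !indicE in_setD in_setC; have := Bmono _ _ (ltnW (jS (pk k + i)%N)) x.
    case: (boolP (x \in B (j (pk k + i).+1))) => [/set_mem Bx /(_ Bx) Bx'|_ _].
      by rewrite (mem_set Bx') /= subrr addr0.
    by case: (x \in B (j (pk k + i))); rewrite /= subr0 ?addr0 ?add0r.
  rewrite (LopD OPsi blT (EH k) (ER k)); apply: (le_trans (rnormD _ _)).
  have := MP _ _ e1 (HB k); have := MP _ _ e1 (RB k).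
  have -> : M * (e / (8 * M)) = e / 8 by field; rewrite gt_eqF.
  lra.
(* A block and its order bounded part are mixed with the same coefficients, so the estimate [close]
   passes to every convex combination. *)
pose pmix t (a b : V * (T -> R)) : V * (T -> R) :=
  (mix t a.1 b.1, fun x => t * a.2 x + (1 - t) * b.2 x).
pose C' m := hull pmix [set (W k, av sk k) | k in [set k | (m <= k)%N]].
have C'P m a : C' m a -> [/\ C m a.1, below s a.2 &
    rnorm (Lop (tau a.1) - Lop f - Lop a.2) <= e / 4].
  apply: (@hull_min _ _ pmix _ [set a | [/\ C m a.1, below s a.2 &
    rnorm (Lop (tau a.1) - Lop f - Lop a.2) <= e / 4]]).
    move=> _ [k /= mk <-]; split=> //=; exact: (Cmono mk (CW k)).
  move=> t a1 b1 t01 [/= Ca [ma sa] ca] [Cb [mb sb] cb]; have /andP[t0' t1'] := t01.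
  split=> /=; first exact: Cmix.
    split=> [|x]; first by apply: measurable_funD; exact: measurable_funM.
    apply: (le_trans (ler_normD _ _)); rewrite !normrM (ger0_norm t0') (@ger0_norm _ (1 - t)) ?subr_ge0//.
    have := ler_wpM2l t0' (sa x); have t1'' : 0 <= 1 - t by rewrite subr_ge0.
    by have := ler_wpM2l t1'' (sb x); lra.
  have E1 := Etau _ (Cmono (leq0n m) Ca); have E2 := Etau _ (Cmono (leq0n m) Cb).
  have F1 := ES a1.2 (conj ma sa); have F2 := ES b1.2 (conj mb sb).
  rewrite (_ : tau (mix t a1.1 b1.1) = (fun x => t * tau a1.1 x + (1 - t) * tau b1.1 x)); last first.
    by apply/funext => x; exact: taumix.
  rewrite (Lop_mix t E1 E2) (Lop_mix t F1 F2).
  have -> : toC t *: Lop (tau a1.1) + toC (1 - t) *: Lop (tau b1.1) - Lop f -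
      (toC t *: Lop a1.2 + toC (1 - t) *: Lop b1.2) =
      toC t *: (Lop (tau a1.1) - Lop f - Lop a1.2) +
      toC (1 - t) *: (Lop (tau b1.1) - Lop f - Lop b1.2).
    have fE : Lop f = toC t *: Lop f + toC (1 - t) *: Lop f.
      by rewrite -scalerDl -toCD subrKC scale1r.
    rewrite {1}fE !scalerBr !opprD.
    by rewrite (addrACA (toC t *: Lop (tau a1.1))) [LHS]addrACA.
  apply: (le_trans (rnormD _ _)); rewrite !rnormZr (ger0_norm t0') (@ger0_norm _ (1 - t)) ?subr_ge0//.
  have := ler_wpM2l t0' ca; have t1'' : 0 <= 1 - t by rewrite subr_ge0.
  by have := ler_wpM2l t1'' cb; lra.
have half : 0 <= (2^-1 : R) <= 1 by rewrite invr_ge0 ler0n/= invf_le1 ?ltr0n// ler1n.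
have e4 : 0 < e / 4 by rewrite divr_gt0.
have [|||||q qC qP] := @order_bounded_blocks _ _ _ P Psi OPsi Z Top blT nofix s cs cs0 spos sc
  _ (pmix 2^-1) C' snd _ _ _ _ _ _ e4.
- by move=> m; exists (W m, av sk m); apply: hull_gen; exists m => /=.
- by move=> m l ml; apply: hullS => _ [k /= lk <-]; exists k => //=; exact: leq_trans lk.
- by move=> m a b Ca Cb; exact: hull_mix.
- by move=> a b x /=; lra.
- by move=> a /C'P[].
exists (fun m => (q m).1) => [m|m l]; first by have [] := C'P _ _ (qC m).
have [Cm bm cm] := C'P _ _ (qC m); have [Cl bl cl] := C'P _ _ (qC l).
have := qP m l.
rewrite (LopB OPsi blT (ES _ bm) (ES _ bl)).
rewrite (LopB OPsi blT (Etau _ (Cmono (leq0n m) Cm)) (Etau _ (Cmono (leq0n l) Cl))).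
move: (Lop (tau (q m).1)) (Lop (tau (q l).1)) (Lop (q m).2) (Lop (q l).2) (Lop f) cm cl.
move=> a b a' b' h ca cb ab.
have -> : a - b = (a - h - a') + (a' - b') - (b - h - b').
  by rewrite addrA subrK -!(addrA _ (- h)) -!opprD opprB addrA subrK.
apply: (le_trans (rnormD _ _)); rewrite rnormN.
by have := rnormD (a - h - a') (a' - b'); lra.
Qed.

End MainBlocks.

(** * The complex case *)

Section ComplexBlocks.
Context (d : measure_display) (T : measurableType d) (R : realType).
Variables (P : probability T R) (Psi : \bar R -> \bar R).
Hypothesis OPsi : Orlicz_function Psi.
Hypothesis D2 : Delta2 (complementary Psi).
Variables (Z : completeNormedModType (Cplx R)) (Top : (T -> Cplx R) -> Z).
Hypothesis blT : bounded_linear_on_orlicz P Psi Top.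
Hypothesis nofix : ~ fixes_c0 P Psi Top.
Local Notation toC := (@real_complex R : R -> Cplx R).
Local Notation normc := (@ComplexField.Normc.normc R).
Local Notation Lop := (Lop Top).
Local Notation Espace := (Espace P Psi).
Local Notation cball := (cball P Psi).
Implicit Types (F G : T -> Cplx R) (t c : R).

Definition repart F x := complex.Re (F x : R[i]).
Definition impart F x := complex.Im (F x : R[i]).
Definition fmix t F G : T -> Cplx R := fun x => toC t * F x + toC (1 - t) * G x.

Lemma repart_mix t F G x : repart (fmix t F G) x = t * repart F x + (1 - t) * repart G x.
Proof.
by rewrite /repart /fmix; case: (F x) => a b; case: (G x) => a' b' /=; ring.
Qed.

Lemma impart_mix t F G x : impart (fmix t F G) x = t * impart F x + (1 - t) * impart G x.
Proof.
by rewrite /impart /fmix; case: (F x) => a b; case: (G x) => a' b' /=; ring.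
Qed.

Lemma norm_im_normc (w : R[i]) : `|complex.Im w| <= normc w.
Proof.
by case: w => a b /=; rewrite -sqrtr_sqr ler_wsqrtr// lerDr sqr_ge0.
Qed.

Lemma cball_repart c F : 0 < c -> cball c F -> mball P Psi c (repart F).
Proof.
move=> c0 [mF Fc]; apply: (mball_le OPsi c0 _ _ Fc); first exact: mF.1.
by move=> x; rewrite [leRHS]ger0_norm ?normc_ge0// norm_re_normc.
Qed.

Lemma cball_impart c F : 0 < c -> cball c F -> mball P Psi c (impart F).
Proof.
move=> c0 [mF Fc]; apply: (mball_le OPsi c0 _ _ Fc); first exact: mF.2.
by move=> x; rewrite [leRHS]ger0_norm ?normc_ge0// norm_im_normc.
Qed.

Lemma cball_fmix c t F G : 0 < c -> 0 <= t <= 1 -> cball c F -> cball c G ->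
  cball c (fmix t F G).
Proof.
move=> c0 t01 [mF Fc] [mG Gc]; have /andP[t0 t1] := t01.
have mz : cmeasurable (fun _ : T => 0 : Cplx R) by split; exact: measurable_cst.
have mm : cmeasurable (fmix t F G).
  apply: cmeasurable_lin => //.
  have := cmeasurable_lin (toC (1 - t)) mG mz.
  by congr cmeasurable; apply/funext => x; rewrite addr0.
split=> //; apply: (mball_le OPsi c0 _ _ (mball_mix OPsi t01 Fc Gc)).
  exact: cmeasurable_normc.
move=> x; rewrite ger0_norm ?normc_ge0// ger0_norm; last first.
  by rewrite addr_ge0// mulr_ge0 ?normc_ge0 ?subr_ge0.
apply: (le_trans (le_normcD _ _)); rewrite !ComplexField.Normc.normcM !normc_toC.
by rewrite !ger0_norm ?subr_ge0.
Qed.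

Lemma Top_fmix t F G : cball 2 F -> cball 2 G ->
  Top (fmix t F G) = cmix t (Top F) (Top G).
Proof.
move=> F2 G2; have two0 : 0 < 2 :> R by [].
have zc : cball 2 (fun=> 0).
  apply: (cball_real OPsi two0 (f := fun=> 0)); apply: (mball_null OPsi) => //.
  by rewrite (_ : [set x | _] = set0) ?measure0//; apply/seteqP; split=> x //=; rewrite eqxx.
have T0 : Top (fun=> 0) = 0 by exact: (Lop0 OPsi blT).
have G2' : Top (fun x => toC (1 - t) * G x) = toC (1 - t) *: Top G.
  have := Top_lin OPsi blT (toC (1 - t)) two0 two0 G2 zc; rewrite T0 addr0 => <-.
  by congr Top; apply/funext => x; rewrite addr0.
(* For [t = 1] the radius [|1 - t| * 2] of the second summand would be 0, while radii have to be
   positive. *)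
rewrite /cmix -G2'; have [->|t1] := eqVneq t 1.
  have -> : Top (fun x => toC (1 - 1) * G x) = 0.
    by rewrite -T0; congr Top; apply/funext => x; rewrite subrr mul0r.
  rewrite addr0 scale1r; congr Top; apply/funext => x.
  by rewrite /fmix subrr mul0r addr0 mul1r.
have t1' : 0 < `|1 - t| by rewrite normr_gt0 subr_eq0 eq_sym.
have cG : cball (`|1 - t| * 2) (fun x => toC (1 - t) * G x).
  have mz : cmeasurable (fun _ : T => 0 : Cplx R) by split; exact: measurable_cst.
  have mm : cmeasurable (fun x => toC (1 - t) * G x).
    have := cmeasurable_lin (toC (1 - t)) G2.1 mz.
    by congr cmeasurable; apply/funext => x; rewrite addr0.
  split=> //; have := mballZ OPsi (_ : 1 - t != 0) G2.2.
  rewrite -normr_gt0 => /(_ t1'); apply: (mball_le OPsi _ _ _).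
  - by rewrite mulr_gt0.
  - exact: cmeasurable_normc.
  - move=> x; rewrite ComplexField.Normc.normcM normc_toC !normrM normr_id.
    by rewrite lexx.
exact: (Top_lin OPsi blT _ two0 (mulr_gt0 t1' two0) F2 cG).
Qed.

Lemma Top_split F : cball 2 F ->
  Top F = ('i%C : Cplx R) *: Lop (impart F) + Lop (repart F).
Proof.
move=> F2; have two0 : 0 < 2 :> R by [].
have cI := cball_real OPsi two0 (cball_impart two0 F2).
have cR := cball_real OPsi two0 (cball_repart two0 F2).
rewrite !LopE -(Top_lin OPsi blT _ two0 two0 cI cR); congr Top.
by apply/funext => x; rewrite /repart /impart addrC [LHS]complexE.
Qed.

Lemma hull_Top (F_ : nat -> T -> Cplx R) (S : set nat) G :
  (forall k, cball 2 (F_ k)) -> hull fmix [set F_ k | k in S] G ->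
  hull (@cmix R Z) [set Top (F_ k) | k in S] (Top G).
Proof.
move=> F2 hG; suff [] : cball 2 G /\ hull (@cmix R Z) [set Top (F_ k) | k in S] (Top G) by [].
elim: hG => [_ [k Sk <-]|t F G' t01 _ [cF hF] _ [cG hG]].
  by split=> //; apply: hull_gen; exists k.
by split; [exact: cball_fmix|rewrite Top_fmix//; exact: hull_mix].
Qed.

(** Two passes: the real parts of [G1] have close images, and [G2] consists of blocks of [G1] whose
    imaginary parts have close images. Closeness for the real parts is inherited by convex
    combinations of the [G1]. *)
Lemma complex_blocks (F_ : nat -> T -> Cplx R) e : (forall k, cball 2 (F_ k)) -> 0 < e ->
  exists2 G : nat -> T -> Cplx R,
    (forall m, hull fmix [set F_ k | k in [set k | (m <= k)%N]] (G m)) &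
    forall m l, rnorm (Top (G m) - Top (G l)) < e.
Proof.
move=> F2 e0; have two0 : 0 < 2 :> R by [].
have e4 : 0 < e / 4 by rewrite divr_gt0.
pose tl (H : nat -> T -> Cplx R) m := hull fmix [set H k | k in [set k | (m <= k)%N]].
have tlball H : (forall k, cball 2 (H k)) -> forall m, tl H m `<=` cball 2.
  move=> H2 m; apply: hull_min => [_ [k _ <-]//|t F G t01].
  exact: cball_fmix.
have tlne H m : tl H m !=set0 by exists (H m); apply: hull_gen; exists m => /=.
have tlmono H m n : (m <= n)%N -> tl H n `<=` tl H m.
  by move=> mn; apply: hullS => _ [k /= nk <-]; exists k => //=; exact: leq_trans nk.
have tlmix H m t F G : 0 <= t <= 1 -> tl H m F -> tl H m G -> tl H m (fmix t F G).
  exact: hull_mix.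
have [G1 G1C G1P] := convex_blocks OPsi D2 blT nofix (tlne F_) (@tlmono F_) (@tlmix F_)
  repart_mix (fun F h => cball_repart two0 (tlball _ F2 _ _ h)) e4.
have G12 k : cball 2 (G1 k) by exact: tlball (G1C k).
have [G2 G2C G2P] := convex_blocks OPsi D2 blT nofix (tlne G1) (@tlmono G1) (@tlmix G1)
  impart_mix (fun F h => cball_impart two0 (tlball _ G12 _ _ h)) e4.
have G22 k : cball 2 (G2 k) by exact: tlball (G2C k).
have Er F : cball 2 F -> Espace (repart F) by move=> h; exists 2 => //; exact: cball_repart.
have Ei F : cball 2 F -> Espace (impart F) by move=> h; exists 2 => //; exact: cball_impart.
have near_convex a : forall m,
    (forall k, rnorm (a - Lop (repart (G1 k))) <= e / 4) ->
    forall G, tl G1 m G -> rnorm (a - Lop (repart G)) <= e / 4.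
  move=> m h G hG; suff [] : cball 2 G /\ rnorm (a - Lop (repart G)) <= e / 4 by [].
  elim: hG => [_ [k _ <-]//|t F G' t01 _ [cF hF] _ [cG hG']].
  split; first exact: cball_fmix.
  have -> : repart (fmix t F G') = (fun x => t * repart F x + (1 - t) * repart G' x).
    by apply/funext => x; exact: repart_mix.
  rewrite (Lop_mix OPsi blT t (Er _ cF) (Er _ cG)).
  have -> : a - (toC t *: Lop (repart F) + toC (1 - t) *: Lop (repart G')) =
      toC t *: (a - Lop (repart F)) + toC (1 - t) *: (a - Lop (repart G')).
    by rewrite !scalerBr addrACA -scalerDl -toCD subrKC scale1r opprD.
  have /andP[t0 t1] := t01; have t1' : 0 <= 1 - t by rewrite subr_ge0.
  apply: (le_trans (rnormD _ _)); rewrite !rnormZr (ger0_norm t0) (ger0_norm t1').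
  by have := ler_wpM2l t0 hF; have := ler_wpM2l t1' hG'; lra.
exists G2 => [m|m l].
  have : tl G1 m (G2 m) by exact: G2C.
  apply: hull_min => [_ [k /= mk <-]|t F G t01]; last exact: hull_mix.
  exact: (tlmono _ _ _ mk _ (G1C k)).
have hre : rnorm (Lop (repart (G2 m)) - Lop (repart (G2 l))) <= e / 4.
  apply: (near_convex _ l) => [k|]; last exact: G2C.
  rewrite rnorm_distC; apply: (near_convex _ m) => [k'|]; last exact: G2C.
  by rewrite -(LopB OPsi blT (Er _ (G12 k)) (Er _ (G12 k'))).
have him := G2P m l.
rewrite (LopB OPsi blT (Ei _ (G22 m)) (Ei _ (G22 l))) in him.
rewrite !Top_split// opprD addrACA -scalerBr; apply: (le_lt_trans (rnormD _ _)).
rewrite rnormZ (_ : normc _ = 1); last first.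
  by rewrite /= expr0n add0r expr1n sqrtr1.
rewrite mul1r; lra.
Qed.

Lemma nofix_weakly_compact : weakly_compact_op P Psi Top.
Proof.
have [M M0 MP] := operator_bound OPsi blT; have two0 : 0 < 2 :> R by [].
apply: (@weakly_compact_of_blocks R Z _ (M * 2)).
  by move=> _ [F [FX F1] <-]; apply: MP => //; exact: luxemburg_ball.
move=> x xA e e0.
have /choice[F_ F_P] : forall k, exists F, cball 2 F /\ Top F = x k.
  by move=> k; have [F [FX F1] FE] := xA k; exists F; split=> //; exact: luxemburg_ball.
have F2 k : cball 2 (F_ k) by exact: (F_P k).1.
have xE : x = Top \o F_ by apply/funext => k; rewrite /= (F_P k).2.
have [G GC GP] := complex_blocks F2 e0.
(* Finitely many generators span [G 0], all of index below some [m]; [G m] then uses only indices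
   from [m] on. *)
have [m hm] : exists m, hull fmix [set F_ k | k in [set k | (k < m)%N]] (G 0%N).
  by apply: hull_initial; apply: hullS (GC 0%N) => _ [k _ <-]; exists k.
exists m, (Top (G 0%N)), (Top (G m)); split; last exact: GP.
  by rewrite xE; exact: hull_Top.
by rewrite xE; exact: hull_Top.
Qed.

End ComplexBlocks.

Theorem mainTheorem2 (d : measure_display) (T : measurableType d) (R : realType)
    (P : probability T R) (Psi : \bar R -> \bar R) :
  ~ purely_atomic P ->
  Orlicz_function Psi ->
  Delta2 (complementary Psi) ->
  orlicz_property_V P Psi.
Proof.
move=> _ OPsi D2 Z Top blT nwc; apply: contrapT => nofix; apply: nwc.
exact: nofix_weakly_compact.
Qed.
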